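(* Let $k\ge 6$ be an integer, and suppose that $\alpha\in\mathbb{R}$, $a\in\mathbb{Z}$ and $q\in\mathbb{N}$ satisfy $(a,q)=1$ and $|\alpha-a/q|\le q^{-2}$. Then for each $\varepsilon>0$, one has $$f_k(\alpha;X)\ll X^{1+\varepsilon}\Theta^{2^{-k}}+X^{1+\varepsilon}(\Theta/X)^{\frac{2}{3}2^{-k}},$$ where $\Theta=q^{-1}+X^{-3}+qX^{-k}$.
   Context: Write $e(z)=e^{2\pi i z}$. $X\ge 1$ is a real number (the main parameter), and $f_k(\alpha;X)=\sum_{1\le x\le X}e(\alpha x^k)$, the sum being over integers $x$. Here $\mathbb{N}$ is the set of positive integers and $(a,q)$ is the greatest common divisor. The notation $A\ll B$ means $|A|\le CB$, where the constant $C>0$ may depend on $\varepsilon$ and $k$ but not on $X$, $\alpha$, $a$ or $q$. *)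

(* Defs.v *)
From mathcomp Require Import all_boot all_order all_algebra complex.
From mathcomp Require Import reals exp trigo.

Set Implicit Arguments.
Unset Strict Implicit.
Unset Printing Implicit Defensive.

Import Order.TTheory GRing.Theory Num.Theory.

Local Open Scope ring_scope.
Local Open Scope complex_scope.

(* [e(z) = exp (2 pi i z)] for real [z], through Euler's formula. *)
Definition e (R : realType) (z : R) : R[i] :=
  cos (2 * pi * z) +i* sin (2 * pi * z).

(* For [0 <= X], [Num.truncn X] is the integer part of [X], so that [x] runs
   over the integers with [1 <= x <= X]. *)
Definition weyl_sum (R : realType) (k : nat) (alpha X : R) : R[i] :=
  \sum_(1 <= x < (Num.truncn X).+1) e (alpha * x%:R ^+ k).

Definition Theta (R : realType) (k q : nat) (X : R) : R :=
  q%:R^-1 + X ^- 3 + q%:R * X ^- k.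

(* Main.v *)
Require Import Defs.
From mathcomp Require Import all_boot all_order all_algebra complex.
From mathcomp Require Import boolp reals exp trigo.
From mathcomp Require Import zify ring lra.

(** Put [r = k - 3] and let [N] be the integer part of [X].  Differencing the
    sum [r] times bounds the power [2 ^ r] of [|f| / N] by [1 / N] plus the
    average, over the boxes [h] in [[1, N)^r], of [v h = |S h| / N], where
    [S h] is an exponential sum over a cubic polynomial of leading coefficient
    [alpha * (k! / 6) * h_1 ... h_r] ([weyl_differencing], [diffs_monomial]).
    As [alpha] is close to [a / q], the divisor bound shows that at most
    [D << N^(r + eps) * Theta] of the frequencies [b h = alpha * k! * h_1 ... h_r]
    lie in a given arc of length [N^-3] ([frequency_count]).  What remains is a
    pair of mean values of cubic sums over frequencies spread out in this way,
    uniform in the lower coefficients.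

    Approximate each [b h] by a fraction [u / s] with [s <= 4 * N^2].  If
    [s <= N] (major arcs), Weyl's inequality gives [v h ^ 4 << N^eps / (s * (1
    + N^3 * |b h - u / s|))], and there are few arcs with a small denominator
    and a small distance: the sum of [v h ^ 8] is [<< N^eps * D]
    ([major_arc_bound], [major_eighth_moment]).  If [s > N] (minor arcs), the
    translation [n -> n - 2 * z] does not change [|S h|] but moves the
    quadratic coefficient by [- z * b h]; since [b h] is badly approximable,
    the [N] values of [z] spread these coefficients out at scale [N^-2].  One
    large cubic sum thus produces [N] large values, at well spaced points, of
    the sum of [e (x * n + y * n^2 + z * n^3)], and the large sieve compares
    their twelfth moment with the number of solutions of Vinogradov's cubic
    system in twelve variables: the sum of [v h ^ 12] is [<< N^eps * D / N]
    ([large_sieve], [minor_twelfth_moment]).  Holder's inequality turns these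
    moments into the averages [Theta^(1/8)] and [(Theta / X)^(1/12)], and the
    root of order [2 ^ r] gives the exponents [2^-k] and [(2/3) * 2^-k].

    The count of solutions of Vinogradov's system, [<< N^(6 + eps)]
    ([vinogradov_cubic]), is proved by Wooley's efficient congruencing in the
    form given to it by Heath-Brown.  For a fixed prime [p], solutions whose
    first variables agree modulo [p^a], and the others modulo [p^b], are forced
    to satisfy stronger congruences ([mu1_lift], [mu2_lift]); combined with
    the log-convexity of mixed moments this gives a recursion which sends
    [(a, b)] to [(b, 2b - a)] and [(b, 3b)] and gains a factor at each step
    ([mu2_iter]).  All moments are averages over a finite grid, and factors
    [N^eps] are carried by the predicate [slow]. *)

Set Implicit Arguments.
Unset Strict Implicit.
Unset Printing Implicit Defensive.

Import Order.TTheory GRing.Theory Num.Theory.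
Local Open Scope ring_scope.
Local Open Scope complex_scope.

(** * Exponentials and distances to the nearest integer *)

Section Exponential.
Variable R : realType.
Implicit Types (z w : R[i]) (x y t : R).

(** A real-valued modulus: the norm of [R[i]] takes its values in [R[i]]. *)
Definition mag z : R := Num.sqrt (complex.Re z ^+ 2 + complex.Im z ^+ 2).

Lemma magE z : `|z| = (mag z)%:C.
Proof. by rewrite normc_def. Qed.

Lemma mag_normc z : mag z = ComplexField.Normc.normc z.
Proof. by case: z. Qed.

Lemma mag_ge0 z : 0 <= mag z.
Proof. exact: sqrtr_ge0. Qed.

Lemma magM z w : mag (z * w) = mag z * mag w.
Proof. by rewrite !mag_normc ComplexField.Normc.normcM. Qed.

Lemma magN z : mag (- z) = mag z.
Proof. by rewrite !mag_normc normcN. Qed.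

Lemma mag0 : mag 0 = 0.
Proof. by rewrite mag_normc ComplexField.Normc.normc0. Qed.

Lemma mag1 : mag 1 = 1.
Proof. by rewrite mag_normc ComplexField.Normc.normc1. Qed.

Lemma magX z n : mag (z ^+ n) = mag z ^+ n.
Proof. by elim: n => [|n IH]; rewrite ?mag1 // !exprS magM IH. Qed.

Lemma mag_real x : mag x%:C = `|x|.
Proof. by rewrite /mag /= expr0n addr0 sqrtr_sqr. Qed.

Lemma magD z w : mag (z + w) <= mag z + mag w.
Proof. by rewrite !mag_normc le_normcD. Qed.

Lemma mag_sum (I : Type) (r : seq I) (P : pred I) (F : I -> R[i]) :
  mag (\sum_(i <- r | P i) F i) <= \sum_(i <- r | P i) mag (F i).
Proof.
elim/big_ind2: _ => [|x1 x2 y1 y2 h1 h2|//]; first by rewrite mag0.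
exact: le_trans (magD _ _) (lerD h1 h2).
Qed.

Lemma mag_prod (I : Type) (r : seq I) (P : pred I) (F : I -> R[i]) :
  mag (\prod_(i <- r | P i) F i) = \prod_(i <- r | P i) mag (F i).
Proof. exact: (big_morph mag magM mag1). Qed.

Lemma mag_conj z : mag z^* = mag z.
Proof. by case: z => a b; rewrite /mag /= sqrrN. Qed.

Lemma sqr_mag z : ((mag z) ^+ 2)%:C = z * z^*.
Proof.
case: z => a b; rewrite /mag /= sqr_sqrtr ?addr_ge0 ?sqr_ge0 //.
by apply/eqP; rewrite eq_complex /=; apply/andP; split; apply/eqP; ring.
Qed.

Lemma mag_Re z : complex.Re z <= mag z.
Proof.
apply: le_trans (ler_norm _) _; rewrite -sqrtr_sqr ler_wsqrtr //.
by rewrite lerDl sqr_ge0.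
Qed.

Lemma eD x y : e (x + y) = e x * e y.
Proof.
apply/eqP; rewrite eq_complex /e /= !mulrDr cosD sinD eqxx /=.
by apply/eqP; ring.
Qed.

Lemma e0 : e (0 : R) = 1.
Proof. by rewrite /e mulr0 cos0 sin0. Qed.

Lemma eN x : e (- x) = (e x)^*.
Proof. by rewrite /e mulrN cosN sinN. Qed.

Lemma mag_e x : mag (e x) = 1.
Proof. by rewrite /mag /= cos2Dsin2 sqrtr1. Qed.

Lemma e_sum (I : Type) (r : seq I) (P : pred I) (F : I -> R) :
  e (\sum_(i <- r | P i) F i) = \prod_(i <- r | P i) e (F i).
Proof. exact: (big_morph (@e R) eD e0). Qed.

Lemma e_mulrn x n : e (x *+ n) = e x ^+ n.
Proof. by elim: n => [|n IH]; rewrite ?mulr0n ?e0 // mulrS eD IH exprS. Qed.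

Lemma e1 : e (1 : R) = 1.
Proof. by rewrite /e mulr1 mulr_natl cos2pi sin2pi. Qed.

Lemma e_nat n : e (n%:R : R) = 1.
Proof. by rewrite e_mulrn e1 expr1n. Qed.

Lemma e_int (n : int) : e (n%:~R : R) = 1.
Proof.
case: n => n; first exact: e_nat.
by rewrite NegzE rmorphN /= eN e_nat conjc1.
Qed.

Lemma eB x y : e (x - y) = e x * (e y)^*.
Proof. by rewrite eD eN. Qed.

Definition fr x : R := x - (Num.floor x)%:~R.

Lemma fr_ge0 x : 0 <= fr x.
Proof. by rewrite subr_ge0 floor_le. Qed.

Lemma fr_lt1 x : fr x < 1.
Proof. by rewrite ltrBlDl -[X in _ + X]/(1%:~R) -intrD floorD1_gt. Qed.

Lemma fr_id x : 0 <= x < 1 -> fr x = x.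
Proof.
by move=> hx; rewrite /fr (@floor_def _ _ 0) ?subr0 // add0r.
Qed.

Lemma frDz x (n : int) : fr (x + n%:~R) = fr x.
Proof. by rewrite /fr floorDrz ?intr_int // intrKfloor intrD; ring. Qed.

Lemma fr_uniq x y (n : int) : x = y + n%:~R -> 0 <= y < 1 -> fr x = y.
Proof. by move=> -> hy; rewrite frDz fr_id. Qed.

Lemma fr_eqz x : x = fr x + (Num.floor x)%:~R.
Proof. by rewrite /fr; ring. Qed.

Lemma e_fr x : e (fr x) = e x.
Proof. by rewrite {2}(fr_eqz x) eD e_int mulr1. Qed.

Lemma mag_1Be_mul x n : mag (1 - e (x *+ n)) <= n%:R * mag (1 - e x).
Proof.
elim: n => [|n IH]; first by rewrite mulr0n e0 subrr mag0 mul0r.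
rewrite mulrS eD -natr1 mulrDl mul1r.
have -> : 1 - e x * e (x *+ n) = (1 - e x) + e x * (1 - e (x *+ n)).
  by rewrite mulrBr mulr1 addrA subrK.
by apply: le_trans (magD _ _) _; rewrite magM mag_e mul1r addrC lerD2r.
Qed.

Lemma mag_1Be_ge1 x : 1 / 4 <= x <= 3 / 4 -> 1 <= mag (1 - e x).
Proof.
move=> hx; apply: le_trans (mag_Re _).
have : 0 <= sin (2 * pi * x - pi / 2).
  by apply: sin_ge0_pi; have := pi_gt0 R; nra.
by rewrite sinBpihalf /= => ?; lra.
Qed.

(** Multiplying [x] by a suitable [n <= 1 / (2 x)] pushes it to distance at
    least [1/4] from the integers, where [1 - e] has modulus at least 1; this
    costs a factor [n] only. *)
Lemma mag_1Be_half x : 0 < x <= 1 / 2 -> 2 * x <= mag (1 - e x).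
Proof.
move=> /andP[x0 x1].
have [hx|hx] := leP (1 / 4) x.
  by apply: le_trans (mag_1Be_ge1 _); lra.
pose n := (Num.truncn ((4 * x)^-1)).+1.
have hn : (4 * x)^-1 < n%:R by exact: truncnS_gt.
have hn2 : n%:R <= (4 * x)^-1 + 1.
  rewrite /n -natr1 lerD2r truncn_le // invr_ge0; lra.
have e1 : (4 * x)^-1 * x = 1 / 4 by field; rewrite gt_eqF.
have h1 : 1 / 4 <= x *+ n.
  by have := ler_wpM2r (ltW x0) (ltW hn); rewrite e1 mulr_natl.
have h2 : x *+ n <= 1 / 2.
  by have := ler_wpM2r (ltW x0) hn2; rewrite mulrDl e1 mulr_natl; lra.
have h3 : 1 <= n%:R * mag (1 - e x).
  by apply: le_trans (mag_1Be_mul _ _); apply: mag_1Be_ge1; lra.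
have n0 : 0 < n%:R :> R by rewrite ltr0n.
rewrite -(ler_pM2l n0); apply: le_trans h3.
by move: h2; rewrite -mulr_natl; lra.
Qed.

Definition dist x : R := Num.min (fr x) (1 - fr x).

Lemma mag_1Be x : 2 * dist x <= mag (1 - e x).
Proof.
rewrite -e_fr /dist; have := fr_ge0 x; have := fr_lt1 x.
move: (fr x) => u u1 u0.
have [hu|hu] := leP u (1 - u).
  have [->|un0] := eqVneq u 0; first by rewrite mulr0 mag_ge0.
  by apply: mag_1Be_half; rewrite lt_def un0 u0 /=; lra.
have -> : 1 - e u = - (e u * (1 - e (1 - u))).
  rewrite mulrBr mulr1 -eD; have -> : u + (1 - u) = 1 by ring.
  by rewrite e1 opprB.
by rewrite magN magM mag_e mul1r; apply: mag_1Be_half; lra.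
Qed.

Lemma dist_ge0 x : 0 <= dist x.
Proof. by rewrite le_min fr_ge0 subr_ge0 ltW ?fr_lt1. Qed.

(** The size of a sum of [N] terms in geometric progression of ratio [e t].
    The case [dist t = 0] is separate because the inverse of 0 is 0. *)
Definition geo (N : R) t : R := if dist t == 0 then N else Num.min N (dist t)^-1.

Lemma geo_le N t : geo N t <= N.
Proof. by rewrite /geo; case: ifP => // _; rewrite ge_min lexx. Qed.

Lemma geo_ge0 N t : 0 <= N -> 0 <= geo N t.
Proof.
by move=> N0; rewrite /geo; case: ifP => // _; rewrite le_min N0 invr_ge0 dist_ge0.
Qed.

Lemma mag_sum_le (f : nat -> R) m n :
  mag (\sum_(m <= i < n) e (f i)) <= (n - m)%:R.
Proof.
apply: le_trans (mag_sum _ _ _) _.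
by under eq_bigr do rewrite mag_e; rewrite sumr_const_nat.
Qed.

Lemma geo_mono N M t : N <= M -> geo N t <= geo M t.
Proof.
rewrite /geo; case: ifP => // _ h; rewrite le_min !ge_min lexx h /= orbT //.
Qed.

Lemma geo_sum t c m n : mag (\sum_(m <= i < n) e (t *+ i + c)) <= geo (n - m)%:R t.
Proof.
rewrite /geo; case: ifP => [_|/eqP dn0]; first exact: mag_sum_le.
rewrite le_min mag_sum_le /=.
have d0 : 0 < dist t by rewrite lt_def dist_ge0 andbT; apply/eqP.
have [nm|mn] := leqP n m; first by rewrite big_geq // mag0 invr_ge0 ltW.
have key : (1 - e t) * \sum_(m <= i < n) e (t *+ i + c) =
    e (t *+ m + c) - e (t *+ n + c).
  have /= tel := telescope_sumr (fun i => e (t *+ i + c)) (ltnW mn).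
  rewrite -[RHS]opprB -tel mulr_sumr -sumrN.
  by apply: eq_bigr => i _; rewrite mulrBl mul1r -eD addrA -mulrS opprB.
have : mag (1 - e t) * mag (\sum_(m <= i < n) e (t *+ i + c)) <= 2.
  rewrite -magM key; apply: le_trans (magD _ _) _.
  by rewrite magN !mag_e; lra.
have := mag_1Be t; have := mag_ge0 (\sum_(m <= i < n) e (t *+ i + c)).
move: (mag (\sum_(m <= i < n) e (t *+ i + c))) (mag (1 - e t)) => S m1 S0 h1 h2.
rewrite -(ler_pM2l d0) divff ?gt_eqF //.
nra.
Qed.

End Exponential.

#[local] Opaque e.

(** * Orthogonality of characters *)

Section Orthogonality.
Variable R : realType.
Variable M : nat.

Lemma dist_frac_gt0 (a b : nat) : (a < M)%N -> (b < a)%N ->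
  0 < dist ((a - b)%:R / M%:R : R).
Proof.
move=> aM ba; have M0 : 0 < M%:R :> R by rewrite ltr0n; lia.
have h : 0 < ((a - b)%:R / M%:R : R) < 1.
  apply/andP; split; first by rewrite divr_gt0 // ltr0n subn_gt0.
  by rewrite ltr_pdivrMr // mul1r ltr_nat; lia.
rewrite /dist fr_id; last by lra.
by rewrite lt_min; lra.
Qed.

Lemma sum_e_frac (a b : nat) : (a < M)%N -> (b < a)%N ->
  \sum_(t < M) e ((t * (a - b))%:R / M%:R : R) = 0.
Proof.
move=> aM ba; have M0 : M%:R != 0 :> R by rewrite pnatr_eq0; lia.
pose u : R := (a - b)%:R / M%:R.
have r1 : 1 - e u != 0.
  apply/eqP => h; have := mag_1Be u; rewrite h mag0.
  by have := dist_frac_gt0 aM ba; rewrite -/u; lra.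
have eq1 : \sum_(t < M) e ((t * (a - b))%:R / M%:R : R) = \sum_(t < M) e u ^+ t.
  by apply: eq_bigr => t _; rewrite natrM -mulrA mulr_natl e_mulrn.
have uM : u *+ M = (a - b)%:R by rewrite -[LHS]mulr_natr divfK.
have := subrX1 (e u) M; rewrite -eq1 -e_mulrn uM.
rewrite e_nat subrr => /esym/eqP; rewrite mulf_eq0 => /orP[/eqP h|/eqP //].
by move: r1; rewrite -opprB h oppr0 eqxx.
Qed.

Lemma ortho1 (a b : nat) : (a < M)%N -> (b < M)%N ->
  \sum_(t < M) e ((t * a)%:R / M%:R : R) * (e ((t * b)%:R / M%:R))^* =
  if a == b then M%:R else 0.
Proof.
move=> aM bM; have [->|ab] := eqVneq a b.
  rewrite (eq_bigr (fun=> 1)) ?sumr_const ?card_ord // => t _.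
  by rewrite -eB subrr e0.
have [ba|ab'] := ltnP b a.
  rewrite -{2}(sum_e_frac aM ba); apply: eq_bigr => t _.
  by rewrite -eB -mulrBl -natrB ?leq_mul2l ?(ltnW ba) ?orbT // mulnBr.
have {ab ab'} ba : (a < b)%N by rewrite ltn_neqAle ab.
transitivity ((\sum_(t < M) e ((t * (b - a))%:R / M%:R : R))^*); last first.
  by rewrite sum_e_frac // conjc0.
rewrite rmorph_sum.
apply: eq_bigr => t _ /=.
by rewrite -eB -eN -mulrBl -mulNr mulnBr natrB ?leq_mul2l ?(ltnW ba) ?orbT // opprB.
Qed.

Variables (W : finType) (p1 p2 p3 : W -> nat).
Hypotheses (p1M : forall w, (p1 w < M)%N) (p2M : forall w, (p2 w < M)%N)
  (p3M : forall w, (p3 w < M)%N).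

Definition character (t : 'I_M * 'I_M * 'I_M) (a b c : nat) : R[i] :=
  e ((t.1.1 * a + t.1.2 * b + t.2 * c)%:R / M%:R).

Lemma characterE t a b c : character t a b c =
  e ((t.1.1 * a)%:R / M%:R) * e ((t.1.2 * b)%:R / M%:R) * e ((t.2 * c)%:R / M%:R).
Proof. by rewrite /character !natrD !mulrDl !eD. Qed.

Lemma characterM_conj t a b c a' b' c' :
  character t a b c * (character t a' b' c')^* =
  (e ((t.1.1 * a)%:R / M%:R) * (e ((t.1.1 * a')%:R / M%:R))^*) *
  (e ((t.1.2 * b)%:R / M%:R) * (e ((t.1.2 * b')%:R / M%:R))^*) *
  (e ((t.2 * c)%:R / M%:R) * (e ((t.2 * c')%:R / M%:R))^*).
Proof.
rewrite !characterE !rmorphM /=.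
by rewrite mulrACA; congr (_ * _); rewrite mulrACA.
Qed.

Lemma sum_triple (f g h : 'I_M -> R[i]) :
  \sum_(t : 'I_M * 'I_M * 'I_M) f t.1.1 * g t.1.2 * h t.2 =
  (\sum_i f i) * (\sum_i g i) * (\sum_i h i).
Proof.
rewrite big_distrlr /= pair_bigA big_distrlr /= pair_bigA /=.
by apply: eq_bigr.
Qed.

Lemma character_ortho (P Q : pred W) :
  \sum_(t : 'I_M * 'I_M * 'I_M)
    (\sum_(w | P w) character t (p1 w) (p2 w) (p3 w)) *
    (\sum_(w | Q w) character t (p1 w) (p2 w) (p3 w))^* =
  (M ^ 3 * #|[pred ww : W * W | [&& P ww.1, Q ww.2, p1 ww.1 == p1 ww.2,
     p2 ww.1 == p2 ww.2 & p3 ww.1 == p3 ww.2]]|)%:R.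
Proof.
under eq_bigr do rewrite raddf_sum big_distrlr /=.
rewrite exchange_big /=; under eq_bigr do rewrite exchange_big /=.
rewrite pair_big /= natrM -sum1_card natr_sum mulr_sumr [RHS]big_mkcond /=.
rewrite big_mkcond; apply: eq_bigr => -[w w'] _ /=; rewrite !inE /=.
case: (P w) => //=; case: (Q w') => //=.
under eq_bigr do rewrite characterM_conj.
rewrite (sum_triple (fun t => e ((t * p1 w)%:R / M%:R) * (e ((t * p1 w')%:R / M%:R))^*)
 (fun t => e ((t * p2 w)%:R / M%:R) * (e ((t * p2 w')%:R / M%:R))^*)
 (fun t => e ((t * p3 w)%:R / M%:R) * (e ((t * p3 w')%:R / M%:R))^*)).
rewrite !ortho1 //.
case: (p1 w == p1 w') => /=; last by rewrite !mul0r.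
case: (p2 w == p2 w') => /=; last by rewrite mulr0 mul0r.
case: (p3 w == p3 w') => /=; last by rewrite mulr0.
by rewrite mulr1 -!natrM expnS expnS expn1 mulnA.
Qed.

End Orthogonality.

(** * Elementary inequalities *)

Section Inequalities.
Variable R : realFieldType.

(** The graph of [v ^ m.+1] lies above its tangent at [a]. *)
Lemma tangent_le (v a : R) m : 0 <= v -> 0 <= a ->
  (m.+1)%:R * a ^+ m * v <= v ^+ m.+1 + m%:R * a ^+ m.+1.
Proof.
move=> v0 a0; elim: m => [|m IH]; first by rewrite expr0 mulr1 mul1r mul0r addr0.
have e1 : m.+1%:R = m%:R + 1 :> R by rewrite natr1.
have e2 : m.+2%:R = m%:R + 2 :> R by rewrite -addn2 natrD.
have h := ler_wpM2r v0 IH; have am : 0 <= a ^+ m by rewrite exprn_ge0.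
have : 0 <= m.+1%:R * (a ^+ m * (v - a) ^+ 2).
  by rewrite mulr_ge0 ?ler0n // mulr_ge0 ?sqr_ge0.
move: h; rewrite !exprS e2 e1 => h; lra.
Qed.

(** Summing the tangent inequality at the mean of the [v i]. *)
Lemma power_mean (I : Type) (r : seq I) (P : pred I) (v : I -> R) m :
  (forall i, P i -> 0 <= v i) ->
  (\sum_(i <- r | P i) v i) ^+ m.+1 <=
  (count P r)%:R ^+ m * \sum_(i <- r | P i) v i ^+ m.+1.
Proof.
move=> v0; set S := \sum_(i <- r | P i) v i; set n := (count P r)%:R : R.
have S0 : 0 <= S by exact: sumr_ge0.
have Sq0 : 0 <= \sum_(i <- r | P i) v i ^+ m.+1.
  by apply: sumr_ge0 => i /v0; exact: exprn_ge0.
have [n0|n0] := eqVneq n 0.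
  have -> : S = 0.
    rewrite /S -big_filter; suff -> : [seq i <- r | P i] = [::] by rewrite big_nil.
    by apply: size0nil; apply/eqP; rewrite size_filter -(pnatr_eq0 R); apply/eqP.
  by rewrite expr0n /=; apply: mulr_ge0 => //; rewrite n0 exprn_ge0.
have np : 0 < n by rewrite lt_def n0 ler0n.
set a := S / n; have a0 : 0 <= a by rewrite divr_ge0 // ltW.
have Sa : S = n * a by rewrite /a mulrC divfK.
have : \sum_(i <- r | P i) (m.+1%:R * a ^+ m * v i) <=
       \sum_(i <- r | P i) (v i ^+ m.+1 + m%:R * a ^+ m.+1).
  by apply: ler_sum => i Pi; apply: tangent_le => //; exact: v0.
rewrite -mulr_sumr -/S big_split /= big_const_seq iter_addr_0 -mulr_natr -/n Sa.
move=> h; rewrite exprMn (exprSr n) -mulrA ler_pM2l ?exprn_gt0 //.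
by move: h; rewrite -natr1 exprS; lra.
Qed.

Lemma cauchy_schwarz (I : Type) (r : seq I) (P : pred I) (f g : I -> R) :
  (\sum_(i <- r | P i) f i * g i) ^+ 2 <=
  (\sum_(i <- r | P i) f i ^+ 2) * (\sum_(i <- r | P i) g i ^+ 2).
Proof.
set A := \sum_(i <- r | P i) f i ^+ 2; set B := \sum_(i <- r | P i) _ * _.
set D := \sum_(i <- r | P i) g i ^+ 2.
have q s t : 0 <= s ^+ 2 * A - 2 * s * t * B + t ^+ 2 * D.
  rewrite !mulr_sumr -sumrB -big_split /=; apply: sumr_ge0 => i _.
  rewrite (_ : _ + _ = (s * f i - t * g i) ^+ 2) ?sqr_ge0 //; ring.
have A0 : 0 <= A by apply: sumr_ge0 => i _; exact: sqr_ge0.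
have [A1|A1] := eqVneq A 0; last first.
  have := q B A; have Ap : 0 < A by rewrite lt_def A1.
  rewrite (_ : _ + _ = A * (A * D - B ^+ 2)); last by ring.
  by rewrite pmulr_rge0 // subr_ge0.
have := q (D + 1) B; rewrite A1 mul0r => h.
have D0 : 0 <= D by apply: sumr_ge0 => i _; exact: sqr_ge0.
have := sqr_ge0 B; nra.
Qed.

Lemma ler_Xn_imp (x y : R) n : 0 <= y -> x ^+ n.+1 <= y ^+ n.+1 -> x <= y.
Proof.
move=> y0; apply: contra_le => yx.
by rewrite ltrXn2r // ltW // (le_lt_trans y0).
Qed.

End Inequalities.

(** * Mean values and solutions of the cubic system *)

Section MeanValue.
Variable R : realType.
Variable N : nat.
Let M := (6 * N ^ 3).+1.

Definition psum j (x : {ffun 'I_6 -> 'I_N}) : nat := \sum_(i < 6) (x i) ^ j.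

Lemma psum_lt j x : (j <= 3)%N -> (psum j x < M)%N.
Proof.
move=> j3; rewrite /M ltnS /psum.
have -> : (6 * N ^ 3 = \sum_(i < 6) N ^ 3)%N by rewrite sum_nat_const card_ord.
apply: leq_sum => i _; have xN := ltn_ord (x i).
apply: leq_trans (_ : N ^ j <= _)%N; first by case: (j) => [|n] //; rewrite leq_exp2r // ltnW.
by rewrite leq_pexp2l //; lia.
Qed.

(** Each variable has its own range, so that single variables can be confined to
    residue classes. *)
Definition sols (A B : 'I_6 -> pred 'I_N) : nat :=
  #|[pred xy : {ffun 'I_6 -> 'I_N} * {ffun 'I_6 -> 'I_N} |
    [&& xy.1 \in family A, xy.2 \in family B, psum 1 xy.1 == psum 1 xy.2,
        psum 2 xy.1 == psum 2 xy.2 & psum 3 xy.1 == psum 3 xy.2]]|.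

Definition cubes (A : pred 'I_N) (t : 'I_M * 'I_M * 'I_M) : R[i] :=
  \sum_(x | A x) character R t (x ^ 1) (x ^ 2) (x ^ 3).

(** The grid of step [1 / M] replaces the torus: the frequencies that occur
    are smaller than [M], so the average over the grid is the integral. *)
Definition mean (F : 'I_M * 'I_M * 'I_M -> R) : R := (\sum_t F t) / M%:R ^+ 3.

Lemma character_sum (t : 'I_M * 'I_M * 'I_M) (x : {ffun 'I_6 -> 'I_N}) :
  character R t (psum 1 x) (psum 2 x) (psum 3 x) =
  \prod_i character R t (x i ^ 1) (x i ^ 2) (x i ^ 3).
Proof.
rewrite /character -e_sum -mulr_suml -natr_sum !big_split /= -!big_distrr /=.
by [].
Qed.

Lemma prod_cubes (A : 'I_6 -> pred 'I_N) t :
  \prod_i cubes (A i) t =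
  \sum_(x in family A) character R t (psum 1 x) (psum 2 x) (psum 3 x).
Proof.
under [RHS]eq_bigr do rewrite character_sum.
by rewrite /cubes bigA_distr_big_dep.
Qed.

Lemma sols_sum (A B : 'I_6 -> pred 'I_N) :
  \sum_t (\prod_i cubes (A i) t) * (\prod_i cubes (B i) t)^* =
  (M ^ 3 * sols A B)%:R.
Proof.
under eq_bigr do rewrite !prod_cubes.
have lt j w : (j <= 3)%N -> (psum j w < M)%N by exact: psum_lt.
have := character_ortho R (fun w => @lt 1 w isT) (fun w => @lt 2 w isT) (fun w => @lt 3 w isT).
move=> /(_ [pred x | x \in family A] [pred x | x \in family B]) /= h.
exact: h.
Qed.

Lemma M3_gt0 : 0 < M%:R ^+ 3 :> R.
Proof. by rewrite exprn_gt0 // ltr0n. Qed.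

Lemma sols_mean (A : 'I_6 -> pred 'I_N) :
  (sols A A)%:R = mean (fun t => \prod_i mag (cubes (A i) t) ^+ 2).
Proof.
rewrite /mean; apply: (mulIf (lt0r_neq0 M3_gt0)); rewrite divfK ?lt0r_neq0 ?M3_gt0 //.
apply: complexI; rewrite rmorph_sum /= mulrC -natrX -natrM rmorph_nat -sols_sum.
apply: eq_bigr => t _; rewrite -sqr_mag mag_prod -prodrXl //.
Qed.

Lemma mean_ge0 F : (forall t, 0 <= F t) -> 0 <= mean F.
Proof. by move=> F0; rewrite divr_ge0 ?(ltW M3_gt0) // sumr_ge0. Qed.

Lemma le_mean F G : (forall t, F t <= G t) -> mean F <= mean G.
Proof. by move=> FG; rewrite ler_pM2r ?invr_gt0 ?M3_gt0 // ler_sum. Qed.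

Lemma meanD F G : mean (fun t => F t + G t) = mean F + mean G.
Proof. by rewrite /mean big_split mulrDl. Qed.

Lemma meanZ c F : mean (fun t => c * F t) = c * mean F.
Proof. by rewrite /mean -mulr_sumr mulrA. Qed.

Lemma mean_sum (I : finType) (P : pred I) (F : I -> _ -> R) :
  mean (fun t => \sum_(i | P i) F i t) = \sum_(i | P i) mean (F i).
Proof. by rewrite /mean exchange_big /= mulr_suml. Qed.

Lemma eq_mean F G : F =1 G -> mean F = mean G.
Proof. by move=> FG; rewrite /mean; congr (_ / _); apply: eq_bigr. Qed.

Lemma sols_le_mean (A B : 'I_6 -> pred 'I_N) :
  (sols A B)%:R <=
  mean (fun t => \prod_i (mag (cubes (A i) t) * mag (cubes (B i) t))).
Proof.
rewrite /mean ler_pdivlMr ?M3_gt0 //.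
have -> : (sols A B)%:R * M%:R ^+ 3 = mag ((M ^ 3 * sols A B)%:R : R[i]).
  rewrite (_ : _%:R = ((M ^ 3 * sols A B)%:R : R)%:C); last by rewrite rmorph_nat.
  by rewrite mag_real ger0_norm ?ler0n // natrM natrX mulrC.
rewrite -sols_sum; apply: le_trans (mag_sum _ _ _) _.
apply: ler_sum => t _.
by rewrite magM mag_conj !mag_prod big_split.
Qed.

End MeanValue.

(** * Congruences for sums of squares and cubes *)

Section Congruences.
Variable p : nat.
Hypotheses (pp : prime p) (p7 : (7 <= p)%N).

Lemma dvdz_primeM (m n : int) : (p %| m * n)%Z = (p %| m)%Z || (p %| n)%Z.
Proof. by rewrite !dvdzE abszM Euclid_dvdM. Qed.

Lemma dvdz_small (m : int) : (0 < `|m| < p)%N -> ~~ (p %| m)%Z.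
Proof. by move=> /andP[m0 mp]; rewrite dvdzE; apply/negP => /(dvdn_leq m0) /=; lia. Qed.

Lemma coprime_pX n (m : int) : ~~ (p %| m)%Z -> coprimez (p ^ n)%N%:Z m.
Proof. by move=> h; rewrite coprimezE /= coprimeXl // prime_coprime // -[p]absz_nat -dvdzE. Qed.

Lemma subz_of_add2 (a b c d : int) : a + b = c + d -> c - a = b - d.
Proof. by move=> h; lra. Qed.

Lemma subz_of_add3 (a b c a' b' c' : int) :
  a + b + c = a' + b' + c' -> (a + b) - (a' + b') = c' - c.
Proof. by move=> h; lra. Qed.

Lemma residue_step (y x z A E u w : int) :
  y - x = A * (u + E * w) -> y - (z + A * u) = (x - z) + A * E * w.
Proof. by move=> h; lra. Qed.

Lemma dvdzD d (m n : int) : (d %| m)%Z -> (d %| n)%Z -> (d %| m + n)%Z.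
Proof. exact: rpredD. Qed.

Lemma dvdzN d (m : int) : (d %| - m)%Z = (d %| m)%Z.
Proof. exact: rpredN. Qed.

Lemma dvdzB d (m n : int) : (d %| m)%Z -> (d %| n)%Z -> (d %| m - n)%Z.
Proof. exact: rpredB. Qed.

Definition eqpow (x y : 'I_6 -> int) :=
  [/\ \sum_i x i = \sum_i y i, \sum_i x i ^+ 2 = \sum_i y i ^+ 2 &
      \sum_i x i ^+ 3 = \sum_i y i ^+ 3].

Lemma eqpow_ext (x y x' y' : 'I_6 -> int) :
  x =1 x' -> y =1 y' -> eqpow x y -> eqpow x' y'.
Proof.
move=> xx yy [e1 e2 e3]; split.
- by under eq_bigr do rewrite -xx; under [RHS]eq_bigr do rewrite -yy.
- by under eq_bigr do rewrite -xx; under [RHS]eq_bigr do rewrite -yy.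
- by under eq_bigr do rewrite -xx; under [RHS]eq_bigr do rewrite -yy.
Qed.

(** Invariance of the cubic system under translations, which makes it possible
    to centre the variables at a residue class. *)
Lemma eqpow_shift (x y : 'I_6 -> int) c :
  eqpow x y -> eqpow (fun i => x i - c) (fun i => y i - c).
Proof.
case=> e1 e2 e3; split.
- by rewrite !big_split /= e1.
- have E (z : 'I_6 -> int) : \sum_i (z i - c) ^+ 2 =
     \sum_i z i ^+ 2 - 2 * c * (\sum_i z i) + \sum_(i < 6) c ^+ 2.
    rewrite mulr_sumr -sumrB -big_split /=; apply: eq_bigr => i _; ring.
  by rewrite !E e1 e2.
- have E (z : 'I_6 -> int) : \sum_i (z i - c) ^+ 3 = \sum_i z i ^+ 3
     - 3 * c * (\sum_i z i ^+ 2) + 3 * c ^+ 2 * (\sum_i z i) - \sum_(i < 6) c ^+ 3.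
    rewrite !mulr_sumr -sumrB -big_split -sumrB /=; apply: eq_bigr => i _; ring.
  by rewrite !E e1 e2 e3.
Qed.

Lemma eqpow_scale (x y : 'I_6 -> int) (c : int) : c != 0 ->
  eqpow (fun i => c * x i) (fun i => c * y i) -> eqpow x y.
Proof.
move=> c0 [e1 e2 e3]; split; [apply: (mulfI c0)|apply: (@mulfI _ (c ^+ 2))|
  apply: (@mulfI _ (c ^+ 3))]; rewrite ?expf_neq0 // !mulr_sumr //.
- by under eq_bigr do rewrite -exprMn; under [RHS]eq_bigr do rewrite -exprMn.
- by under eq_bigr do rewrite -exprMn; under [RHS]eq_bigr do rewrite -exprMn.
Qed.

(** [X^3 - Y^3] is [X - Y] times a unit modulo [p]. *)
Lemma cube_lift (b : nat) (X Y : int) :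
  (p %| X - Y)%Z -> ~~ (p %| X)%Z -> ((p ^ b)%N %| X ^+ 3 - Y ^+ 3)%Z ->
  ((p ^ b)%N %| X - Y)%Z.
Proof.
move=> hXY hX.
have -> : X ^+ 3 - Y ^+ 3 = (X ^+ 2 + X * Y + Y ^+ 2) * (X - Y) by ring.
rewrite Gauss_dvdzr //; apply: coprime_pX; apply/negP => h.
have : (p %| 3 * (X * X))%Z.
  have -> : 3 * (X * X) = (X ^+ 2 + X * Y + Y ^+ 2) + (X - Y) * (2 * X + Y) by ring.
  by rewrite dvdzD // dvdz_mulr.
rewrite !dvdz_primeM (negbTE hX) !orbF; apply/negP; apply: dvdz_small => /=; lia.
Qed.

(** With [S], [Q] the sums of the two numbers and of their squares, twice the
    sum of the cubes is [S (3 Q - S^2)].  Hence [S - S'] is annihilated modulo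
    [p^n] by [3 Q - S^2 - S S' - S'^2], which is [- 6 X0^2] modulo [p] and so a
    unit.  Once the sums agree, equality of the sums of squares says that
    [2 (Y0 - X0) (Y1 - X0)] vanishes. *)
Lemma pair_lift (n : nat) (X0 X1 Y0 Y1 : int) :
  (p %| X1 - X0)%Z -> (p %| Y0 - X0)%Z -> (p %| Y1 - X0)%Z -> ~~ (p %| X0)%Z ->
  ((p ^ n)%N %| (X0 ^+ 2 + X1 ^+ 2) - (Y0 ^+ 2 + Y1 ^+ 2))%Z ->
  ((p ^ n)%N %| (X0 ^+ 3 + X1 ^+ 3) - (Y0 ^+ 3 + Y1 ^+ 3))%Z ->
  ((p ^ n)%N %| (X0 + X1) - (Y0 + Y1))%Z /\
  ((p ^ n)%N %| (Y0 - X0) * (Y1 - X0))%Z.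
Proof.
move=> h1 h2 h3 hX hQ hC.
have two : ~~ (p %| 2)%Z by apply: dvdz_small => /=; lia.
have hS : ((p ^ n)%N %| (X0 + X1) - (Y0 + Y1))%Z.
  pose S := X0 + X1; pose S' := Y0 + Y1; pose Q := X0 ^+ 2 + X1 ^+ 2.
  pose Q' := Y0 ^+ 2 + Y1 ^+ 2.
  have E : (3 * Q - S ^+ 2 - S * S' - S' ^+ 2) * (S - S') =
    2 * ((X0 ^+ 3 + X1 ^+ 3) - (Y0 ^+ 3 + Y1 ^+ 3)) - 3 * S' * (Q - Q').
    by rewrite /Q /Q' /S /S'; ring.
  have : ((p ^ n)%N %| (3 * Q - S ^+ 2 - S * S' - S' ^+ 2) * (S - S'))%Z.
    by rewrite E dvdzB // dvdz_mull.
  rewrite Gauss_dvdzr //; apply: coprime_pX; apply/negP => h.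
  have : (p %| 6 * (X0 * X0))%Z.
    pose d1 := X1 - X0; pose d2 := Y0 - X0; pose d3 := Y1 - X0.
    have -> : 6 * (X0 * X0) = - (3 * Q - S ^+ 2 - S * S' - S' ^+ 2) +
      d1 * (2 * d1 - d2 - d3) + d2 * (- 6 * X0 - d2 - 2 * d3) + d3 * (- 6 * X0 - d3).
      by rewrite /d1 /d2 /d3 /Q /S /S'; ring.
    by rewrite !dvdzD ?dvdzN // dvdz_mulr.
  rewrite !dvdz_primeM (negbTE hX) !orbF; apply/negP; apply: dvdz_small => /=; lia.
split=> //.
have : ((p ^ n)%N %| 2 * ((Y0 - X0) * (Y1 - X0)))%Z.
  have -> : 2 * ((Y0 - X0) * (Y1 - X0)) = (X0 ^+ 2 + X1 ^+ 2) - (Y0 ^+ 2 + Y1 ^+ 2)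
     - ((X0 + X1) - (Y0 + Y1)) * (Y0 + Y1 + X1 - X0) by ring.
  by rewrite dvdzB // dvdz_mulr.
by rewrite Gauss_dvdzr //; apply: coprime_pX.
Qed.

End Congruences.

(** * Mixed moments over residue classes *)

Section LogConvex.
Variable R : realFieldType.

(** Interpolation in a log-convex sequence, with integer exponents only. *)
Lemma log_convex24 (x1 x2 x3 x4 : R) : 0 <= x1 -> 0 <= x2 -> 0 <= x3 -> 0 <= x4 ->
  x2 ^+ 2 <= x1 * x3 -> x3 ^+ 2 <= x2 * x4 -> x2 ^+ 3 <= x1 ^+ 2 * x4.
Proof.
move=> h1 h2 h3 h4 a b; have [->|x20] := eqVneq x2 0.
  by rewrite expr0n /= mulr_ge0 ?exprn_ge0.
have xp : 0 < x2 by rewrite lt_def x20.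
rewrite -(ler_pM2r xp) -exprSr (exprM x2 2 2).
apply: le_trans (_ : (x1 * x3) ^+ 2 <= _); first by rewrite lerXn2r // nnegrE ?sqr_ge0 ?mulr_ge0.
by rewrite exprMn -[_ * _ * x2]mulrA ler_wpM2l ?sqr_ge0 // mulrC.
Qed.

Lemma log_convex14 (x0 x1 x2 x4 : R) : 0 <= x0 -> 0 <= x1 -> 0 <= x2 -> 0 <= x4 ->
  x1 ^+ 2 <= x0 * x2 -> x2 ^+ 3 <= x1 ^+ 2 * x4 -> x1 ^+ 4 <= x0 ^+ 3 * x4.
Proof.
move=> h0 h1 h2 h4 a b; have [->|x10] := eqVneq x1 0.
  by rewrite expr0n /= mulr_ge0 ?exprn_ge0.
have xp : 0 < x1 ^+ 2 by rewrite exprn_gt0 // lt_def x10.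
rewrite -(ler_pM2r xp) -exprD (exprM x1 2 3).
apply: le_trans (_ : (x0 * x2) ^+ 3 <= _); first by rewrite lerXn2r // nnegrE ?sqr_ge0 ?mulr_ge0.
by rewrite exprMn -[_ * x4 * _]mulrA ler_wpM2l ?exprn_ge0 // mulrC.
Qed.

Lemma sum_le_max (n : nat) (f : 'I_n -> R) : (0 < n)%N ->
  exists j, \sum_i f i <= n%:R * f j.
Proof.
case: n f => // n f _.
have [j _ hj] := @arg_maxP _ _ 'I_n.+1 ord0 xpredT f isT.
exists j; rewrite -[X in X%:R * _](card_ord n.+1) mulr_natl -sumr_const.
by apply: ler_sum => i _; exact: hj.
Qed.

End LogConvex.

Section Classes.
Variable R : realType.
Variable N : nat.
Let M := (6 * N ^ 3).+1.

Definition cls (n xi : nat) : pred 'I_N := fun x => (x == xi %[mod n])%N.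

Definition mix m (A B : pred 'I_N) (i : 'I_6) : pred 'I_N :=
  if (i < m)%N then A else B.

Definition pw (A : pred 'I_N) t : R := mag (cubes R A t) ^+ 2.

(** The mixed moment of [|f_A|^(2 m)] and [|f_B|^(12 - 2 m)], where [f_A] and
    [f_B] are the cubic sums over [A] and [B]. *)
Definition mu m (A B : pred 'I_N) : R := mean (fun t => pw A t ^+ m * pw B t ^+ (6 - m)).

Lemma pw_ge0 A t : 0 <= pw A t.
Proof. exact: sqr_ge0. Qed.

Lemma mu_ge0 m A B : 0 <= mu m A B.
Proof. by apply: mean_ge0 => t; apply: mulr_ge0; apply: exprn_ge0; exact: pw_ge0. Qed.

Lemma mu_sols m A B : (m <= 6)%N -> (sols (mix m A B) (mix m A B))%:R = mu m A B.
Proof.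
move=> m6; rewrite sols_mean; apply: eq_mean => t.
rewrite (eq_bigr (fun i : 'I_6 => if (i < m)%N then pw A t else pw B t)); last first.
  by move=> i _; rewrite /mix /pw; case: ifP.
move: (pw A t) (pw B t) => a b; rewrite !big_ord_recl big_ord0 /= /bump /=.
by do 7![case: m m6 => [|m] m6 //=; first by ring].
Qed.

Lemma mu_sym m A B : (m <= 6)%N -> mu m A B = mu (6 - m) B A.
Proof. by move=> m6; apply: eq_mean => t; rewrite subKn // mulrC. Qed.

Lemma mu_cs m A B : (m.+2 <= 6)%N -> mu m.+1 A B ^+ 2 <= mu m A B * mu m.+2 A B.
Proof.
move=> m6; rewrite /mu /mean mulf_div expr_div_n -expr2 ler_pM2r; last first.
  by rewrite invr_gt0 !exprn_gt0 // ltr0n.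
have h k j (u v : R) : (u ^+ 2) ^+ k * (v ^+ 2) ^+ j = (u ^+ k * v ^+ j) ^+ 2.
  by rewrite -!exprM (mulnC 2 k) (mulnC 2 j) !exprM -exprMn.
pose f t := mag (cubes R A t) ^+ m * mag (cubes R B t) ^+ (6 - m).
pose g t := mag (cubes R A t) ^+ m.+2 * mag (cubes R B t) ^+ (6 - m.+2).
under [X in X * _]eq_bigr do rewrite /pw h -/(f _).
under [X in _ * X]eq_bigr do rewrite /pw h -/(g _).
rewrite (eq_bigr (fun t => f t * g t)); first exact: cauchy_schwarz.
move=> t _; rewrite /pw /f /g mulrACA -!exprD -!exprM; congr (_ ^+ _ * _ ^+ _); lia.
Qed.

Lemma mu_holder2 A B : mu 2 A B ^+ 3 <= mu 1 A B ^+ 2 * mu 4 A B.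
Proof. by apply: (@log_convex24 _ _ _ (mu 3 A B)); rewrite ?mu_ge0 // mu_cs. Qed.

Lemma mu_holder1 A B : mu 1 A B ^+ 4 <= mu 0 A B ^+ 3 * mu 4 A B.
Proof.
apply: (@log_convex14 _ _ _ (mu 2 A B)); rewrite ?mu_ge0 ?mu_cs //.
exact: mu_holder2.
Qed.

(** Weighted comparison of geometric and arithmetic means under the average. *)
Lemma mu_young (s u : R) A B : 0 <= s -> 0 <= u ->
  s ^+ 2 * u ^+ 4 * mu 2 A B <= s ^+ 6 * mu 6 A B + u ^+ 6 * mu 0 A B.
Proof.
move=> s0 u0; rewrite /mu -!meanZ -meanD; apply: le_mean => t.
have := mulr_ge0 s0 (pw_ge0 A t); have := mulr_ge0 u0 (pw_ge0 B t).
rewrite !subnn subn0 !expr0 mulr1 mul1r mulrACA -!exprMn.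
move: (s * _) (u * _) => a b b0 a0.
have [ab|ba] := leP a b.
  apply: le_trans (_ : b ^+ 6 <= _); last by rewrite lerDr exprn_ge0.
  by rewrite (exprD b 2 4) ler_wpM2r ?exprn_ge0 // lerXn2r // nnegrE.
apply: le_trans (_ : a ^+ 6 <= _); last by rewrite lerDl exprn_ge0.
by rewrite (exprD a 2 4) ler_wpM2l ?exprn_ge0 // lerXn2r ?nnegrE // ltW.
Qed.

Definition solution (x y : {ffun 'I_6 -> 'I_N}) :=
  [&& psum 1 x == psum 1 y, psum 2 x == psum 2 y & psum 3 x == psum 3 y].

Lemma solution_eqpow x y : solution x y ->
  eqpow (fun i => (x i)%:Z) (fun i => (y i)%:Z).
Proof.
have E j (z : {ffun 'I_6 -> 'I_N}) : \sum_(i < 6) (z i)%:Z ^+ j = (psum j z)%:Z.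
  rewrite /psum (big_morph Posz PoszD (erefl _)); apply: eq_bigr => i _.
  by rewrite -natz -natrX natz.
move=> /and3P[/eqP e1 /eqP e2 /eqP e3].
by split; [move: (E 1%N x) (E 1%N y); rewrite e1 => -> // |rewrite !E e2|rewrite !E e3].
Qed.

Lemma sols_cover (J : finType) (A B : 'I_6 -> pred 'I_N) (A' B' : J -> 'I_6 -> pred 'I_N) :
  (forall x y, x \in family A -> y \in family B -> solution x y ->
     exists2 j, x \in family (A' j) & y \in family (B' j)) ->
  (sols A B <= \sum_j sols (A' j) (B' j))%N.
Proof.
move=> H; rewrite /sols -sum1_card.
under [X in (_ <= X)%N]eq_bigr => j _.
  rewrite -sum1_card big_mkcond /=; over.
rewrite exchange_big /= big_mkcond; apply: leq_sum => -[x y] _ /=; rewrite !inE /=.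
case: ifP => // /and3P[xA yB] xy; have [j xj yj] := H x y xA yB xy.
by rewrite (bigD1 j) //= inE /= xj yj xy.
Qed.

Lemma clsE n xi (x : 'I_N) : cls n xi x = (n %| x%:Z - xi%:Z)%Z.
Proof.
by rewrite /cls -eqz_mod_dvd !modz_nat.
Qed.

(** The off-diagonal choices of classes for the first two variables on each
    side are controlled by the diagonal ones, again by comparing geometric and
    arithmetic means. *)
Lemma mean_prod4 (A1 A2 A3 A4 B : pred 'I_N) K :
  mu 2 A1 B <= K -> mu 2 A2 B <= K -> mu 2 A3 B <= K -> mu 2 A4 B <= K ->
  mean (fun t => mag (cubes R A1 t) * mag (cubes R A2 t) *
    (mag (cubes R A3 t) * mag (cubes R A4 t)) * pw B t ^+ 4) <= K.
Proof.
move=> h1 h2 h3 h4.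
suff : mean (fun t => mag (cubes R A1 t) * mag (cubes R A2 t) *
    (mag (cubes R A3 t) * mag (cubes R A4 t)) * pw B t ^+ 4) <=
    4^-1 * (mu 2 A1 B + mu 2 A2 B + mu 2 A3 B + mu 2 A4 B) by lra.
rewrite /mu -!meanD -meanZ; apply: le_mean => t.
have h := exprn_ge0 4 (pw_ge0 B t); rewrite (_ : (6 - 2)%N = 4%N) //.
rewrite -!mulrDl [4^-1 * _]mulrA; apply: ler_wpM2r => //; rewrite /pw.
move: (mag _) (mag _) (mag _) (mag _) => a b c d.
have := sqr_ge0 (a * b - c * d); have := sqr_ge0 (a ^+ 2 - b ^+ 2).
have := sqr_ge0 (c ^+ 2 - d ^+ 2).
by lra.
Qed.

End Classes.

(** * Lifting congruences *)

Section Congruencing.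
Variables (R : realType) (p : nat).
Hypotheses (pp : prime p) (p7 : (7 <= p)%N).

(** The side [p ^ l] lets residue classes modulo [p ^ b] be exactly intervals of
    length [p ^ (l - b)], without rounding. *)
Definition J (l : nat) : nat := @sols (p ^ l) (fun=> predT) (fun=> predT).

Lemma pX_gt0 n : (0 < p ^ n)%N.
Proof. by rewrite expn_gt0; lia. Qed.

Section Level.
Variable L : nat.
Notation N := (p ^ L)%N.

Lemma family_mix m (A B : pred 'I_N) (x : {ffun 'I_6 -> 'I_N}) :
  x \in family (mix m A B) ->
  (forall i : 'I_6, (i < m)%N -> A (x i)) /\ (forall i : 'I_6, (m <= i)%N -> B (x i)).
Proof.
move=> /familyP h; have {}h i : mix m A B i (x i) by exact: h.
split=> i im; have := h i; rewrite /mix ?im //.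
by rewrite ltnNge im.
Qed.

Lemma mix_family m (A B : pred 'I_N) (x : {ffun 'I_6 -> 'I_N}) :
  (forall i : 'I_6, (i < m)%N -> A (x i)) -> (forall i : 'I_6, (m <= i)%N -> B (x i)) ->
  x \in family (mix m A B).
Proof.
move=> h1 h2; apply/familyP => i; rewrite -[_ \in _]/(mix m A B i (x i)) /mix.
by case: ltnP => h; [exact: h1|exact: h2].
Qed.

Lemma ord6_lt1 (i : 'I_6) : (i < 1)%N -> i = ord0.
Proof. by move=> h; apply: val_inj => /=; lia. Qed.

Lemma dvdz_sub_trans (n : int) (x y z : int) :
  (n %| x - z)%Z -> (n %| y - z)%Z -> (n %| x - y)%Z.
Proof.
move=> h1 h2; have -> : x - y = (x - z) - (y - z) by ring.
exact: dvdzB.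
Qed.

(** The substitution [x = eta + p^b y] preserves the system. *)
Lemma mu0_le b eta A : (b <= L)%N -> mu R 0 A (cls (p ^ b) eta : pred 'I_N) <= (J (L - b))%:R.
Proof.
move=> bL; rewrite -mu_sols // ler_nat /J /sols.
have Nb : (N = p ^ b * p ^ (L - b))%N by rewrite -expnD subnKC.
have pb0 := pX_gt0 b.
pose r := (eta %% p ^ b)%N.
have qlt (x : 'I_N) : (x %/ p ^ b < p ^ (L - b))%N.
  by rewrite ltn_divLR // mulnC -Nb.
pose g (x : {ffun 'I_6 -> 'I_N}) : {ffun 'I_6 -> 'I_(p ^ (L - b))} :=
  [ffun i => Ordinal (qlt (x i))].
have xE (x : {ffun 'I_6 -> 'I_N}) i : x \in family (mix 0 A (cls (p ^ b) eta : pred 'I_N)) ->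
   (x i = g x i * p ^ b + r :> nat)%N.
  move=> /family_mix[_ /(_ i isT)]; rewrite /cls => /eqP h.
  by rewrite /g ffunE /= /r -h -divn_eq.
rewrite -(card_in_imset (f := fun xy => (g xy.1, g xy.2))); last first.
  move=> [x y] [x' y']; rewrite !inE /= => /and3P[hx hy _] /and3P[hx' hy' _] E.
  have /= gx := congr1 fst E; have /= gy := congr1 snd E.
  congr (_, _); apply/ffunP => i; apply: val_inj => /=.
    by rewrite (xE _ _ hx) (xE _ _ hx') gx.
  by rewrite (xE _ _ hy) (xE _ _ hy') gy.
apply: subset_leq_card; apply/subsetP => w /imsetP[[x y]]; rewrite inE /=.
move=> /and3P[hx hy sxy] ->.
have [e1 e2 e3] : eqpow (fun i => (g x i)%:Z) (fun i => (g y i)%:Z).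
  apply: (@eqpow_scale _ _ (p ^ b)%N); first by move: pb0; case: (p ^ b)%N.
  apply: eqpow_ext (eqpow_shift r (solution_eqpow sxy)) => i.
    by rewrite (xE _ _ hx); lia.
  by rewrite (xE _ _ hy); lia.
have E j (z : {ffun 'I_6 -> 'I_(p ^ (L - b))}) :
    \sum_(i < 6) ((z i)%:Z) ^+ j = (psum j z)%:Z.
  rewrite /psum (big_morph Posz PoszD (erefl _)); apply: eq_bigr => i _.
  by rewrite -natz -natrX natz.
have F (z : {ffun 'I_6 -> 'I_(p ^ (L - b))}) : z \in family (fun=> predT : pred 'I_(p ^ (L - b))).
  by apply/familyP => i.
rewrite inE; apply/and5P; split=> /=; rewrite ?F //; rewrite -eqz_nat -!E; exact/eqP.
Qed.

(** After centring at [eta], the ten variables congruent to [eta] modulo [p^b]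
    contribute cubes divisible by [p^(3 b)], so the two remaining variables have
    congruent cubes, and [cube_lift] puts them in a common class modulo
    [p^(3 b)].  There are [p^(3 b - a)] such classes. *)
Lemma mu1_lift a b xi eta : (0 < a)%N -> (a <= 3 * b)%N -> (0 < b)%N ->
  ~~ (p %| xi%:Z - eta%:Z)%Z ->
  exists2 xi', ~~ (p %| xi'%:Z - eta%:Z)%Z &
    mu R 1 (cls (p ^ a) xi : pred 'I_N) (cls (p ^ b) eta) <=
    (p ^ (3 * b - a))%:R * mu R 1 (cls (p ^ (3 * b)) xi' : pred 'I_N) (cls (p ^ b) eta).
Proof.
move=> a0 ab b0 hxe.
have Pab : (p ^ (3 * b) = p ^ a * p ^ (3 * b - a))%N by rewrite -expnD subnKC.
(* the classes modulo [p^(3 b)] contained in the class of [xi] modulo [p^a] *)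
pose z (j : nat) := (xi %% p ^ a + p ^ a * j)%N.
have pa : (p%:Z %| (p ^ a)%N%:Z)%Z by rewrite dvdzE /= dvdn_exp.
have zxi j : (p %| (z j)%:Z - xi%:Z)%Z.
  apply: dvdz_trans pa _; rewrite -eqz_mod_dvd !modz_nat /z.
  by rewrite eqz_nat addnC (mulnC (p ^ a)%N) modnMDl modn_mod.
have zeta j : ~~ (p %| (z j)%:Z - eta%:Z)%Z.
  apply/negP => h; move/negP: hxe; apply.
  have -> : xi%:Z - eta%:Z = ((z j)%:Z - eta%:Z) - ((z j)%:Z - xi%:Z) by ring.
  exact: dvdzB.
have [j hj] := sum_le_max (fun j => mu R 1 (cls (p ^ (3 * b)) (z j) : pred 'I_N) (cls (p ^ b) eta))
  (pX_gt0 (3 * b - a)).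
exists (z j) => //; apply: le_trans hj; rewrite -mu_sols //.
under eq_bigr do rewrite -mu_sols //.
rewrite -natr_sum ler_nat; apply: sols_cover => x y hx hy sxy.
have [x0 x1] := family_mix hx; have [y0 y1] := family_mix hy.
have x00 := x0 ord0 isT; have y00 := y0 ord0 isT.
have lt : ((x ord0 %% p ^ (3 * b)) %/ p ^ a < p ^ (3 * b - a))%N.
  by rewrite ltn_divLR ?pX_gt0 // (mulnC _ (p ^ a)%N) -Pab ltn_mod pX_gt0.
have zE : z (Ordinal lt) = (x ord0 %% p ^ (3 * b))%N.
  rewrite /z /=; have -> : (xi %% p ^ a = (x ord0 %% p ^ (3 * b)) %% p ^ a)%N.
    by rewrite modn_dvdm; [move: x00 => /eqP -> | rewrite Pab dvdn_mulr].
  by rewrite addnC (mulnC (p ^ a)%N) -divn_eq.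
have xz : cls (p ^ (3 * b)) (z (Ordinal lt)) (x ord0).
  by rewrite /cls zE modn_mod.
have yz : cls (p ^ (3 * b)) (z (Ordinal lt)) (y ord0).
  rewrite clsE; move: (xz); rewrite clsE => xz'.
  apply: (@dvdz_sub_trans _ _ _ (x ord0)%:Z); last first.
    by rewrite -dvdzN opprB.
  have -> : (y ord0)%:Z - (x ord0)%:Z = ((y ord0)%:Z - eta%:Z) - ((x ord0)%:Z - eta%:Z) by ring.
  have xxi : (p %| (x ord0)%:Z - xi%:Z)%Z by apply: dvdz_trans pa _; rewrite -clsE.
  have yxi : (p %| (y ord0)%:Z - xi%:Z)%Z by apply: dvdz_trans pa _; rewrite -clsE.
  apply: cube_lift => //.
  - have -> : ((y ord0)%:Z - eta%:Z) - ((x ord0)%:Z - eta%:Z) =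
      ((y ord0)%:Z - xi%:Z) - ((x ord0)%:Z - xi%:Z) by ring.
    exact: dvdzB.
  - apply/negP => h; move/negP: hxe; apply.
    have -> : xi%:Z - eta%:Z = ((y ord0)%:Z - eta%:Z) - ((y ord0)%:Z - xi%:Z) by ring.
    exact: dvdzB.
  have [_ _ e3] := eqpow_shift eta%:Z (solution_eqpow sxy).
  move: e3; rewrite (bigD1 ord0) //= [in RHS](bigD1 ord0) //= => e3.
  have -> : ((y ord0)%:Z - eta%:Z) ^+ 3 - ((x ord0)%:Z - eta%:Z) ^+ 3 =
    \sum_(i < 6 | i != ord0) (((x i)%:Z - eta%:Z) ^+ 3 - ((y i)%:Z - eta%:Z) ^+ 3).
    by rewrite sumrB; exact: subz_of_add2.
  have -> : (p ^ (3 * b))%N%:Z = (p ^ b)%N%:Z ^+ 3.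
    by rewrite mulnC expnM -natz natrX natz.
  apply: rpred_sum => i i0.
  have i1 : (1 <= i)%N by rewrite lt0n.
  by apply: dvdzB; apply: dvdz_exp2r; rewrite -clsE; [exact: x1|exact: y1].
exists (Ordinal lt); apply: mix_family => // i /ord6_lt1 -> //.
Qed.

End Level.
End Congruencing.

(** Parametrises the zeros of [u * v] modulo [p^e]; each value of [i] accounts
    for [p^e] pairs of residues. *)
Lemma dvdn_pX_mul p e u v : prime p -> (p ^ e %| u * v)%N ->
  exists2 i, (i <= e)%N & (p ^ i %| u)%N && (p ^ (e - i) %| v)%N.
Proof.
move=> pp h; have [->|u0] := posnP u.
  by exists e; rewrite // subnn dvdn0 expn0 dvd1n.
have [->|v0] := posnP v; first by exists 0%N; rewrite // dvdn0 expn0 dvd1n.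
exists (minn (logn p u) e); first exact: geq_minr.
move: h; rewrite !pfactor_dvdn ?muln_gt0 ?u0 // lognM //.
by move: (logn p u) (logn p v) => i j; lia.
Qed.

Section Congruencing2.
Variables (R : realType) (p : nat).
Hypotheses (pp : prime p) (p7 : (7 <= p)%N).
Variable L : nat.
Notation N := (p ^ L)%N.

Definition quad (A B C : pred 'I_N) (i : 'I_6) : pred 'I_N :=
  if i == 0%N :> nat then A else if i == 1%N :> nat then B else C.

Lemma quad_family (A B C : pred 'I_N) (x : {ffun 'I_6 -> 'I_N}) :
  A (x (inord 0)) -> B (x (inord 1)) -> (forall i : 'I_6, (2 <= i)%N -> C (x i)) ->
  x \in family (quad A B C).
Proof.
move=> h0 h1 h2; apply/familyP => i; rewrite -[_ \in _]/(quad A B C i (x i)) /quad.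
case: eqP => [i0|/eqP i0].
  by have -> : i = inord 0 by apply: val_inj; rewrite /= inordK.
case: eqP => [i1|/eqP i1].
  by have -> : i = inord 1 by apply: val_inj; rewrite /= inordK.
by apply: h2; move: (nat_of_ord i) i0 i1; lia.
Qed.

Lemma sols_quad_le (A A' B B' C : pred 'I_N) (K : R) :
  mu R 2 A C <= K -> mu R 2 A' C <= K -> mu R 2 B C <= K -> mu R 2 B' C <= K ->
  (sols (quad A A' C) (quad B B' C))%:R <= K.
Proof.
move=> h1 h2 h3 h4; apply: le_trans (sols_le_mean R _ _) _.
apply: le_trans (mean_prod4 h1 h2 h3 h4); apply: le_mean => t.
rewrite (eq_bigr (fun i : 'I_6 =>
  (if i == 0%N :> nat then mag (cubes R A t) * mag (cubes R B t) else
   if i == 1%N :> nat then mag (cubes R A' t) * mag (cubes R B' t) else pw R C t))); last first.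
  by move=> i _; rewrite /quad /pw; case: ifP => // _; case: ifP => // _; rewrite expr2.
rewrite !big_ord_recl big_ord0 /= mulr1.
move: (mag _) (mag _) (mag _) (mag _) (pw _ _ _) => a b c d u.
by rewrite le_eqVlt; apply/orP; left; apply/eqP; ring.
Qed.

Lemma big_ord6_split2 (f : 'I_6 -> int) :
  \sum_i f i = f (inord 0) + f (inord 1) + \sum_(i < 6 | (2 <= i)%N) f i.
Proof.
rewrite (bigD1 (inord 0)) //= (bigD1 (inord 1)) /=; last first.
  by rewrite -val_eqE /= !inordK.
rewrite addrA; congr (_ + _); apply: eq_bigl => i.
by rewrite -!val_eqE /= !inordK //; move: (nat_of_ord i); lia.
Qed.

(** The eight variables in the class of [eta] are negligible modulo [p^(2 b)], so
    [pair_lift] applies to the other four: with [y0 = x0 + p^a u] and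
    [y1 = x0 + p^a v] one gets [p^(2 (b - a))] dividing [u * v], and [x1] is then
    determined modulo [p^(2 b - a)].  The number of admissible quadruples of
    classes modulo [p^(2 b - a)] is [(2 (b - a) + 1) p^(4 (b - a))]. *)
Lemma mu2_lift a b xi eta (K : R) : (0 < a)%N -> (a <= b)%N ->
  ~~ (p %| xi%:Z - eta%:Z)%Z -> 0 <= K ->
  (forall xi', ~~ (p %| xi'%:Z - eta%:Z)%Z ->
    mu R 2 (cls (p ^ (2 * b - a)) xi' : pred 'I_N) (cls (p ^ b) eta) <= K) ->
  mu R 2 (cls (p ^ a) xi : pred 'I_N) (cls (p ^ b) eta) <=
  (2 * b)%:R * (p ^ (4 * (b - a)))%:R * K.
Proof.
move=> a0 ab hxe K0 HK.
pose c := (2 * b - a)%N; pose e := (2 * (b - a))%N.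
have Pc : (p ^ c = p ^ a * p ^ e)%N by rewrite -expnD; congr (_ ^ _)%N; rewrite /c /e; lia.
pose z (r : nat) := (xi %% p ^ a + p ^ a * r)%N.
pose C := cls (p ^ b) eta : pred 'I_N.
pose k (r : nat) := cls (p ^ c) r : pred 'I_N.
(* [m] encodes [u / p^i] and [v / p^(e - i)] as the digits of a number below [p^e] *)
pose cu (i m : nat) := (p ^ a * (p ^ i * (m %/ p ^ i)))%N.
pose cv (i m : nat) := (p ^ a * (p ^ (e - i) * (m %% p ^ i)))%N.
pose A' (j : 'I_(p ^ e) * 'I_e.+1 * 'I_(p ^ e)) :=
  let: (r, i, m) := j in quad (k (z r)) (k (z r + (cu i m + cv i m)))%N C.
pose B' (j : 'I_(p ^ e) * 'I_e.+1 * 'I_(p ^ e)) :=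
  let: (r, i, m) := j in quad (k (z r + cu i m))%N (k (z r + cv i m))%N C.
have pa : (p%:Z %| (p ^ a)%N%:Z)%Z by rewrite dvdzE /= dvdn_exp.
have zeta r (d : nat) : (p ^ a %| d)%N -> ~~ (p %| (z r + d)%N%:Z - eta%:Z)%Z.
  move=> hd; have zxi : (p %| (z r + d)%N%:Z - xi%:Z)%Z.
    apply: dvdz_trans pa _; rewrite -eqz_mod_dvd !modz_nat /z eqz_nat.
    by rewrite -addnA addnC -modnDml (eqP (dvdn_add (dvdn_mulr r (dvdnn _)) hd)) add0n modn_mod.
  apply/negP => h; move/negP: hxe; apply.
  have -> : xi%:Z - eta%:Z = ((z r + d)%N%:Z - eta%:Z) - ((z r + d)%N%:Z - xi%:Z) by ring.
  exact: dvdzB.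
have hcu i m : (p ^ a %| cu i m)%N by rewrite dvdn_mulr.
have hcv i m : (p ^ a %| cv i m)%N by rewrite dvdn_mulr.
have cover : (sols (mix 2 (cls (p ^ a) xi : pred 'I_N) C) (mix 2 (cls (p ^ a) xi : pred 'I_N) C)
    <= \sum_j sols (A' j) (B' j))%N.
  apply: sols_cover => x y hx hy sxy.
  have [x0 x1] := family_mix hx; have [y0 y1] := family_mix hy.
  have i0 : ((inord 0 : 'I_6) < 2)%N by rewrite inordK.
  have i1 : ((inord 1 : 'I_6) < 2)%N by rewrite inordK.
  have xa0 := x0 _ i0; have xa1 := x0 _ i1; have ya0 := y0 _ i0; have ya1 := y0 _ i1.
  have [dS dP] : ((p ^ (2 * b))%N %| ((x (inord 0))%:Z + (x (inord 1))%:Z)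
        - ((y (inord 0))%:Z + (y (inord 1))%:Z))%Z /\
      ((p ^ (2 * b))%N %| ((y (inord 0))%:Z - (x (inord 0))%:Z) *
        ((y (inord 1))%:Z - (x (inord 0))%:Z))%Z.
    have [_ q2 q3] := eqpow_shift eta%:Z (solution_eqpow sxy).
    have same (u v : 'I_N) : cls (p ^ a) xi u -> cls (p ^ a) xi v ->
        (p %| (u%:Z - eta%:Z) - (v%:Z - eta%:Z))%Z.
      rewrite !clsE => hu hv; apply: dvdz_trans pa _.
      have -> : (u%:Z - eta%:Z) - (v%:Z - eta%:Z) = (u%:Z - xi%:Z) - (v%:Z - xi%:Z) by ring.
      exact: dvdzB.
    have unit (u : 'I_N) : cls (p ^ a) xi u -> ~~ (p %| u%:Z - eta%:Z)%Z.
      rewrite clsE => hu; apply/negP => h; move/negP: hxe; apply.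
      have -> : xi%:Z - eta%:Z = (u%:Z - eta%:Z) - (u%:Z - xi%:Z) by ring.
      by apply: dvdzB => //; apply: dvdz_trans pa _.
    have P2 : (p ^ (2 * b))%N%:Z = (p ^ b)%N%:Z ^+ 2 by rewrite mulnC expnM -natz natrX natz.
    have rest j : (2 <= j)%N -> ((p ^ (2 * b))%N%:Z %|
       \sum_(i < 6 | (2 <= i)%N) (((y i)%:Z - eta%:Z) ^+ j - ((x i)%:Z - eta%:Z) ^+ j))%Z.
      move=> j2; rewrite P2; apply: rpred_sum => i i2.
      apply: (@dvdz_trans ((p ^ b)%N%:Z ^+ j)); first exact: dvdz_exp2l.
      by apply: dvdzB; apply: dvdz_exp2r; rewrite -clsE; [exact: y1|exact: x1].
    have [] := @pair_lift p pp p7 (2 * b) ((x (inord 0))%:Z - eta%:Z) ((x (inord 1))%:Z - eta%:Z)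
      ((y (inord 0))%:Z - eta%:Z) ((y (inord 1))%:Z - eta%:Z).
    - exact: same.
    - exact: same.
    - exact: same.
    - exact: unit.
    - by have := rest 2%N isT; rewrite sumrB; move: q2; rewrite !big_ord6_split2 => /subz_of_add3 ->.
    - by have := rest 3%N isT; rewrite sumrB; move: q3; rewrite !big_ord6_split2 => /subz_of_add3 ->.
    move=> h1 h2; split.
      by move: h1; congr (_ %| _)%Z; ring.
    by move: h2; congr (_ %| _ * _)%Z; ring.
  move: dS dP xa0 ya0 ya1; set X := x (inord 0); set Y := y (inord 0); set Z := y (inord 1).
  move=> dS dP xa0 ya0 ya1.
  have ltr : ((X %% p ^ c) %/ p ^ a < p ^ e)%N.
    by rewrite ltn_divLR ?pX_gt0 // (mulnC _ (p ^ a)%N) -Pc ltn_mod pX_gt0.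
  have zE : z ((X %% p ^ c) %/ p ^ a)%N = (X %% p ^ c)%N.
    rewrite /z; have -> : (xi %% p ^ a = (X %% p ^ c) %% p ^ a)%N.
      by rewrite modn_dvdm; [move: xa0 => /eqP -> | rewrite Pc dvdn_mulr].
    by rewrite addnC (mulnC (p ^ a)%N) -divn_eq.
  have kX : ((p ^ c)%N%:Z %| X%:Z - (z ((X %% p ^ c) %/ p ^ a)%N)%:Z)%Z.
    by rewrite zE -eqz_mod_dvd !modz_nat modn_mod.
  have pa0 := pX_gt0 pp p7 a; have pe0 := pX_gt0 pp p7 e.
  have split2 (V : 'I_N) : cls (p ^ a) xi V -> exists2 m : nat, (m < p ^ e)%N &
      exists w : int, V%:Z - X%:Z = (p ^ a)%N%:Z * (m%:Z + (p ^ e)%N%:Z * w).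
    move=> hV; have : ((p ^ a)%N%:Z %| V%:Z - X%:Z)%Z.
      apply: (@dvdz_sub_trans _ _ _ xi%:Z); by rewrite -clsE.
    case/dvdzP => d dE; exists `|(d %% (p ^ e)%N)%Z|%N.
      by rewrite -ltz_nat gez0_abs ?modz_ge0 ?ltz_pmod // -lt0n.
    exists (d %/ (p ^ e)%N)%Z; rewrite dE gez0_abs ?modz_ge0 -?lt0n //.
    by rewrite {1}(divz_eq d (p ^ e)%N); ring.
  have [u ult [w uE]] := split2 Y ya0; have [v vlt [w' vE]] := split2 Z ya1.
  have : (p ^ e %| u * v)%N.
    suff : ((p ^ e)%N%:Z %| u%:Z * v%:Z)%Z by rewrite dvdzE abszM.
    have : ((p ^ e)%N%:Z %| (u%:Z + (p ^ e)%N%:Z * w) * (v%:Z + (p ^ e)%N%:Z * w'))%Z.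
      rewrite -(@dvdz_mul2l ((p ^ a * p ^ a)%N)); last by rewrite -lt0n muln_gt0 pa0.
      move: dP; rewrite uE vE; congr (_ %| _)%Z; first by rewrite PoszM; ring.
      by rewrite -PoszM -!expnD; congr (Posz (_ ^ _)%N); rewrite /e; clear -ab; lia.
    have -> : (u%:Z + (p ^ e)%N%:Z * w) * (v%:Z + (p ^ e)%N%:Z * w') =
       u%:Z * v%:Z + (p ^ e)%N%:Z * (u%:Z * w' + w * v%:Z + (p ^ e)%N%:Z * w * w') by ring.
    move=> h; rewrite -(addrK ((p ^ e)%N%:Z * (u%:Z * w' + w * v%:Z + (p ^ e)%N%:Z * w * w')) (u%:Z * v%:Z)).
    by apply: dvdzB => //; apply: dvdz_mulr.
  case/(dvdn_pX_mul pp) => i ie /andP[/dvdnP[u' u'E] /dvdnP[v' v'E]].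
  have pi0 := pX_gt0 pp p7 i; have pei0 := pX_gt0 pp p7 (e - i).
  have Pe : (p ^ e = p ^ i * p ^ (e - i))%N by rewrite -expnD subnKC.
  have u'lt : (u' < p ^ (e - i))%N.
    by move: ult; rewrite u'E Pe mulnC ltn_pmul2l.
  have v'lt : (v' < p ^ i)%N.
    by move: vlt; rewrite v'E Pe ltn_pmul2r.
  have mlt : (u' * p ^ i + v' < p ^ e)%N.
    rewrite Pe (mulnC (p ^ i)%N); apply: leq_trans (_ : u'.+1 * p ^ i <= _)%N.
      by rewrite mulSn addnC ltn_add2r.
    by rewrite leq_mul2r u'lt orbT.
  have md : ((u' * p ^ i + v') %/ p ^ i = u')%N by rewrite divnMDl // divn_small ?addn0.
  have mm : ((u' * p ^ i + v') %% p ^ i = v')%N by rewrite modnMDl modn_small.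
  have ie' : (i < e.+1)%N by rewrite ltnS.
  have Ecu : cu i (u' * p ^ i + v')%N = (p ^ a * u)%N by rewrite /cu md u'E (mulnC u').
  have Ecv : cv i (u' * p ^ i + v')%N = (p ^ a * v)%N by rewrite /cv mm v'E (mulnC v').
  have Pcz : (p ^ c)%N%:Z = (p ^ a)%N%:Z * (p ^ e)%N%:Z by rewrite Pc PoszM.
  have kY : ((p ^ c)%N%:Z %| Y%:Z - (z ((X %% p ^ c) %/ p ^ a)%N + p ^ a * u)%N%:Z)%Z.
    have -> : Y%:Z - (z ((X %% p ^ c) %/ p ^ a)%N + p ^ a * u)%N%:Z =
       (X%:Z - (z ((X %% p ^ c) %/ p ^ a)%N)%:Z) + (p ^ c)%N%:Z * w.
       by rewrite Pcz PoszD PoszM; exact: residue_step.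
    by apply: dvdzD => //; apply: dvdz_mulr.
  have kZ : ((p ^ c)%N%:Z %| Z%:Z - (z ((X %% p ^ c) %/ p ^ a)%N + p ^ a * v)%N%:Z)%Z.
    have -> : Z%:Z - (z ((X %% p ^ c) %/ p ^ a)%N + p ^ a * v)%N%:Z =
       (X%:Z - (z ((X %% p ^ c) %/ p ^ a)%N)%:Z) + (p ^ c)%N%:Z * w'.
       by rewrite Pcz PoszD PoszM; exact: residue_step.
    by apply: dvdzD => //; apply: dvdz_mulr.
  pose zz := z ((X %% p ^ c) %/ p ^ a)%N; pose q := (u' * p ^ i + v')%N.
  have xq : x \in family (quad (k zz) (k (zz + (cu i q + cv i q))%N) C).
    rewrite Ecu Ecv; apply: quad_family => //; rewrite /k clsE //.
    have -> : (x (inord 1))%:Z - (z ((X %% p ^ c) %/ p ^ a)%N + (p ^ a * u + p ^ a * v))%N%:Z =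
       (X%:Z + (x (inord 1))%:Z - (Y%:Z + Z%:Z))
       + (Y%:Z - (z ((X %% p ^ c) %/ p ^ a)%N + p ^ a * u)%N%:Z)
       + (Z%:Z - (z ((X %% p ^ c) %/ p ^ a)%N + p ^ a * v)%N%:Z)
       - (X%:Z - (z ((X %% p ^ c) %/ p ^ a)%N)%:Z) by rewrite !PoszD; ring.
    apply: dvdzB kX; apply: dvdzD kZ; apply: dvdzD kY.
    by apply: dvdz_trans dS; rewrite dvdzE /=; apply: dvdn_exp2l; rewrite /c leq_subr.
  have yq : y \in family (quad (k (zz + cu i q)%N) (k (zz + cv i q)%N) C).
    by rewrite Ecu Ecv; apply: quad_family => //; rewrite /k clsE; [exact: kY|exact: kZ].
  by exists (Ordinal ltr, Ordinal ie', Ordinal mlt).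
rewrite -mu_sols //; apply: le_trans (_ : (\sum_j sols (A' j) (B' j))%:R <= _).
  by rewrite ler_nat.
rewrite natr_sum; apply: le_trans (_ : \sum_(j : 'I_(p ^ e) * 'I_e.+1 * 'I_(p ^ e)) K <= _).
  apply: ler_sum => -[[r i] m] _; apply: sols_quad_le.
  - by apply: HK; rewrite -[z r]addn0; apply: zeta; rewrite dvdn0.
  - by apply: HK; apply: zeta; rewrite dvdn_add.
  - by apply: HK; apply: zeta.
  - by apply: HK; apply: zeta.
rewrite sumr_const -[K *+ _]mulr_natl; apply: ler_wpM2r => //.
rewrite -natrM ler_nat !card_prod !card_ord mulnAC -expnD mulnC.
have -> : (e + e = 4 * (b - a))%N by rewrite /e; lia.
by rewrite leq_mul2r; apply/orP; right; rewrite /e; lia.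
Qed.

End Congruencing2.

(** * The cubic case of Vinogradov's mean value theorem *)

(** A large sum of [q] terms comes either from one large term or from two
    different ones.  The second case is the one in which two variables of the
    system are incongruent modulo [p]. *)
Lemma two_largest (R : realFieldType) (q : nat) (a : 'I_q -> R) :
  (1 < q)%N -> (forall i, 0 <= a i) ->
  (\sum_i a i) ^+ 12 <=
  2 ^+ 11 * (\sum_i a i ^+ 12 +
    q%:R ^+ 12 * \sum_i \sum_(j | j != i) a i ^+ 4 * a j ^+ 8).
Proof.
case: q a => // q a q1 a0.
have [i0 _ hi0] := @arg_maxP _ _ 'I_q.+1 ord0 xpredT a isT.
have [j1 j1i] : exists j : 'I_q.+1, j != i0.
  have [->|h] := eqVneq i0 ord0; last by exists ord0; rewrite eq_sym.
  by exists (Ordinal q1).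
have [i1 i1i hi1] := @arg_maxP _ _ 'I_q.+1 j1 (fun j => j != i0) a j1i.
have S2 : \sum_(j | j != i0) a j <= q.+1%:R * a i1.
  apply: le_trans (_ : \sum_(j < q.+1) a i1 <= _); last first.
    by rewrite sumr_const card_ord mulr_natl.
  apply: le_trans (_ : \sum_(j | j != i0) a i1 <= _); first exact: ler_sum.
  by rewrite [leRHS](bigID (fun j => j != i0)) /= lerDl sumr_ge0.
rewrite (bigD1 i0) //=.
set s := \sum_(j | j != i0) a j in S2 *; have s0 : 0 <= s by exact: sumr_ge0.
have := @power_mean R bool [:: true; false] xpredT (fun b => if b then a i0 else s) 11.
rewrite !big_cons !big_nil /= !addr0 => pm.
apply: le_trans (pm _) _; first by case.
rewrite ler_pM2l ?exprn_gt0 //; apply: lerD.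
  by rewrite (bigD1 i0) //= lerDl sumr_ge0 // => i _; rewrite exprn_ge0.
apply: le_trans (_ : (q.+1%:R * a i1) ^+ 12 <= _).
  by rewrite lerXn2r // nnegrE mulr_ge0 ?ler0n.
rewrite exprMn ler_wpM2l ?exprn_ge0 ?ler0n //.
have nn i j : 0 <= a i ^+ 4 * a j ^+ 8 by rewrite mulr_ge0 ?exprn_ge0.
apply: le_trans (_ : a i0 ^+ 4 * a i1 ^+ 8 <= _).
  by rewrite (exprD _ 4 8) ler_wpM2r ?exprn_ge0 // lerXn2r ?nnegrE //; exact: hi0.
rewrite (bigD1 i0) //= (bigD1 i1) //= -addrA lerDl addr_ge0 ?sumr_ge0 //.
by move=> i _; rewrite sumr_ge0.
Qed.

Section Vinogradov.
Variables (R : realType) (p : nat).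
Hypotheses (pp : prime p) (p7 : (7 <= p)%N).
Let P : R := p%:R.

Lemma prime_gt0R : 0 < P. Proof. by rewrite ltr0n; lia. Qed.

Section Iteration.
Variables (L : nat) (sg C : R).
Hypotheses (sg1 : 1 <= sg) (C0 : 0 <= C).
Hypothesis IH : forall l, (l < L)%N -> (J p l)%:R <= C * P ^+ (6 * l) * sg ^+ (6 * l).
Notation N := (p ^ L)%N.
Variable T : R.
Hypothesis TE : T = C * P ^+ (6 * L) * sg ^+ (6 * L).

Let sg0 : 0 < sg. Proof. exact: lt_le_trans sg1. Qed.

Let T0 : 0 <= T.
Proof. by rewrite TE !mulr_ge0 // ?exprn_ge0 ?(ltW prime_gt0R) ?(ltW sg0). Qed.

Lemma mu0_bound b eta A : (0 < b)%N -> (b <= L)%N ->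
  mu R 0 A (cls (p ^ b) eta : pred 'I_N) * (P ^+ (6 * b) * sg ^+ (6 * b)) <= T.
Proof.
move=> b0 bL; have := mu0_le R pp p7 eta A bL; have := @IH (L - b)%N.
move=> /(_ ltac:(lia)) h1 h2.
have : mu R 0 A (cls (p ^ b) eta : pred 'I_N) <=
  C * P ^+ (6 * (L - b)) * sg ^+ (6 * (L - b)) by exact: le_trans h1.
have Pb : 0 < P ^+ (6 * b) * sg ^+ (6 * b) by rewrite mulr_gt0 ?exprn_gt0 ?prime_gt0R.
move=> h; apply: le_trans (ler_wpM2r (ltW Pb) h) _.
rewrite TE (_ : 6 * L = 6 * (L - b) + 6 * b)%N; last by lia.
by rewrite !exprD le_eqVlt; apply/orP; left; apply/eqP; ring.
Qed.

Lemma incong_sym (x y : nat) : ~~ (p %| x%:Z - y%:Z)%Z -> ~~ (p %| y%:Z - x%:Z)%Z.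
Proof. by rewrite -dvdzN opprB. Qed.

(** The recursion.  One step lifts the first variables with [mu2_lift],
    interpolates, lifts again with [mu1_lift] and interpolates once more; up to
    powers of [p] the sixth power of the moment for [(a, b)] is then at most
    [(2 b)^6] times the square of the moment for [(b, 2 b - a)], the moment for
    [(b, 3 b)] and the cube of [J p (L - b)].  The linear form [3 b - a] is
    reproduced by this recursion, while the factor [J p (L - b)] contributes a
    gain in every step; and the weight [32 b^2] absorbs [(2 b)^6] because the
    exponents of the two moments add up to half of 6. *)
Lemma mu2_iter n a b xi eta : (0 < a)%N -> (a <= b)%N -> (3 ^ n * b <= L)%N ->
  ~~ (p %| xi%:Z - eta%:Z)%Z ->
  mu R 2 (cls (p ^ a) xi : pred 'I_N) (cls (p ^ b) eta) *
    (P ^+ (2 * a + 4 * b) * sg ^+ (n * (3 * b - a))) <= 32 * b%:R ^+ 2 * T.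
Proof.
have sgn m : 1 <= sg ^+ m by exact: exprn_ege1.
have P0 := prime_gt0R.
elim: n a b xi eta => [|n IHn] a b xi eta a0 ab bL hxe.
  have b0 : (0 < b)%N by lia.
  rewrite expn0 mul1n in bL; rewrite mul0n expr0 mulr1.
  have Pa : 0 <= P ^+ a by rewrite exprn_ge0 ?ltW.
  have Pb : 0 <= P ^+ b by rewrite exprn_ge0 ?ltW.
  (* with these weights both pure moments are bounded by the induction hypothesis on [J] *)
  have := mu_young (cls (p ^ a) xi : pred 'I_N) (cls (p ^ b) eta) Pa Pb.
  have h1 c zt A : (0 < c)%N -> (c <= L)%N ->
     (P ^+ c) ^+ 6 * mu R 0 A (cls (p ^ c) zt : pred 'I_N) <= T.
    move=> c0 cL; apply: le_trans (mu0_bound zt A c0 cL).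
    rewrite mulrC; apply: ler_wpM2l; first exact: mu_ge0.
    by rewrite -exprM mulnC ler_peMr // exprn_ge0 // ltW.
  have := h1 b eta (cls (p ^ a) xi) b0 bL.
  have := h1 a xi (cls (p ^ b) eta) a0 (leq_trans ab bL).
  rewrite (mu_sym R (cls (p ^ a) xi) _ (leqnn 6)) subnn => h2 h3 h4.
  have b1 : 1 <= b%:R ^+ 2 :> R by rewrite exprn_ege1 // ler1n.
  have -> : P ^+ (2 * a + 4 * b) = (P ^+ a) ^+ 2 * (P ^+ b) ^+ 4.
    by rewrite exprD mulnC exprM mulnC exprM.
  have b2 : T <= b%:R ^+ 2 * T by rewrite ler_peMl.
  rewrite mulrC; apply: le_trans h4 _; apply: le_trans (lerD h2 h3) _; rewrite -mulrA; move: T0 b2; set u := _ ^+ 2 * T => u1 u2. lra.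
have b0 : (0 < b)%N by (clear -a0 ab; lia).
have bL' : (b <= L)%N.
  by apply: leq_trans bL; rewrite leq_pmull // expn_gt0.
have bR : 0 < b%:R :> R by rewrite ltr0n.
pose Q := P ^+ (8 * b - 2 * a) * sg ^+ (n.+1 * (3 * b - a)).
have Q0 : 0 < Q by rewrite mulr_gt0 // exprn_gt0.
(* the value for which the factor [2 b p^(4 (b - a))] of [mu2_lift] gives the claim *)
pose K := 16 * b%:R * T / Q.
have K0 : 0 <= K by rewrite divr_ge0 ?(ltW Q0) // !mulr_ge0 // ltW.
have key zt : ~~ (p %| zt%:Z - eta%:Z)%Z ->
    mu R 2 (cls (p ^ (2 * b - a)) zt : pred 'I_N) (cls (p ^ b) eta) <= K.
  move=> hz; rewrite /K ler_pdivlMr //.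
  set m := mu R 2 _ _.
  have m0 : 0 <= m by exact: mu_ge0.
  have hol2 := mu_holder2 R (cls (p ^ (2 * b - a)) zt : pred 'I_N) (cls (p ^ b) eta).
  rewrite -/m (mu_sym R _ _ (isT : (4 <= 6)%N)) (_ : (6 - 4)%N = 2%N) // in hol2.
  have c0 : (0 < 2 * b - a)%N by (clear -a0 ab b0; lia).
  have c3 : (2 * b - a <= 3 * b)%N by (clear -a0 ab b0; lia).
  have [z' hz' hz1] := mu1_lift R pp p7 L c0 c3 b0 hz.
  have hol1 := mu_holder1 R (cls (p ^ (3 * b)) z' : pred 'I_N) (cls (p ^ b) eta).
  rewrite (mu_sym R _ _ (isT : (4 <= 6)%N)) (_ : (6 - 4)%N = 2%N) // in hol1.
  have r1 : (b <= 2 * b - a)%N by (clear -a0 ab b0; lia).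
  have r2 : (3 ^ n * (2 * b - a) <= L)%N.
    apply: leq_trans bL; rewrite expnSr -mulnA leq_mul2l; apply/orP; right; (clear -a0 ab b0; lia).
  have r3 : (3 ^ n * (3 * b) <= L)%N by rewrite mulnA -expnSr.
  have r4 : (b <= 3 * b)%N by (clear -a0 ab b0; lia).
  have k1 := IHn b (2 * b - a)%N eta zt b0 r1 r2 (incong_sym hz).
  have k2 := IHn b (3 * b)%N eta z' b0 r4 r3 (incong_sym hz').
  have k0 := mu0_bound eta (cls (p ^ (3 * b)) z' : pred 'I_N) b0 bL'.
  move: hol2 hz1 hol1 k1 k2 k0.
  set m4 := mu R 2 (cls (p ^ b) eta : pred 'I_N) (cls (p ^ (2 * b - a)) zt).
  set m5 := mu R 2 (cls (p ^ b) eta : pred 'I_N) (cls (p ^ (3 * b)) z').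
  set m1 := mu R 1 _ _; set y := mu R 1 _ _; set w := mu R 0 _ _.
  move=> hol2 hz1 hol1 k1 k2 k0.
  have [m40 m50 m10 y0 w0] : [/\ 0 <= m4, 0 <= m5, 0 <= m1, 0 <= y & 0 <= w].
    by split; exact: mu_ge0.
  have {}k1 : m4 * (P ^+ (10 * b - 4 * a) * sg ^+ (n * (5 * b - 3 * a))) <= 128 * b%:R ^+ 2 * T.
    rewrite (_ : 10 * b - 4 * a = 2 * b + 4 * (2 * b - a))%N; last by (clear -a0 ab b0; lia).
    rewrite (_ : 5 * b - 3 * a = 3 * (2 * b - a) - b)%N; last by (clear -a0 ab b0; lia).
    apply: le_trans k1 _; apply: ler_wpM2r => //.
    have h : (2 * b - a)%:R <= 2 * b%:R :> R by rewrite -natrM ler_nat leq_subr.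
    have := ler0n R (2 * b - a)%N; nra.
  have {}k2 : m5 * (P ^+ (14 * b) * sg ^+ (8 * n * b)) <= 288 * b%:R ^+ 2 * T.
    rewrite (_ : 14 * b = 2 * b + 4 * (3 * b))%N; last by (clear -a0 ab b0; lia).
    rewrite (_ : 8 * n * b = n * (3 * (3 * b) - b))%N; last by (clear -a0 ab b0; nia).
    by apply: le_trans k2 _; rewrite natrM; lra.
  apply: (@ler_Xn_imp _ _ _ 5); first by rewrite !mulr_ge0 // ltW.
  have s1 : m ^+ 6 <= (P ^+ (b + a)) ^+ 4 * (w ^+ 3 * m5) * m4 ^+ 2.
    rewrite (exprM m 3 2); apply: le_trans (_ : (m1 ^+ 2 * m4) ^+ 2 <= _).
      by rewrite lerXn2r // nnegrE ?exprn_ge0 // mulr_ge0 // exprn_ge0.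
    rewrite exprMn -(exprM m1 2 2) (_ : (2 * 2)%N = 4%N) //.
    apply: ler_wpM2r; first exact: exprn_ge0.
    apply: le_trans (_ : (P ^+ (b + a) * y) ^+ 4 <= _).
      have Py : 0 <= P ^+ (b + a) * y by rewrite mulr_ge0 // exprn_ge0 // ltW.
      apply: lerXn2r; rewrite ?nnegrE //.
      apply: le_trans hz1 _; rewrite natrX (_ : 3 * b - (2 * b - a) = b + a)%N //; (clear -a0 ab b0; lia).
    by rewrite exprMn; apply: ler_wpM2l hol1; rewrite !exprn_ge0 // ltW.
  (* the exponents of [p] agree on both sides, those of [sg] leave [6 a] to spare *)
  have s2 : Q ^+ 6 * (P ^+ (b + a)) ^+ 4 <=
     (P ^+ (10 * b - 4 * a) * sg ^+ (n * (5 * b - 3 * a))) ^+ 2 *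
     (P ^+ (14 * b) * sg ^+ (8 * n * b)) * (P ^+ (6 * b) * sg ^+ (6 * b)) ^+ 3.
    rewrite /Q !exprMn -!exprM.
    have -> : (P ^+ ((10 * b - 4 * a) * 2) * sg ^+ (n * (5 * b - 3 * a) * 2)) *
      (P ^+ (14 * b) * sg ^+ (8 * n * b)) * (P ^+ (6 * b * 3) * sg ^+ (6 * b * 3)) =
      P ^+ ((10 * b - 4 * a) * 2 + 14 * b + 6 * b * 3) *
      sg ^+ (n * (5 * b - 3 * a) * 2 + 8 * n * b + 6 * b * 3) by rewrite !exprD; ring.
    rewrite mulrAC -exprD.
    rewrite (_ : (8 * b - 2 * a) * 6 + (b + a) * 4 =
       (10 * b - 4 * a) * 2 + 14 * b + 6 * b * 3)%N; last by (clear -a0 ab b0; lia).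
    apply: ler_wpM2l; first by rewrite exprn_ge0 // ltW.
    apply: ler_weXn2l => //; (clear -a0 ab b0; nia).
  rewrite exprMn; apply: le_trans (ler_wpM2r _ s1) _; first by rewrite exprn_ge0 ?ltW.
  have -> : (P ^+ (b + a)) ^+ 4 * (w ^+ 3 * m5) * m4 ^+ 2 * Q ^+ 6 =
     (w ^+ 3 * m5 * m4 ^+ 2) * (Q ^+ 6 * (P ^+ (b + a)) ^+ 4) by ring.
  apply: le_trans (ler_wpM2l _ s2) _; first by apply: mulr_ge0; [apply: mulr_ge0 => //|]; exact: exprn_ge0.
  move: k1 k2 k0; set u1 := P ^+ (10 * b - 4 * a) * _; set u2 := P ^+ (14 * b) * _.
  set u3 := P ^+ (6 * b) * _ => k1 k2 k0.
  have -> : w ^+ 3 * m5 * m4 ^+ 2 * (u1 ^+ 2 * u2 * u3 ^+ 3) =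
    (w * u3) ^+ 3 * (m5 * u2) * (m4 * u1) ^+ 2 by ring.
  have [u10 u20 u30] : [/\ 0 <= u1, 0 <= u2 & 0 <= u3].
    by split; rewrite mulr_ge0 // exprn_ge0 // ltW.
  apply: le_trans (_ : T ^+ 3 * (288 * b%:R ^+ 2 * T) * (128 * b%:R ^+ 2 * T) ^+ 2 <= _).
    have bT : 0 <= b%:R ^+ 2 * T by rewrite mulr_ge0 // exprn_ge0 // ltW.
    have wu : 0 <= w * u3 by exact: mulr_ge0.
    have mu5 : 0 <= m5 * u2 by exact: mulr_ge0.
    have mu4 : 0 <= m4 * u1 by exact: mulr_ge0.
    have E1 : (w * u3) ^+ 3 <= T ^+ 3 by apply: lerXn2r; rewrite ?nnegrE.
    have E2 : (m4 * u1) ^+ 2 <= (128 * b%:R ^+ 2 * T) ^+ 2.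
      by apply: lerXn2r; rewrite ?nnegrE // -mulrA mulr_ge0.
    apply: ler_pM => //; first by apply: mulr_ge0 => //; exact: exprn_ge0.
      exact: exprn_ge0.
    by apply: ler_pM => //; exact: exprn_ge0.
  have -> : T ^+ 3 * (288 * b%:R ^+ 2 * T) * (128 * b%:R ^+ 2 * T) ^+ 2 =
    288 * (128 ^+ 2 * (b%:R * T) ^+ 6) by ring.
  (* the constants leave room: [288 * 128^2 <= 16^6] *)
  have c16 : 16 ^+ 6 = 1024 * 128 ^+ 2 :> R by ring.
  have -> : (16 * b%:R * T) ^+ 6 = 1024 * (128 ^+ 2 * (b%:R * T) ^+ 6).
    by rewrite -mulrA exprMn c16 mulrA.
  apply: ler_wpM2r; last by lra.
  apply: mulr_ge0; apply: exprn_ge0 => //.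
  by apply: mulr_ge0 => //; exact: ltW.
have := mu2_lift pp p7 a0 ab hxe K0 key.
set m := mu R 2 _ _ => hm.
have W0 : 0 <= P ^+ (2 * a + 4 * b) * sg ^+ (n.+1 * (3 * b - a)).
  by rewrite mulr_ge0 // exprn_ge0 // ltW.
apply: le_trans (ler_wpM2r W0 hm) _.
rewrite /K /Q natrX natrM -/P le_eqVlt; apply/orP; left; apply/eqP.
have -> : P ^+ (8 * b - 2 * a) = P ^+ (4 * (b - a)) * P ^+ (2 * a + 4 * b).
  by rewrite -exprD; congr (_ ^+ _); (clear -a0 ab b0; lia).
by field; rewrite !expf_neq0 // gt_eqF.
Qed.

(** The solutions in a single class modulo [p] lose a power of [p], and those with
    two incongruent variables gain [sg^(2 n)] by [mu2_iter]; both effects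
    outweigh the numerical factors, so [C] survives the passage to [L]. *)
Lemma J_step n : (3 ^ n <= L)%N -> 2 ^+ 17 * P ^+ 8 <= sg ^+ (2 * n) ->
  (J p L)%:R <= T.
Proof.
move=> nL hn; have P0 := prime_gt0R.
have L1 : (1 <= L)%N by apply: leq_trans nL; rewrite expn_gt0.
have P7 : 7 <= P by rewrite ler_nat.
pose A (x : 'I_p) := cls (p ^ 1) x : pred 'I_N.
have split t : cubes R (predT : pred 'I_N) t = \sum_(x < p) cubes R (A x) t.
  rewrite /cubes (partition_big (fun x : 'I_N => Ordinal (ltn_pmod x (prime_gt0 pp))) xpredT) //=.
  apply: eq_bigr => i _; apply: eq_bigl => x.
  by rewrite /A /cls expn1 -val_eqE /= (modn_small (ltn_ord i)).
rewrite sols_mean.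
rewrite (eq_mean (G := fun t => mag (cubes R (predT : pred 'I_N) t) ^+ 12)); last first.
  by move=> t; rewrite prodr_const card_ord -exprM.
apply: le_trans (_ : mean (fun t => 2 ^+ 11 * (\sum_(x < p) pw R (A x) t ^+ 6 +
   P ^+ 12 * \sum_(x < p) \sum_(y < p | y != x) pw R (A x) t ^+ 2 * pw R (A y) t ^+ 4)) <= _).
  apply: le_mean => t.
  apply: le_trans (_ : (\sum_(x < p) mag (cubes R (A x) t)) ^+ 12 <= _).
    by rewrite lerXn2r ?nnegrE ?mag_ge0 ?sumr_ge0 // ?split ?mag_sum // => i _; exact: mag_ge0.
  apply: le_trans (two_largest (prime_gt1 pp) (fun x => mag_ge0 _)) _.
  rewrite le_eqVlt; apply/orP; left; apply/eqP; congr (_ * (_ + _ * _)).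
    by apply: eq_bigr => x _; rewrite /pw -exprM.
  by apply: eq_bigr => x _; apply: eq_bigr => y _; rewrite /pw -!exprM.
rewrite meanZ meanD meanZ !mean_sum.
under [in X in _ * (_ + _ * X)]eq_bigr do rewrite mean_sum.
have h0 x : mean (fun t => pw R (A x) t ^+ 6) * P ^+ 6 <= T.
  have := mu0_bound x (A x) (leqnn 1) L1; rewrite !muln1.
  rewrite /mu; under eq_mean do rewrite expr0 mul1r subn0.
  move=> h; apply: le_trans h; apply: ler_wpM2l; last by rewrite ler_peMr ?exprn_ege1 // exprn_ge0 // ltW.
  by apply: mean_ge0 => t; rewrite exprn_ge0 // pw_ge0.
have h2 (x y : 'I_p) : y != x ->
   mean (fun t => pw R (A x) t ^+ 2 * pw R (A y) t ^+ 4) * (P ^+ 6 * sg ^+ (2 * n)) <= 32 * T.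
  move=> yx; have := @mu2_iter n 1 1 x y isT isT; rewrite !muln1 mulnC => /(_ nL).
  rewrite expr1n mulr1; apply.
  rewrite -eqz_mod_dvd !modz_nat !modn_small //.
  by apply: contra yx => /eqP [h]; apply/eqP/val_inj.
have a1 : (\sum_(x < p) mean (fun t => pw R (A x) t ^+ 6)) * P ^+ 6 <= P * T.
  rewrite mulr_suml; apply: le_trans (_ : \sum_(x < p) T <= _); first exact: ler_sum.
  by rewrite sumr_const card_ord mulr_natl.
have a2 : (\sum_(x < p) \sum_(y < p | y != x)
   mean (fun t => pw R (A x) t ^+ 2 * pw R (A y) t ^+ 4)) * (P ^+ 6 * sg ^+ (2 * n)) <= P ^+ 2 * (32 * T).
  rewrite mulr_suml; apply: le_trans (_ : \sum_(x < p) P * (32 * T) <= _); last first.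
    by rewrite sumr_const card_ord -[leLHS]mulr_natl -/P mulrA -expr2.
  apply: ler_sum => x _; rewrite mulr_suml.
  apply: le_trans (_ : \sum_(y < p | y != x) 32 * T <= _).
    by apply: ler_sum => y; exact: h2.
  rewrite sumr_const -[leLHS]mulr_natl; apply: ler_wpM2r; first by rewrite mulr_ge0.
  by rewrite ler_nat; apply: leq_trans (max_card _) _; rewrite card_ord.
move: a1 a2; set S1 := \sum_(x < p) mean _; set S2 := \sum_(x < p) _ => a1 a2.
have S20 : 0 <= S2.
  apply: sumr_ge0 => x _; apply: sumr_ge0 => y _; apply: mean_ge0 => t.
  by rewrite mulr_ge0 // exprn_ge0 // pw_ge0.
have P5 : 2 ^+ 12 <= P ^+ 5.
  apply: le_trans (_ : 7 ^+ 5 <= _); first by lra.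
  by rewrite lerXn2r // nnegrE ltW.
have a1' : 2 ^+ 12 * S1 <= T.
  have PP : 0 < P ^+ 6 by rewrite exprn_gt0.
  have c12 : 0 <= 2 ^+ 12 :> R by exact: exprn_ge0.
  rewrite -(ler_pM2r PP) -mulrA; apply: le_trans (ler_wpM2l c12 a1) _.
  rewrite mulrA mulrC; apply: ler_wpM2l => //.
  by rewrite (exprSr P 5) ler_wpM2r // ltW.
have a2' : 2 ^+ 12 * (P ^+ 12 * S2) <= T.
  have PP : 0 < P ^+ 6 * 2 ^+ 17 * P ^+ 8 by rewrite !mulr_gt0 ?exprn_gt0.
  rewrite -(ler_pM2r PP).
  have : S2 * (P ^+ 6 * (2 ^+ 17 * P ^+ 8)) <= P ^+ 2 * (32 * T).
    apply: le_trans a2; apply: ler_wpM2l => //; apply: ler_wpM2l => //.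
    by rewrite exprn_ge0 // ltW.
  have PC : 0 <= 2 ^+ 12 * P ^+ 12 by rewrite mulr_ge0 ?exprn_ge0 // ltW.
  by move=> /(ler_wpM2l PC); lra.
lra.
Qed.

End Iteration.

Lemma J_trivial l : (J p l <= (p ^ l) ^ 12)%N.
Proof.
rewrite /J /sols; apply: leq_trans (max_card _) _.
by rewrite card_prod !card_ffun !card_ord -expnD.
Qed.

(** As [sg > 1] is arbitrary, this is the bound [<< X^(6 + eps)] for [X = p^l].
    The number [n] of steps depends on [sg] only, and the constant is the trivial
    bound for the ranges that are too short for [n] steps. *)
Theorem vinogradov_cubic (sg : R) : 1 < sg ->
  exists2 C, 0 < C & forall l, (J p l)%:R <= C * P ^+ (6 * l) * sg ^+ (6 * l).
Proof.
move=> sg1; have P0 := prime_gt0R.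
have P1 : 1 <= P by rewrite ler1n; lia.
have [n hn] : exists n, 2 ^+ 17 * P ^+ 8 <= sg ^+ (2 * n).
  pose d := sg - 1; have d0 : 0 < d by rewrite subr_gt0.
  exists (Num.truncn (2 ^+ 17 * P ^+ 8 / d)).+1.
  set m := (Num.truncn _).+1; have hm : 2 ^+ 17 * P ^+ 8 / d < m%:R by exact: truncnS_gt.
  rewrite ltr_pdivrMr // in hm.
  have bern j : j%:R * d <= sg ^+ j.
    elim: j => [|j IHj]; first by rewrite mul0r expr0.
    have : 1 <= sg ^+ j by apply: exprn_ege1; exact: ltW.
    move=> /(ler_wpM2l (ltW d0)); rewrite -natr1 exprS.
    have -> : sg * sg ^+ j = sg ^+ j + d * sg ^+ j by rewrite /d; ring.
    by move: IHj; move: (d * sg ^+ j) (sg ^+ j) => u v; lra.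
  apply: le_trans (ltW hm) _; apply: le_trans (bern m) _.
  by apply: ler_weXn2l; [exact: ltW|lia].
pose C := P ^+ (12 * 3 ^ n).
exists C; first by rewrite exprn_gt0.
move=> l; have [m] := ubnP l; elim: m l => // m IHm l lm.
have sge k : 1 <= sg ^+ k by apply: exprn_ege1; exact: ltW.
have [nl|ln] := leqP (3 ^ n) l.
  apply: (J_step (ltW sg1) _ _ erefl nl hn); first by rewrite exprn_ge0 // ltW.
  by move=> l' ll'; apply: IHm; lia.
apply: le_trans (_ : ((p ^ l) ^ 12)%:R <= _); first by rewrite ler_nat J_trivial.
rewrite -expnM natrX -/P -mulrA.
apply: le_trans (_ : C <= _).
  by apply: ler_weXn2l => //; nia.
have C0 : 0 <= C by rewrite exprn_ge0 // ltW.
by rewrite ler_peMr // mulr_ege1 // exprn_ege1.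
Qed.

End Vinogradov.

(** * Divisors, harmonic sums and functions of slow growth *)

Section Slow.
Variable R : realType.
Implicit Types F G : nat -> R.

(** [F N << N^eps] for every [eps > 0], stated with [eps = 1 / s] so that no real
    power occurs. *)
Definition slow F := (forall N, 0 <= F N) /\
  forall s, exists2 C, 0 <= C & forall N, (0 < N)%N -> F N ^+ s <= C * N%:R.

Lemma slow_ge0 F N : slow F -> 0 <= F N.
Proof. by case. Qed.

Lemma slow_const c : 0 <= c -> slow (fun=> c).
Proof.
move=> c0; split=> // s; exists (c ^+ s); first exact: exprn_ge0.
by move=> N N0; rewrite ler_peMr ?exprn_ge0 // ler1n.
Qed.

Lemma slow_le F G : slow G -> (forall N, 0 <= F N) -> (forall N, (0 < N)%N -> F N <= G N) -> slow F.
Proof.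
move=> [G0 sG] F0 FG; split=> // s; have [C C0 hC] := sG s; exists C => // N N0.
by apply: le_trans (hC N N0); apply: lerXn2r; rewrite ?nnegrE // FG.
Qed.

Lemma slow_mul F G : slow F -> slow G -> slow (fun N => F N * G N).
Proof.
move=> [F0 sF] [G0 sG]; split=> [N|s]; first exact: mulr_ge0.
have [C C0 hC] := sF (s * 2)%N; have [D D0 hD] := sG (s * 2)%N.
exists (C + D); first exact: addr_ge0.
move=> N N0; have N1 : 0 <= N%:R :> R by exact: ler0n.
apply: (@ler_Xn_imp _ _ _ 1); first by rewrite mulr_ge0 // addr_ge0.
rewrite -exprM exprMn.
apply: le_trans (_ : (C * N%:R) * (D * N%:R) <= _).
  by apply: ler_pM; rewrite ?exprn_ge0 ?hC ?hD.
rewrite exprMn mulrACA -expr2; apply: ler_wpM2r; first exact: exprn_ge0.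
by rewrite sqrrD; have := mulr_ge0 C0 D0; have := sqr_ge0 C; have := sqr_ge0 D; lra.
Qed.

Lemma slow_exp F m : slow F -> slow (fun N => F N ^+ m).
Proof.
move=> [F0 sF]; split=> [N|s]; first exact: exprn_ge0.
have [C C0 hC] := sF (m * s)%N; exists C => // N N0.
by rewrite -exprM hC.
Qed.

Lemma slow_add F G : slow F -> slow G -> slow (fun N => F N + G N).
Proof.
move=> sF sG; apply: (@slow_le _ (fun N => (1 + F N) * (1 + G N))); last 2 first.
- by move=> N; rewrite addr_ge0 ?slow_ge0.
- by move=> N _; have := mulr_ge0 (slow_ge0 N sF) (slow_ge0 N sG); lra.
have aux H : slow H -> slow (fun N => 1 + H N).
  move=> [H0 sH]; split=> [N|s]; first by rewrite addr_ge0.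
  have [C C0 hC] := sH s; exists (2 ^+ s * (1 + C)).
    by rewrite mulr_ge0 ?exprn_ge0 // addr_ge0.
  move=> N N0; have N1 : 1 <= N%:R :> R by rewrite ler1n.
  have [h|h] := leP (H N) 1.
    apply: le_trans (_ : 2 ^+ s <= _); first by apply: lerXn2r; rewrite ?nnegrE ?addr_ge0 //; lra.
    by rewrite -mulrA ler_peMr ?exprn_ge0 // mulrDl mul1r; have := mulr_ge0 C0 (ler0n R N); lra.
  apply: le_trans (_ : (2 * H N) ^+ s <= _).
    by apply: lerXn2r; rewrite ?nnegrE ?addr_ge0 ?mulr_ge0 //; lra.
  rewrite exprMn -mulrA; apply: ler_wpM2l; first exact: exprn_ge0.
  by apply: le_trans (hC N N0) _; rewrite ler_wpM2r ?ler0n //; lra.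
by apply: slow_mul; exact: aux.
Qed.

Lemma slow_comp F (g : nat -> nat) c m : slow F -> (0 < m)%N ->
  (forall N, (0 < N)%N -> (0 < g N <= c * N ^ m)%N) -> slow (fun N => F (g N)).
Proof.
move=> [F0 sF] m0 hg; split=> // s; have [C C0 hC] := sF (s * m)%N.
exists (1 + C * c%:R); first by rewrite addr_ge0 ?mulr_ge0 ?ler0n.
move=> N N0; have /andP[g0 gN] := hg N N0.
have Cc : 0 <= C * c%:R by rewrite mulr_ge0 ?ler0n.
clear hg; case: m m0 gN hC => // m _ gN hC.
apply: (@ler_Xn_imp _ _ _ m); first by rewrite mulr_ge0 ?ler0n // addr_ge0.
rewrite -exprM; apply: le_trans (hC _ g0) _.
apply: le_trans (_ : C * (c * N ^ m.+1)%:R <= _); first by rewrite ler_wpM2l // ler_nat.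
rewrite natrM natrX mulrA exprMn; apply: ler_wpM2r; first by rewrite exprn_ge0 ?ler0n.
apply: le_trans (_ : 1 + C * c%:R <= _); first by lra.
by rewrite ler_eXnr //; lra.
Qed.

End Slow.

Section Divisors.

(** Write [e = s j + t] with [t < s] and use [j + 1 <= 2^j]. *)
Lemma succ_exp_le s e : (0 < s)%N -> (e.+1 ^ s <= s ^ s * 2 ^ e)%N.
Proof.
move=> s0; have := divn_eq e s; set j := (e %/ s)%N => ej.
have h1 : (e.+1 <= s * j.+1)%N.
  by rewrite mulnS addnC mulnC {1}ej -addnS leq_add2l ltn_mod.
have h2 : (j.+1 <= 2 ^ j)%N by exact: ltn_expl.
apply: leq_trans (_ : (s * 2 ^ j) ^ s <= _)%N.
  by rewrite leq_exp2r // (leq_trans h1) // leq_mul2l h2 orbT.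
rewrite expnMn leq_mul2l -expnM leq_pexp2l ?orbT //.
by rewrite /j leq_trunc_div.
Qed.

Definition tau n := size (divisors n).

Lemma tau_peel p e n : prime p -> (0 < n)%N -> ~~ (p %| n)%N ->
  (tau (p ^ e * n) <= e.+1 * tau n)%N.
Proof.
move=> pp n0 pn; rewrite /tau -[e.+1](size_iota 0) -(size_allpairs (fun i d => (p ^ i * d)%N)).
apply: uniq_leq_size; first exact: divisors_uniq.
have pe0 : (0 < p ^ e)%N by rewrite expn_gt0 prime_gt0.
move=> d; rewrite -dvdn_divisors ?muln_gt0 ?pe0 // => dn.
have d0 : (0 < d)%N by apply: dvdn_gt0 dn; rewrite muln_gt0 pe0.
apply/allpairsP; exists (logn p d, (d %/ p ^ logn p d)%N); rewrite ![_.1]/(logn p d) ![_.2]/(d %/ p ^ logn p d)%N.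
have pd : (p ^ logn p d %| d)%N by exact: pfactor_dvdnn.
split; last by rewrite mulnC divnK.
- rewrite mem_iota add0n ltnS /=.
  have := dvdn_leq_log p (_ : 0 < p ^ e * n)%N dn; rewrite muln_gt0 pe0 n0 => /(_ isT).
  rewrite lognM // pfactorK // (_ : logn p n = 0)%N ?addn0 //.
  by apply/eqP; rewrite -leqn0 leqNgt logn_gt0 mem_primes (negbTE pn) !andbF.
- rewrite -dvdn_divisors //.
  have cop : coprime (d %/ p ^ logn p d) (p ^ e).
    rewrite coprime_sym; apply: coprimeXl; rewrite prime_coprime //.
    apply/negP => h.
    have : (p ^ (logn p d).+1 %| d)%N by rewrite -[X in (_ %| X)%N](divnK pd) expnS dvdn_mul.
    by rewrite pfactor_dvdn // ltnn.
  rewrite -(Gauss_dvdr _ cop); apply: dvdn_trans dn.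
  exact: dvdn_div.
Qed.

(** Peeling off the smallest prime factor [p], with exponent [e], costs
    [(e + 1)^s].  This is at most [p^e] if [p >= 2^s], and at most [s^s p^e] in any
    case; the parameter [q] counts how many small primes are left. *)
Lemma tau_bound_rough s q n : (0 < s)%N -> (0 < n)%N ->
  (forall p, prime p -> (p %| n)%N -> (q <= p)%N) ->
  (tau n ^ s <= (s ^ s) ^ (2 ^ s - q) * n)%N.
Proof.
move=> s0; have K0 : (0 < s ^ s)%N by rewrite expn_gt0 s0.
have [m] := ubnP n; elim: m n q => // m IH n q nm n0 hq.
have [n1|n1] := leqP n 1.
  have -> : n = 1%N by lia.
  by rewrite (_ : tau 1 = 1%N) // exp1n muln1 expn_gt0 K0.
pose p := pdiv n; have pp : prime p by exact: pdiv_prime.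
have pn : (p %| n)%N by exact: pdiv_dvd.
have [n' pn' nE] := pfactor_coprime pp n0.
set e := logn p n in nE.
have e0 : (0 < e)%N by rewrite logn_gt0 mem_primes pp n0 pn.
have n'0 : (0 < n')%N by rewrite nE muln_gt0 in n0; case/andP: n0.
have pn'' : ~~ (p %| n')%N by rewrite -prime_coprime.
have pe : (1 < p ^ e)%N by rewrite -{1}(expn0 p) ltn_exp2l ?prime_gt1.
have n'n : (n' < n)%N by rewrite nE -{1}[n']muln1 ltn_pmul2l.
have := IH n' p.+1 (leq_trans n'n nm) n'0.
have hr r : prime r -> (r %| n')%N -> (p < r)%N.
  move=> rp rn; have rn' : (r %| n)%N by rewrite nE dvdn_mulr.
  rewrite ltn_neqAle pdiv_min_dvd ?prime_gt1 // andbT.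
  by apply/eqP => pr; move: pn''; rewrite pr rn.
move=> /(_ hr) hn'.
apply: leq_trans (_ : (e.+1 * tau n') ^ s <= _)%N.
  by rewrite leq_exp2r // {1}nE mulnC tau_peel.
rewrite expnMn [X in (_ <= _ * X)%N]nE.
have qp : (q <= p)%N by exact: hq.
have [pB|Bp] := ltnP p (2 ^ s).
  apply: leq_trans (_ : (s ^ s * p ^ e) * ((s ^ s) ^ (2 ^ s - p.+1) * n') <= _)%N.
    apply: leq_mul => //; apply: leq_trans (succ_exp_le e s0) _.
    by rewrite leq_mul2l leq_exp2r ?prime_gt1 ?orbT.
  rewrite mulnACA -expnS (mulnC n'); apply: leq_mul => //.
  by rewrite leq_pexp2l //; lia.
apply: leq_trans (_ : p ^ e * ((s ^ s) ^ (2 ^ s - p.+1) * n') <= _)%N.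
  apply: leq_mul => //; apply: leq_trans (_ : (2 ^ e) ^ s <= _)%N.
    by rewrite leq_exp2r // ltn_expl.
  by rewrite -expnM mulnC expnM leq_exp2r.
rewrite mulnCA (mulnC n'); apply: leq_mul => //.
by rewrite leq_pexp2l //; lia.
Qed.

Lemma tau_bound s : exists C, forall n, (0 < n)%N -> (tau n ^ s <= C * n)%N.
Proof.
case: s => [|s]; first by exists 1%N => n n0; rewrite expn0 mul1n.
exists ((s.+1 ^ s.+1) ^ (2 ^ s.+1))%N => n n0.
by have := @tau_bound_rough s.+1 0 n isT n0 (fun _ _ _ => isT); rewrite subn0.
Qed.

End Divisors.

Section SlowExamples.
Variable R : realType.

Definition tau_max n : nat := \max_(m < n.+1) tau m.

Lemma tau_le_max m n : (m <= n)%N -> (tau m <= tau_max n)%N.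
Proof.
by move=> mn; rewrite /tau_max -[m]/(nat_of_ord (Ordinal (mn : (m < n.+1)%N))); apply: leq_bigmax.
Qed.

Lemma slow_tau : slow (fun n => (tau_max n)%:R : R).
Proof.
split=> [N|s]; first exact: ler0n.
have [C hC] := tau_bound s; exists C.+1%:R; first exact: ler0n.
move=> N N0; rewrite -natrX -natrM ler_nat /tau_max.
have hc : (0 < #|'I_N.+1|)%N by rewrite card_ord.
have [i hi] := @bigop.eq_bigmax _ (fun m : 'I_N.+1 => tau m) hc; rewrite hi.
have [i0|i0] := posnP i.
  by rewrite i0 /tau /= ; case: s {hC} => [|s]; rewrite ?exp1n ?muln_gt0 ?N0 //.
apply: leq_trans (hC _ i0) _; apply: leq_mul; first exact: leqnSn.
by rewrite -ltnS.
Qed.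

Definition harm n : R := \sum_(1 <= k < n.+1) k%:R^-1.

Lemma harm_ge0 n : 0 <= harm n.
Proof. by apply: sumr_ge0 => k _; rewrite invr_ge0 ler0n. Qed.

Lemma le_harm m n : (m <= n)%N -> harm m <= harm n.
Proof.
move=> mn; rewrite /harm (@big_cat_nat _ _ _ m.+1 1 n.+1) //= lerDl.
by apply: sumr_ge0 => k _; rewrite invr_ge0 ler0n.
Qed.

Lemma harm_le m n : (n < 2 ^ m)%N -> harm n <= m%:R.
Proof.
elim: m n => [|m IH] n hn.
  have -> : n = 0%N by lia.
  by rewrite /harm big_geq.
have [h|h] := ltnP n (2 ^ m); first by apply: le_trans (IH n h) _; rewrite ler_nat.
have m0 : (0 < 2 ^ m)%N by rewrite expn_gt0.
rewrite /harm (@big_cat_nat _ _ _ (2 ^ m)) //=; last by lia.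
rewrite -natr1; apply: lerD.
  by have := IH (2 ^ m).-1; rewrite /harm prednK //; apply.
apply: le_trans (_ : \sum_(2 ^ m <= k < n.+1) (2 ^ m)%:R^-1 <= _).
  rewrite big_nat_cond [leRHS]big_nat_cond; apply: ler_sum => k /andP[/andP[k1 _] _].
  by rewrite lef_pV2 ?ler_nat // posrE ltr0n //; lia.
rewrite sumr_const_nat -[leLHS]mulr_natr mulrC ler_pdivrMr ?ltr0n // mul1r ler_nat.
by rewrite expnS in hn; lia.
Qed.

Lemma slow_harm : slow harm.
Proof.
split=> [N|s]; first exact: harm_ge0.
exists (s.+1 ^ s.+1)%:R; first exact: ler0n.
move=> N N0; have := trunc_log_bounds (isT : (1 < 2)%N) N0.
set m := trunc_log 2 N => /andP[h1 h2].
have hm := harm_le h2.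
apply: le_trans (_ : m.+1%:R ^+ s.+1 <= _).
  apply: le_trans (_ : m.+1%:R ^+ s <= _).
    by apply: lerXn2r; rewrite ?nnegrE ?harm_ge0 ?ler0n.
  by apply: ler_weXn2l; rewrite ?ler1n.
rewrite -natrX -natrM ler_nat; apply: leq_trans (succ_exp_le m (isT : (0 < s.+1)%N)) _.
by rewrite leq_mul2l h1 orbT.
Qed.

End SlowExamples.

(** * Points in short arcs *)

Section Arcs.
Variable R : realType.
Implicit Types (t b c x : R) (N q m : nat).

(** A point in the [k]-th of [N] cells of the circle has inverse distance to the
    integers about [N * cell_weight N k]. *)
Definition cell_weight N k : R :=
  (maxn 1 k)%:R^-1 + (maxn 1 (N.-1 - k))%:R^-1.

Definition cell_total N : R := 2 * (1 + harm R N).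

Lemma cell_weight_ge0 N k : 0 <= cell_weight N k.
Proof. by rewrite addr_ge0 // invr_ge0 ler0n. Qed.

Lemma cell_total_ge0 N : 0 <= cell_total N.
Proof. by rewrite mulr_ge0 // addr_ge0 // harm_ge0. Qed.

Lemma sum_cell_weight N : \sum_(k < N) cell_weight N k <= cell_total N.
Proof.
case: N => [|N]; first by rewrite big_ord0 cell_total_ge0.
have h : \sum_(k < N.+1) (maxn 1 k)%:R^-1 <= 1 + harm R N.+1.
  rewrite big_ord_recl /= invr1 lerD2l.
  apply: le_trans (_ : harm R N <= _); last exact: le_harm.
  rewrite /harm big_add1 big_mkord; apply: ler_sum => i _.
  by rewrite /bump /= add1n (maxn_idPr _).
rewrite big_split /= /cell_total mulr_natl mulr2n; apply: lerD => //.
rewrite (reindex_inj rev_ord_inj) /=.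
by under eq_bigr => k _ do rewrite subSS subKn -1?ltnS //.
Qed.

Lemma truncn_frP N x : (0 < N)%N ->
  exists2 k : 'I_N, (k : nat)%:R <= N%:R * fr x & N%:R * fr x < (k : nat)%:R + 1.
Proof.
move=> N0; have Np : 0 < N%:R :> R by rewrite ltr0n.
have f0 : 0 <= N%:R * fr x by rewrite mulr_ge0 ?fr_ge0 // ltW.
have f1 : N%:R * fr x < N%:R by rewrite gtr_pMr // fr_lt1.
have /andP[h1 h2] := truncn_itv f0.
have kN : (Num.truncn (N%:R * fr x) < N)%N by rewrite -(ltr_nat R); exact: le_lt_trans f1.
by exists (Ordinal kN); rewrite //= natr1.
Qed.

Lemma geo_cell N t : (0 < N)%N ->
  geo N%:R t <= \sum_(k < N) N%:R * cell_weight N k * (fr (t - k%:R / N%:R) < N%:R^-1)%R%:R.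
Proof.
move=> N0; have Np : 0 < N%:R :> R by rewrite ltr0n.
have [k k1 k2] := truncn_frP t N0.
have kf : k%:R / N%:R <= fr t by rewrite ler_pdivrMr // mulrC.
have fk : fr t < k%:R / N%:R + N%:R^-1.
  by rewrite -[X in _ + X]mul1r -mulrDl ltr_pdivlMr // mulrC.
have hit : fr (t - k%:R / N%:R) < N%:R^-1.
  rewrite (@fr_uniq _ _ (fr t - k%:R / N%:R) (Num.floor t)); first by lra.
    by rewrite {1}(fr_eqz t); ring.
  apply/andP; split; first by lra.
  apply: lt_le_trans (_ : N%:R^-1 <= _); first by lra.
  by rewrite invf_le1 // ler1n.
rewrite (bigD1 k) //= hit mulr1.
apply: le_trans (_ : N%:R * cell_weight N k <= _); last first.
  rewrite lerDl; apply: sumr_ge0 => i _.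
  by rewrite !mulr_ge0 ?ler0n // cell_weight_ge0.
have inv0 m : 0 <= m%:R^-1 :> R by rewrite invr_ge0 ler0n.
have c1 : (k <= 1)%N -> N%:R <= N%:R * cell_weight N k.
  move=> h; rewrite /cell_weight (maxn_idPl h).
  by rewrite invr1 ler_peMr ?lerDl // ltW.
have c2 : (N.-1 - k <= 1)%N -> N%:R <= N%:R * cell_weight N k.
  move=> h; rewrite /cell_weight (maxn_idPl h).
  by rewrite invr1 ler_peMr ?lerDr // ltW.
have [k0|k0] := leqP k 1; first by apply: le_trans (geo_le _ _) (c1 k0).
have [k3|k3] := leqP (N.-1 - k) 1; first by apply: le_trans (geo_le _ _) (c2 k3).
have kp : 0 < k%:R :> R by rewrite ltr0n (ltn_trans _ k0).
have Nkp : 0 < (N.-1 - k)%:R :> R by rewrite ltr0n (ltn_trans _ k3).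
have f0 : 0 < fr t by apply: lt_le_trans kf; rewrite divr_gt0.
have NkE : (N.-1 - k)%:R = N%:R - 1 - k%:R :> R.
  rewrite natrB; last by rewrite -ltnS prednK.
  by rewrite -[X in _ = X%:R - _ - _](prednK N0) -natr1 addrK.
have f1 : 0 < 1 - fr t by rewrite subr_gt0 fr_lt1.
have g1 : (fr t)^-1 <= N%:R * k%:R^-1.
  by rewrite -[(fr t)^-1]mul1r ler_pdivrMr // mulrAC ler_pdivlMr // mul1r.
have g2 : (1 - fr t)^-1 <= N%:R * (N.-1 - k)%:R^-1.
  rewrite -[(1 - fr t)^-1]mul1r ler_pdivrMr // mulrAC ler_pdivlMr // mul1r NkE mulrBr mulr1.
  by lra.
have d0 : 0 < dist t by rewrite lt_min f0 f1.
rewrite /geo gt_eqF //.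
apply: le_trans (_ : (dist t)^-1 <= _); first by rewrite ge_min lexx orbT.
rewrite /cell_weight (maxn_idPr (ltnW k0)) (maxn_idPr (ltnW k3)).
rewrite mulrDr /dist minEle; case: ifP => _.
  by apply: le_trans g1 _; rewrite lerDl mulr_ge0 // ltW.
by apply: le_trans g2 _; rewrite lerDr mulr_ge0 // ltW.
Qed.

(** The weights [w] make it possible to apply the lemma once for each
    coordinate of a family of points on a torus. *)
Lemma geo_sum_cells N (I : Type) (r : seq I) (P : pred I) (t w : I -> R) (D : R) :
  (0 < N)%N -> (forall i, 0 <= w i) ->
  (forall c, \sum_(i <- r | P i) w i * (fr (t i - c) < N%:R^-1)%R%:R <= D) ->
  \sum_(i <- r | P i) w i * geo N%:R (t i) <= D * (N%:R * cell_total N).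
Proof.
move=> N0 w0 hD.
apply: le_trans (_ : \sum_(i <- r | P i) w i * \sum_(k < N)
   N%:R * cell_weight N k * (fr (t i - k%:R / N%:R) < N%:R^-1)%R%:R <= _).
  by apply: ler_sum => i _; apply: ler_wpM2l => //; exact: geo_cell.
under eq_bigr do rewrite mulr_sumr.
rewrite exchange_big /= mulrC.
have D0 : 0 <= D by apply: le_trans (hD 0); apply: sumr_ge0 => i _; rewrite mulr_ge0 ?ler0n.
apply: le_trans (_ : \sum_(k < N) N%:R * cell_weight N k * D <= _).
  apply: ler_sum => k _.
  have wk : 0 <= N%:R * cell_weight N k by rewrite mulr_ge0 ?ler0n ?cell_weight_ge0.
  apply: le_trans (ler_wpM2l wk (hD (k%:R / N%:R))); rewrite mulr_sumr.
  by apply: ler_sum => i _; rewrite mulrCA.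
rewrite -mulr_suml; apply: ler_wpM2r => //; rewrite -mulr_sumr.
by apply: ler_wpM2l; rewrite ?ler0n ?sum_cell_weight.
Qed.

Lemma fr_perturb x th dl et : `|th| <= et -> fr (x + th) < dl -> fr (x + et) < dl + 2 * et.
Proof.
move=> /[dup] h; rewrite ler_norml => /andP[h1 h2] hf.
have [d1|d1] := leP (dl + 2 * et) 1; last by apply: lt_trans d1; exact: fr_lt1.
have := fr_ge0 (x + th) => f0.
rewrite (@fr_uniq _ _ (fr (x + th) + (et - th)) (Num.floor (x + th))); first by lra.
  by have := fr_eqz (x + th); lra.
by apply/andP; split; lra.
Qed.

(** Pigeonhole: integer parts in [[0, B]] that separate the indices. *)
Lemma floor_inj_count q (u : 'I_q -> R) (P : pred 'I_q) (B : R) :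
  (forall i, P i -> 0 <= u i < B) ->
  (forall i j, P i -> P j -> Num.truncn (u i) = Num.truncn (u j) -> i = j) ->
  0 <= B -> #|P|%:R <= B + 1.
Proof.
move=> hu inj B0.
have lt (i : 'I_q) : (minn (Num.truncn (u i)) (Num.truncn B) < (Num.truncn B).+1)%N.
  by rewrite ltnS geq_minr.
have : (#|P| <= #|'I_(Num.truncn B).+1|)%N.
  rewrite -(card_in_imset (f := fun i => Ordinal (lt i)) (D := P)); first exact: max_card.
  move=> i j Pi Pj /(congr1 val) /=.
  have hi := hu i Pi; have hj := hu j Pj.
  have le k : 0 <= u k < B -> (Num.truncn (u k) <= Num.truncn B)%N.
    by move=> /andP[? ?]; apply: le_truncn; exact: ltW.
  rewrite !(minn_idPl _) ?le // => e; exact: inj.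
rewrite card_ord -(ler_nat R) => h; apply: le_trans h _.
by rewrite -natr1 lerD2r; have /andP[] := truncn_itv B0.
Qed.

(** Over [q] consecutive integers, [b m] differs by at most [1/q] from the points
    of a translate of the fractions of denominator [q], each taken once. *)
Lemma block_count q (a : int) b m0 c dl : (0 < q)%N -> coprimez a q ->
  `|b - a%:~R / q%:R| <= q%:R ^- 2 -> 0 <= dl ->
  #|[pred i : 'I_q | fr (b * (m0 + i)%:R - c) < dl]|%:R <= q%:R * dl + 3.
Proof.
move=> q0 cop hb dl0; have qp : 0 < q%:R :> R by rewrite ltr0n.
pose x (i : 'I_q) := a%:~R / q%:R * i%:R + (b * m0%:R - c) + q%:R^-1.
pose u i := q%:R * fr (x i).
have -> : q%:R * dl + 3 = (q%:R * dl + 2) + 1 by ring.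
have inv2 : q%:R * (2 * q%:R^-1) = 2 :> R by field; rewrite gt_eqF.
apply: (@floor_inj_count q u); last by rewrite addr_ge0 // mulr_ge0 // ltW.
- move=> i; rewrite inE => hi; apply/andP; split.
    by rewrite mulr_ge0 ?fr_ge0 // ltW.
  have : fr (x i) < dl + 2 * q%:R^-1.
    apply: (@fr_perturb _ ((b - a%:~R / q%:R) * i%:R)).
      rewrite normrM (ger0_norm (ler0n _ _)).
      apply: le_trans (_ : q%:R ^- 2 * q%:R <= _).
        by apply: ler_pM => //; rewrite ler_nat ltnW.
      by rewrite exprSr expr1 invfM mulfVK ?gt_eqF.
    by move: hi; rewrite natrD; congr (fr _ < _); ring.
  by rewrite -(ltr_pM2l qp) [q%:R * (dl + _)]mulrDr inv2.
move=> i j _ _ e.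
have ui : 0 <= u i by rewrite mulr_ge0 ?fr_ge0 // ltW.
have uj : 0 <= u j by rewrite mulr_ge0 ?fr_ge0 // ltW.
have hi := truncn_itv ui; have hj := truncn_itv uj; rewrite e in hi.
have close : `|u i - u j| < 1.
  move: hi hj => /andP[a1 a2] /andP[a3 a4]; rewrite -natr1 in a2 a4.
  by rewrite ltr_norml; apply/andP; split; lra.
have diff : u i - u j = (a * (i%:Z - j%:Z) - q%:Z * (Num.floor (x i) - Num.floor (x j)))%:~R.
  rewrite rmorphB !rmorphM !rmorphB /= /u /fr /x.
  rewrite -[(i%:Z)%:~R]/(i%:R) -[(j%:Z)%:~R]/(j%:R) -[(q%:Z)%:~R]/(q%:R).
  by field; rewrite gt_eqF.
have z0 : (a * (i%:Z - j%:Z) - q%:Z * (Num.floor (x i) - Num.floor (x j)))%R = 0.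
  move: close; rewrite diff -intr_norm -[1]/(1%:~R) ltr_int.
  by move: (_ - _)%R => [[|n]|n].
have : (q%:Z %| a * (i%:Z - j%:Z))%Z.
  by move/eqP: z0; rewrite subr_eq0 => /eqP ->; exact: dvdz_mulr.
rewrite Gauss_dvdzr; last by rewrite coprimez_sym.
rewrite -eqz_mod_dvd !modz_nat !modn_small // => /eqP [h].
exact: val_inj.
Qed.

Lemma sum_blocks (V : nmodType) (F : nat -> V) n q :
  \sum_(0 <= m < n * q) F m = \sum_(0 <= l < n) \sum_(i < q) F (l * q + i)%N.
Proof.
elim: n => [|n IH]; first by rewrite mul0n !big_geq.
rewrite big_nat_recr //= -IH mulSn (@big_cat_nat _ _ _ (n * q)) ?leq_addl //=.
congr (_ + _); rewrite -{1}[(n * q)%N]add0n big_addn addnK big_mkord.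
by apply: eq_bigr => i _; rewrite addnC.
Qed.

Lemma interval_count M q (a : int) b c dl : (0 < q)%N -> coprimez a q ->
  `|b - a%:~R / q%:R| <= q%:R ^- 2 -> 0 <= dl ->
  \sum_(0 <= m < M) (fr (b * m%:R - c) < dl)%R%:R <=
  (M%:R / q%:R + 1) * (q%:R * dl + 3) :> R.
Proof.
move=> q0 cop hb dl0; have qp : 0 < q%:R :> R by rewrite ltr0n.
pose n := (M %/ q).+1.
have Mn : (M <= n * q)%N by rewrite ltnW // ltn_ceil.
apply: le_trans (_ : \sum_(0 <= m < n * q) (fr (b * m%:R - c) < dl)%R%:R <= _).
  rewrite (@big_cat_nat _ _ _ M 0 (n * q)) //= lerDl.
  by apply: sumr_ge0 => i _; exact: ler0n.
rewrite sum_blocks.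
apply: le_trans (_ : \sum_(0 <= l < n) (q%:R * dl + 3) <= _).
  apply: ler_sum => l _; rewrite -natr_sum.
  apply: le_trans (block_count (l * q) c q0 cop hb dl0).
  rewrite ler_nat -sum1_card [leqRHS]big_mkcond; apply: leq_sum => i _.
  by rewrite inE; case: (fr _ < _).
rewrite sumr_const_nat subn0 -[leLHS]mulr_natl; apply: ler_wpM2r.
  by rewrite addr_ge0 // mulr_ge0 // ltW.
by rewrite /n -natr1 lerD2r ler_pdivlMr // -natrM ler_nat leq_trunc_div.
Qed.

(** Dirichlet's approximation theorem, by the pigeonhole principle. *)
Lemma dirichlet b Q : (0 < Q)%N ->
  exists q (a : int), [/\ (0 < q <= Q)%N, coprimez a q & `|q%:R * b - a%:~R| <= Q%:R^-1].
Proof.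
move=> Q0; have Qp : 0 < Q%:R :> R by rewrite ltr0n.
have [f hf] : exists f : 'I_Q.+1 -> 'I_Q, forall i,
    (f i)%:R <= Q%:R * fr (b * i%:R) < (f i)%:R + 1.
  have aux (i : 'I_Q.+1) : { k : 'I_Q | k%:R <= Q%:R * fr (b * i%:R) < k%:R + 1 }.
    by apply: sig_eqW; have [k h1 h2] := truncn_frP (b * i%:R) Q0; exists k; rewrite h1 h2.
  by exists (fun i => sval (aux i)) => i; case: (aux i).
have [i [j [ij fij]]] : exists i j : 'I_Q.+1, (i < j)%N /\ f i = f j.
  have : ~~ injectiveb f.
    by apply/injectiveP => inj; have := max_card (mem (codom f)); rewrite (card_codom inj) !card_ord ltnn.
  move=> /injectivePn [i [j ij fij]].
  by have [h|h|h] := ltngtP i j; [exists i, j|exists j, i|case/eqP: ij; exact: val_inj].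
pose q := (j - i)%N; pose a := (Num.floor (b * j%:R) - Num.floor (b * i%:R))%R.
have q0 : (0 < q)%N by rewrite subn_gt0.
have qQ : (q <= Q)%N by have := ltn_ord j; rewrite /q; lia.
have close : `|q%:R * b - a%:~R| <= Q%:R^-1.
  have -> : q%:R * b - a%:~R = fr (b * j%:R) - fr (b * i%:R).
    by rewrite /q natrB ?(ltnW ij) // /fr /a rmorphB /=; ring.
  rewrite -(ler_pM2l Qp) divff ?gt_eqF // -{1}(ger0_norm (ltW Qp)) -normrM mulrBr.
  have := hf i; have := hf j; rewrite fij => /andP[h1 h2] /andP[h3 h4].
  by rewrite ler_norml; apply/andP; split; lra.
pose g := gcdn `|a| q; have g0 : (0 < g)%N by rewrite gcdn_gt0 q0 orbT.
have gq : (g %| q)%N by exact: dvdn_gcdr.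
have ga : (g%:Z %| a)%Z by rewrite dvdzE dvdn_gcdl.
exists (q %/ g)%N, (a %/ g)%Z; split.
- by rewrite divn_gt0 // dvdn_leq //= (leq_trans (leq_div _ _)).
- have aE : (`|(a %/ g)%Z| * g = `|a|)%N by rewrite -{2}(divzK ga) abszM.
  by rewrite coprimezE /= /coprime -(eqn_pmul2r g0) mul1n muln_gcdl divnK // aE.
have gp : 0 < g%:R :> R by rewrite ltr0n.
have E : q%:R * b - a%:~R = g%:R * ((q %/ g)%:R * b - (a %/ g)%Z%:~R).
  have qE : q%:R = (q %/ g)%:R * g%:R :> R by rewrite -natrM divnK.
  have aE : a%:~R = (a %/ g)%Z%:~R * g%:R :> R.
    by rewrite -{1}(divzK ga) rmorphM.
  by rewrite qE aE; ring.
apply: le_trans close; rewrite E normrM (ger0_norm (ltW gp)).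
by rewrite ler_peMl // ler1n.
Qed.

End Arcs.

(** * Weyl differencing *)

Section Weyl.
Variable R : realType.
Implicit Types (P : {poly R}) (N n h r : nat).

Definition wsum P n : R[i] := \sum_(0 <= i < n) e P.[i%:R].

Definition diff h P : {poly R} := P \Po ('X + h%:R%:P) - P.

Lemma horner_diff h P x : (diff h P).[x] = P.[x + h%:R] - P.[x].
Proof. by rewrite /diff hornerD hornerN horner_comp !hornerE. Qed.

Lemma wsumS P n : wsum P n.+1 = wsum P n + e P.[n%:R].
Proof. by rewrite /wsum big_nat_recr. Qed.

(** Grouping the pairs of indices by their difference. *)
Lemma differencing_sum P n :
  \sum_(0 <= i < n) \sum_(0 <= j < i) e (P.[i%:R] - P.[j%:R]) =
  \sum_(1 <= h < n) wsum (diff h P) (n - h).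
Proof.
elim: n => [|n IH]; first by rewrite !big_geq.
rewrite big_nat_recr //= IH.
case: n {IH} => [|n]; first by rewrite !big_geq // addr0.
have -> : \sum_(1 <= h < n.+2) wsum (diff h P) (n.+2 - h) =
   \sum_(1 <= h < n.+2) (wsum (diff h P) (n.+1 - h) + e (diff h P).[(n.+1 - h)%:R]).
  rewrite !big_nat; apply: eq_bigr => h /andP[h1 h2].
  by rewrite subSn // wsumS.
rewrite big_split /= [X in _ = X + _]big_nat_recr //= subnn.
rewrite [X in _ = _ + X + _](_ : _ = 0) ?addr0; last by rewrite /wsum big_geq.
congr (_ + _); rewrite [RHS]big_nat_rev /= big_add1 /=.
rewrite !big_nat; apply: eq_bigr => j /andP[_ jn].
rewrite horner_diff -natrD.
have -> : (n.+1 - (1 + n.+2 - j.+2) = j)%N by lia.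
by have -> : (j + (1 + n.+2 - j.+2) = n.+1)%N by lia.
Qed.

Lemma sqr_wsum P n :
  mag (wsum P n) ^+ 2 =
  n%:R + 2 * complex.Re (\sum_(0 <= i < n) \sum_(0 <= j < i) e (P.[i%:R] - P.[j%:R])).
Proof.
elim: n => [|n IH].
  by rewrite /wsum !big_geq // mag0 expr0n /= mulr0 addr0.
rewrite [in RHS]big_nat_recr //= wsumS.
have -> : \sum_(0 <= j < n) e (P.[n%:R] - P.[j%:R]) = e P.[n%:R] * (wsum P n)^*.
  rewrite /wsum rmorph_sum mulr_sumr; apply: eq_bigr => j _ /=; exact: eB.
rewrite -natr1; set S := wsum P n in IH *; set T := \sum_(0 <= i < n) _ in IH *.
have /eqP : mag (e P.[n%:R]) ^+ 2 = 1 by rewrite mag_e expr1n.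
move: IH; rewrite /mag !sqr_sqrtr ?addr_ge0 ?sqr_ge0 //.
case: S => a b; case: T => c d; case: (e _) => u v /= IH /eqP h; lra.
Qed.

Lemma van_der_corput P n :
  mag (wsum P n) ^+ 2 <= n%:R + 2 * \sum_(1 <= h < n) mag (wsum (diff h P) (n - h)).
Proof.
rewrite sqr_wsum differencing_sum lerD2l ler_pM2l //.
by apply: le_trans (mag_Re _) _; exact: mag_sum.
Qed.

Fixpoint boxes N r : seq (seq nat) :=
  if r is r'.+1 then [seq h :: t | h <- iota 1 N.-1, t <- boxes N r'] else [:: [::]].

Fixpoint diffs (hs : seq nat) P : {poly R} :=
  if hs is h :: t then diffs t (diff h P) else P.

Fixpoint residual_length (n : nat) (hs : seq nat) : nat :=
  if hs is h :: t then residual_length (n - h) t else n.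

Lemma residual_length_le n hs : (residual_length n hs <= n)%N.
Proof. by elim: hs n => //= h t IH n; apply: leq_trans (IH _) (leq_subr _ _). Qed.

Lemma sum_boxes N r (F : seq nat -> R) :
  \sum_(h <- boxes N r.+1) F h = \sum_(1 <= h < N) \sum_(t <- boxes N r) F (h :: t).
Proof.
rewrite /= big_allpairs_dep /= /index_iota.
by case: N => [|N]; rewrite ?subn1.
Qed.

(** [r] applications of [van_der_corput], with the power mean inequality to
    raise the average over each new difference to the next power of 2. *)
Lemma weyl_differencing r : exists2 c : R, 0 <= c & forall P n N, (0 < N)%N -> (n <= N)%N ->
  (mag (wsum P n) / N%:R) ^+ (2 ^ r) <=
  c * (N%:R^-1 + N%:R ^- r * \sum_(h <- boxes N r) mag (wsum (diffs h P) (residual_length n h)) / N%:R).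
Proof.
elim: r => [|r [c c0 IH]].
  exists 1 => // P n N N0 nN; rewrite expn0 !expr1 expr0 invr1 !mul1r big_seq1 /=.
  by rewrite lerDr invr_ge0 ler0n.
exists (2 * 4 ^+ (2 ^ r) * (1 + c)).
  by rewrite !mulr_ge0 ?exprn_ge0 // addr_ge0.
move=> P n N N0 nN; have Np : 0 < N%:R :> R by rewrite ltr0n.
set v := fun h => mag (wsum (diff h P) (n - h)) / N%:R.
have v0 h : 0 <= v h by rewrite /v divr_ge0 ?mag_ge0 // ltW.
have two_gt0 : (0 < 2 ^ r)%N by rewrite expn_gt0.
pose m := (2 ^ r).-1; have mE : (2 ^ r = m.+1)%N by rewrite /m prednK.
have iN0 : 0 <= N%:R^-1 :> R by rewrite invr_ge0 ltW.
have iN1 : N%:R^-1 <= 1 :> R by rewrite invf_le1 // ler1n.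
have s1 : (mag (wsum P n) / N%:R) ^+ 2 <= N%:R^-1 + 2 * N%:R^-1 * \sum_(1 <= h < N) v h.
  rewrite expr_div_n ler_pdivrMr ?exprn_gt0 //.
  apply: le_trans (van_der_corput P n) _.
  have -> : (N%:R^-1 + 2 * N%:R^-1 * \sum_(1 <= h < N) v h) * N%:R ^+ 2 =
     N%:R + 2 * (\sum_(1 <= h < N) v h * N%:R).
    by rewrite -mulr_suml; field; rewrite gt_eqF.
  apply: lerD; first by rewrite ler_nat.
  rewrite ler_pM2l //; apply: le_trans (_ : \sum_(1 <= h < n) v h * N%:R <= _).
    by apply: ler_sum => h _; rewrite /v divfK // gt_eqF.
  have [n1|n1] := leqP n 1.
    by rewrite [leLHS]big_geq //; apply: sumr_ge0 => h _; rewrite mulr_ge0 // ltW.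
  rewrite [leRHS](@big_cat_nat _ _ _ n) ?(ltnW n1) //= lerDl.
  by apply: sumr_ge0 => h _; rewrite mulr_ge0 // ltW.
have vs0 : 0 <= \sum_(1 <= h < N) v h by exact: sumr_ge0.
have s2 : (\sum_(1 <= h < N) v h) ^+ m.+1 <= N%:R ^+ m * \sum_(1 <= h < N) v h ^+ m.+1.
  apply: le_trans (power_mean _ _ _) _ => //.
  apply: ler_wpM2r; first by apply: sumr_ge0 => h _; exact: exprn_ge0.
  apply: lerXn2r; rewrite ?nnegrE ?ler0n // ler_nat count_predT size_iota.
  by rewrite subn1 leq_pred.
have s3 : (N%:R^-1 + 2 * N%:R^-1 * \sum_(1 <= h < N) v h) ^+ m.+1 <=
   4 ^+ m.+1 * (N%:R^-1 + N%:R^-1 * \sum_(1 <= h < N) v h ^+ m.+1).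
  have := @power_mean R bool [:: true; false] xpredT
    (fun b => if b then N%:R^-1 else 2 * N%:R^-1 * \sum_(1 <= h < N) v h) m.
  rewrite !big_cons !big_nil /= !addr0 => pm.
  apply: le_trans (pm _) _; first by case=> // _; rewrite !mulr_ge0.
  have -> : 4 ^+ m.+1 = 2 ^+ m * (2 * 2 ^+ m.+1) :> R.
    have -> : 4 = 2 * 2 :> R by ring.
    by rewrite exprMn {1}exprSr mulrA.
  rewrite -[leRHS]mulrA; apply: ler_wpM2l; first exact: exprn_ge0.
  have w0 : 0 <= \sum_(1 <= h < N) v h ^+ m.+1 by apply: sumr_ge0 => h _; exact: exprn_ge0.
  rewrite mulrDr; apply: lerD.
    apply: le_trans (_ : N%:R^-1 <= _).
      by rewrite exprS ler_piMr // exprn_ile1.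
    by rewrite ler_peMl // mulr_ege1 ?exprn_ege1 // ler1n.
  rewrite !exprMn -mulrA; apply: le_trans (_ : 2 ^+ m.+1 * (N%:R^-1 * \sum_(1 <= h < N) v h ^+ m.+1) <= _).
    apply: ler_wpM2l; first exact: exprn_ge0.
    apply: le_trans (ler_wpM2l _ s2) _; first exact: exprn_ge0.
    rewrite mulrA; apply: ler_wpM2r => //.
    by rewrite exprSr mulrAC -exprMn mulVf ?gt_eqF // expr1n mul1r.
  apply: ler_wpM2r; first by rewrite mulr_ge0.
  by rewrite ler_peMl ?exprn_ge0 // ler1n.
rewrite expnS exprM mE; apply: le_trans (_ : (N%:R^-1 + 2 * N%:R^-1 * \sum_(1 <= h < N) v h) ^+ m.+1 <= _).
  by apply: lerXn2r; rewrite ?nnegrE ?exprn_ge0 ?divr_ge0 ?mag_ge0 ?ler0n // addr_ge0 ?mulr_ge0.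
apply: le_trans s3 _; rewrite (mulrC 2) -!mulrA; apply: ler_wpM2l; first exact: exprn_ge0.
rewrite sum_boxes; set W := fun h => \sum_(t <- boxes N r) mag (wsum (diffs (h :: t) P) (residual_length n (h :: t))) / N%:R.
have W0 h : 0 <= W h by apply: sumr_ge0 => t _; rewrite divr_ge0 ?mag_ge0 ?ler0n.
have s4 : \sum_(1 <= h < N) v h ^+ m.+1 <= c + c * N%:R ^- r * \sum_(1 <= h < N) W h.
  apply: le_trans (_ : \sum_(1 <= h < N) c * (N%:R^-1 + N%:R ^- r * W h) <= _).
    apply: ler_sum => h _; rewrite -mE; apply: IH => //.
    by apply: leq_trans (leq_subr _ _) nN.
  rewrite -mulr_sumr big_split /= -mulr_sumr mulrDr mulrA; apply: lerD => //.
  rewrite ler_piMr // sumr_const_nat -[leLHS]mulr_natr mulrC ler_pdivrMr // mul1r ler_nat.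
  by rewrite subn1 leq_pred.
have W1 : 0 <= \sum_(1 <= h < N) W h by exact: sumr_ge0.
have r0 : 0 <= N%:R ^- r :> R by rewrite invr_ge0 exprn_ge0 // ltW.
apply: le_trans (_ : N%:R^-1 + N%:R^-1 * (c + c * N%:R ^- r * \sum_(1 <= h < N) W h) <= _).
  by rewrite lerD2l; apply: ler_wpM2l.
have -> : N%:R ^- r.+1 = N%:R^-1 * N%:R ^- r :> R by rewrite exprS invfM.
rewrite -/W; set a := N%:R^-1 in iN0 iN1 *; set b := N%:R ^- r in r0 *; set w := \sum_(1 <= h < N) W h in W1 *.
have h1 := mulr_ge0 iN0 c0; have h2 := mulr_ge0 iN0 (mulr_ge0 r0 W1).
have h3 := mulr_ge0 c0 h2.
lra.
Qed.

(** Differencing lowers the degree like a derivation. *)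
Lemma diff_lead h P m : (size P <= m.+2)%N ->
  (size (diff h P) <= m.+1)%N /\ (diff h P)`_m = m.+1%:R * h%:R * P`_m.+1.
Proof.
move=> sP.
have cE j : (P \Po ('X + h%:R%:P))`_j =
    \sum_(i < m.+2) P`_i * (h%:R ^+ (i - j) *+ 'C(i, j)).
  rewrite comp_polyE (big_ord_widen m.+2 (fun i => P`_i *: ('X + h%:R%:P) ^+ i) sP) /=.
  rewrite big_mkcond /= coef_sum; apply: eq_bigr => i _.
  case: ltnP => iP; last by rewrite coef0 nth_default // mul0r.
  rewrite coefZ; congr (_ * _).
  rewrite addrC exprDn_comm; last exact: commr_polyX.
  rewrite coef_sum; have [ji|ij] := leqP j i.
    rewrite (bigD1 (Ordinal (ji : (j < i.+1)%N))) //= coefMn -rmorphXn coefCM coefXn eqxx mulr1.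
    rewrite big1 ?addr0 // => l lj; rewrite coefMn -rmorphXn coefCM coefXn.
    by rewrite (_ : (j == l) = false) ?mulr0 ?mul0rn //; apply/negbTE; rewrite eq_sym; apply: contra lj => /eqP lj; apply/eqP/val_inj.
  rewrite bin_small // mulr0n big1 // => l _; rewrite coefMn -rmorphXn coefCM coefXn.
  by rewrite (_ : (j == l) = false) ?mulr0 ?mul0rn //; apply/negbTE; have := ltn_ord l; lia.
split.
  apply/leq_sizeP => j mj; rewrite /diff coefD coefN cE.
  have [mj'|mj'] := leqP j m.+1.
    have -> : j = m.+1 by lia.
    rewrite big_ord_recr /= big1 ?add0r; last first.
      by move=> i _; rewrite bin_small // mulr0n mulr0.
    by rewrite subnn expr0 binn mulr1n mulr1 subrr.
  rewrite big1 ?add0r; last first.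
    by move=> i _; rewrite bin_small ?mulr0n ?mulr0 // (leq_trans (ltn_ord i)).
  by rewrite nth_default ?oppr0 // (leq_trans sP).
rewrite /diff coefD coefN cE !big_ord_recr /= big1 ?add0r; last first.
  by move=> i _; rewrite bin_small // mulr0n mulr0.
rewrite subnn expr0 binn mulr1n mulr1 subSn // subnn expr1 binSn -mulr_natr.
ring.
Qed.

Lemma diffs_lead hs P d : (size P <= size hs + d.+1)%N ->
  (size (diffs hs P) <= d.+1)%N /\
  (diffs hs P)`_d * d`!%:R = (size hs + d)`!%:R * (\prod_(h <- hs) h)%:R * P`_(size hs + d).
Proof.
elim: hs P => [|h t IH] P /=.
  by rewrite !add0n big_nil mulr1 => sP; split=> //; rewrite mulrC.
move=> sP; rewrite addSn addnS in sP.
have [sQ cQ] := diff_lead h sP; rewrite -addnS in sQ; have [s1 s2] := IH _ sQ; split=> //.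
rewrite s2 cQ big_cons natrM addSn factS natrM; ring.
Qed.

End Weyl.

(** * Weyl's inequality for cubic polynomials *)

Section Boxes.

Definition bprod (h : seq nat) : nat := \prod_(x <- h) x.

Lemma boxes_size N r h : h \in boxes N r -> size h = r.
Proof.
elim: r h => [|r IH] h /=; first by rewrite inE => /eqP ->.
by case/allpairsP=> -[x t] [_ /= /IH ht ->]; rewrite /= ht.
Qed.

Lemma boxes_prod N r h : h \in boxes N r -> (0 < bprod h <= N ^ r)%N.
Proof.
elim: r h => [|r IH] h; first by rewrite /= inE => /eqP ->; rewrite /bprod big_nil.
case/allpairsP=> -[x t] [/= hx /IH /andP[t0 t1] ->]; rewrite /bprod big_cons -/(bprod t).
rewrite mem_iota in hx; rewrite muln_gt0 t0 expnS leq_mul // ?andbT //; lia.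
Qed.

Lemma size_boxes N r : (size (boxes N r) <= N ^ r)%N.
Proof.
elim: r => [|r IH] //=; rewrite size_allpairs size_iota expnS.
by apply: leq_mul => //; exact: leq_pred.
Qed.

(** Each coordinate of a box of product [m] divides [m]. *)
Lemma count_boxes N r B T m : (0 < m <= B)%N ->
  (forall m', (0 < m' <= B)%N -> (tau m' <= T)%N) ->
  (count (fun h => bprod h == m) (boxes N r) <= T ^ r)%N.
Proof.
move=> mB hT; elim: r m mB => [|r IH] m mB.
  by rewrite /= addn0; case: (_ == _).
rewrite -sum1_count big_mkcond /= big_allpairs_dep /=.
apply: leq_trans (_ : \sum_(h <- iota 1 N.-1) (h %| m) * T ^ r <= _)%N.
  rewrite !big_seq; apply: leq_sum => h; rewrite mem_iota => /andP[h0 _].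
  have [hm|hm] := boolP (h %| m)%N.
    have m'B : (0 < m %/ h <= B)%N.
      case/andP: mB => m0 mB; rewrite divn_gt0 // dvdn_leq //=.
      by apply: leq_trans (leq_div _ _) mB.
    rewrite mul1n; apply: leq_trans (IH _ m'B).
    rewrite -sum1_count [leqRHS]big_mkcond; apply: leq_sum => t _.
    rewrite /bprod big_cons -/(bprod t); case: eqP => // e.
    by rewrite -e mulKn // eqxx.
  rewrite mul0n leqn0; apply/eqP; apply: big1 => t _.
  rewrite /bprod big_cons -/(bprod t); case: eqP => // e.
  by move: hm; rewrite -e dvdn_mulr.
rewrite -big_distrl /= expnS leq_mul2r; apply/orP; right.
apply: leq_trans (hT m mB); rewrite /tau.
apply: leq_trans (_ : size [seq h <- iota 1 N.-1 | h %| m]%N <= _)%N.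
  by rewrite size_filter -sum1_count [leqRHS]big_mkcond; apply: leq_sum => h _; case: (_ %| _)%N.
apply: uniq_leq_size; first by rewrite filter_uniq ?iota_uniq.
move=> h; rewrite mem_filter => /andP[hm _]; rewrite -dvdn_divisors //.
by case/andP: mB.
Qed.

Lemma sum_boxes_prod (R : realFieldType) N r B T (F : nat -> R) :
  (N ^ r <= B)%N -> (forall m, (0 < m <= B)%N -> (tau m <= T)%N) ->
  (forall m, 0 <= F m) ->
  \sum_(h <- boxes N r) F (bprod h) <= T%:R ^+ r * \sum_(1 <= m < B.+1) F m.
Proof.
move=> NB hT F0.
apply: le_trans (_ : \sum_(h <- boxes N r) \sum_(1 <= m < B.+1) (bprod h == m)%:R * F m <= _).
  rewrite !big_seq; apply: ler_sum => h /boxes_prod /andP[h0 h1].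
  rewrite (bigD1_seq (bprod h)) ?iota_uniq //=; last first.
    by rewrite mem_index_iota h0 ltnS (leq_trans h1 NB).
  rewrite eqxx mul1r lerDl; apply: sumr_ge0 => m _; by rewrite mulr_ge0.
rewrite exchange_big mulr_sumr big_nat [leRHS]big_nat; apply: ler_sum => m /andP[m0 m1].
rewrite -mulr_suml; apply: ler_wpM2r => //.
rewrite -natr_sum -natrX ler_nat.
apply: leq_trans (@count_boxes N r B T m _ hT); last by rewrite m0.
by rewrite -sum1_count [leqRHS]big_mkcond; apply: leq_sum => t _; case: (_ == _).
Qed.

End Boxes.

Section MajorArcs.
Variable R : realType.
Implicit Types (P : {poly R}) (N n q : nat) (a : int) (b t : R).

Lemma linear_wsum P n N : (size P <= 2)%N -> (n <= N)%N -> mag (wsum P n) <= geo N%:R P`_1.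
Proof.
move=> sP nN; have -> : wsum P n = \sum_(0 <= i < n) e (P`_1 *+ i + P`_0).
  apply: eq_bigr => i _; rewrite (horner_coef_wide _ sP) !big_ord_recl big_ord0 /=.
  by congr e; rewrite /bump /= expr0 expr1 -mulr_natr; ring.
apply: le_trans (geo_sum _ _ _ _) _; rewrite subn0; apply: geo_mono.
by rewrite ler_nat.
Qed.

(** Two more differencings make the phase linear. *)
Lemma cubic_weyl : exists2 c : R, 0 <= c & forall P n N, (0 < N)%N -> (n <= N)%N ->
  (size P <= 4)%N ->
  (mag (wsum P n) / N%:R) ^+ 4 <=
  c * (N%:R^-1 + N%:R ^- 3 * \sum_(h <- boxes N 2) geo N%:R (6 * P`_3 * (bprod h)%:R)).
Proof.
have [c c0 hc] := weyl_differencing R 2; exists c => // P n N N0 nN sP.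
have Np : 0 < N%:R :> R by rewrite ltr0n.
apply: le_trans (hc P n N N0 nN) _; apply: ler_wpM2l => //; rewrite lerD2l.
have -> : N%:R ^- 3 = N%:R ^- 2 * N%:R^-1 :> R by rewrite exprSr invfM mulrC.
rewrite -[leRHS]mulrA; apply: ler_wpM2l; first by rewrite invr_ge0 exprn_ge0 // ltW.
rewrite mulr_sumr !big_seq; apply: ler_sum => h hb; rewrite mulrC.
apply: ler_wpM2l; first by rewrite invr_ge0 ltW.
have sh := boxes_size hb.
have := @diffs_lead R h P 1; rewrite sh => /(_ sP) [sQ cQ].
have -> : 6 * P`_3 * (bprod h)%:R = (diffs h P)`_1.
  by move: cQ; rewrite (_ : (2 + 1)`! = 6)%N // (_ : 1`! = 1)%N // mulr1 => ->; rewrite /bprod; ring.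
by apply: linear_wsum => //; exact: leq_trans (residual_length_le _ _) nN.
Qed.

Lemma dist_norm t : `|t| <= 1 / 2 -> dist t = `|t|.
Proof.
move=> h; have [t0|t0] := leP 0 t.
  rewrite ger0_norm // in h *; rewrite /dist fr_id; last by lra.
  by apply/min_idPl; lra.
rewrite ltr0_norm // in h *.
have f : fr t = t + 1 by apply: (@fr_uniq _ _ _ (-1)); lra.
by rewrite /dist f; rewrite (_ : 1 - (t + 1) = - t); [apply/min_idPr; lra|ring].
Qed.

Lemma distDz t (n : int) : dist (t + n%:~R) = dist t.
Proof. by rewrite /dist frDz. Qed.

Lemma distN t : dist (- t) = dist t.
Proof.
have [f0|f0] := eqVneq (fr t) 0.
  have -> : - t = 0 + (- Num.floor t)%:~R by rewrite rmorphN /= {1}(fr_eqz t) f0; ring.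
  rewrite distDz [in RHS](fr_eqz t) f0 distDz //.
have f1 := fr_lt1 t; have f2 : 0 < fr t by rewrite lt_def f0 fr_ge0.
have E : fr (- t) = 1 - fr t.
  apply: (@fr_uniq _ _ _ (- Num.floor t - 1)); last by lra.
  by rewrite rmorphB rmorphN /= {1}(fr_eqz t); ring.
by rewrite /dist E minC; congr (Num.min _ _); ring.
Qed.

Lemma dist_le_norm t (n : int) : dist t <= `|t - n%:~R|.
Proof.
have -> : dist t = dist (t - n%:~R) by rewrite -[in RHS](rmorphN _ n) distDz.
move: (t - _) => {}t; have [h|h] := leP `|t| (1 / 2); first by rewrite dist_norm.
apply: le_trans (ltW h); rewrite /dist ge_min.
by apply/orP; have [k|k] := leP (fr t) (1 / 2); [left|right]; lra.
Qed.

Lemma dist_near t : exists n : int, `|t - n%:~R| = dist t.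
Proof.
rewrite /dist minEle; case: ifP => h.
  exists (Num.floor t); rewrite ger0_norm ?fr_ge0 //.
exists (Num.floor t + 1); rewrite intrD opprD addrA -/(fr t) distrC ger0_norm //.
by rewrite subr_ge0 ltW // fr_lt1.
Qed.

Lemma dist_tri t u : dist t <= dist u + `|t - u|.
Proof.
have [n <-] := dist_near u; apply: le_trans (dist_le_norm t n) _.
by apply: le_trans (ler_normD _ _); rewrite le_eqVlt; apply/orP; left; apply/eqP; congr `|_|; ring.
Qed.

Lemma dist_rat q a (m : nat) : (0 < q)%N -> coprimez a q -> ~~ (q %| m)%N ->
  q%:R^-1 <= dist (a%:~R / q%:R * m%:R : R).
Proof.
move=> q0 cop qm; have qp : 0 < q%:R :> R by rewrite ltr0n.
have [n <-] := dist_near (a%:~R / q%:R * m%:R).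
have -> : a%:~R / q%:R * m%:R - n%:~R = (a * m%:Z - n * q%:Z)%:~R / q%:R :> R.
  rewrite rmorphB !rmorphM /= -[(m%:Z)%:~R]/(m%:R) -[(q%:Z)%:~R]/(q%:R).
  by field; rewrite gt_eqF.
have iq : 0 <= q%:R^-1 :> R by rewrite invr_ge0 ltW.
rewrite normrM (ger0_norm iq) -[leLHS]mul1r; apply: ler_wpM2r => //.
rewrite -intr_norm -[1]/(1%:~R) ler_int.
suff : (a * m%:Z - n * q%:Z)%R != 0 by move: (_ - _)%R => [[|k]|k].
apply: contra qm; rewrite subr_eq0 => /eqP e.
have : (q%:Z %| a * m%:Z)%Z by rewrite e dvdz_mull.
by rewrite Gauss_dvdzr // coprimez_sym.
Qed.

Lemma geo_le_inv N t : 0 < dist t -> geo N%:R t <= (dist t)^-1.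
Proof. by move=> d; rewrite /geo gt_eqF // ge_min lexx orbT. Qed.

Lemma geo_compare N (M : R) t : 0 < M -> M^-1 <= dist t -> geo N%:R t <= geo M t.
Proof.
move=> M0 h; have d : 0 < dist t by apply: lt_le_trans h; rewrite invr_gt0.
apply: le_trans (geo_le_inv N d) _; rewrite /geo gt_eqF // le_min lexx andbT.
by rewrite -[M]invrK lef_pV2 // posrE invr_gt0.
Qed.

End MajorArcs.

(** * Major arcs *)

Section MajorSum.
Variable R : realType.
Variables (N q : nat) (a : int) (b : R).
Hypotheses (q0 : (0 < q)%N) (qN : (q <= N)%N) (cop : coprimez a q)
  (hb : `|q%:R * b - a%:~R| <= (4 * N ^ 2)%:R^-1).

Let tau0 : R := b - a%:~R / q%:R.
Let Y : R := N%:R ^+ 3 * `|tau0|.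
Let n : nat := (N ^ 2 %/ q).+1.

Let qp : 0 < q%:R :> R. Proof. by rewrite ltr0n. Qed.
Let Np : 0 < N%:R :> R. Proof. by rewrite ltr0n (leq_trans q0). Qed.
Let qNR : q%:R <= N%:R :> R. Proof. by rewrite ler_nat. Qed.
Let N1 : 1 <= N%:R :> R. Proof. by rewrite ler1n (leq_trans q0). Qed.

Let qtau : q%:R * `|tau0| * (4 * N%:R ^+ 2) <= 1.
Proof.
have h : 0 < 4 * N%:R ^+ 2 :> R by rewrite mulr_gt0 // exprn_gt0.
rewrite -ler_pdivlMr // mul1r; move: hb.
rewrite natrM natrX => hb'; apply: le_trans hb'.
rewrite -{1}(ger0_norm (ltW qp)) -normrM le_eqVlt; apply/orP; left; apply/eqP.
by congr `|_|; rewrite /tau0 mulrBr mulrCA divff ?gt_eqF // mulr1.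
Qed.

Let Y0 : 0 <= Y. Proof. by rewrite mulr_ge0 // exprn_ge0 // ltW. Qed.

Let qY : q%:R * Y * 4 <= N%:R.
Proof.
have -> : q%:R * Y * 4 = N%:R * (q%:R * `|tau0| * (4 * N%:R ^+ 2)) by rewrite /Y; ring.
by rewrite ler_piMr // ltW.
Qed.

Let S : R := N%:R ^+ 3 / (q%:R * (1 + Y)).

Let den0 : 0 < q%:R * (1 + Y).
Proof. by rewrite mulr_gt0 //; have := Y0; lra. Qed.

Let S0 : 0 <= S.
Proof. by rewrite divr_ge0 ?exprn_ge0 // ltW. Qed.

Let den_le : q%:R * (1 + Y) <= 2 * N%:R.
Proof. by have := qY; have := qNR; have := Np; lra. Qed.

Lemma inv_N_le : N%:R^-1 <= 2 / (q%:R * (1 + Y)).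
Proof. by rewrite ler_pdivlMr // ler_pdivrMl // (mulrC N%:R) den_le. Qed.

Let sqr_N_le : N%:R ^+ 2 <= 2 * S.
Proof.
have -> : 2 * S = N%:R ^+ 3 * (2 / (q%:R * (1 + Y))) by rewrite /S; ring.
apply: le_trans (ler_wpM2l _ inv_N_le); last by rewrite exprn_ge0 // ltW.
by rewrite (exprSr N%:R 2) mulfK // gt_eqF.
Qed.

Let nN : (n * q <= 2 * N ^ 2)%N.
Proof.
rewrite /n mulSn mul2n -addnn; apply: leq_add; last exact: leq_trunc_div.
by apply: leq_trans qN _; rewrite -[X in (X <= _)%N]expn1 leq_pexp2l // (leq_trans q0).
Qed.

Let nR : n%:R <= 2 * N%:R ^+ 2 / q%:R :> R.
Proof. by rewrite ler_pdivlMr // -natrX -!natrM ler_nat. Qed.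

Let harm1 : 1 <= harm R n.
Proof. by apply: le_trans (le_harm R (_ : 1 <= n)%N) => //; rewrite /harm big_nat1 invr1. Qed.

Let dist_mult (l : nat) : (l < n)%N -> dist (b * (l * q)%:R) = `|tau0| * (l * q)%:R.
Proof.
move=> ln; have -> : b * (l * q)%:R = tau0 * (l * q)%:R + (a * l%:Z)%:~R.
  rewrite intrM natrM -[(l%:Z)%:~R]/(l%:R) /tau0.
  by field; rewrite gt_eqF.
rewrite distDz dist_norm; first by rewrite normrM (ger0_norm (ler0n _ _)).
have lq : (l * q)%:R <= N%:R ^+ 2 :> R.
  rewrite -natrX ler_nat; apply: leq_trans (leq_trunc_div _ q).
  by rewrite leq_mul2r; apply/orP; right; rewrite -ltnS.
rewrite normrM (ger0_norm (ler0n _ _)).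
have t0 := normr_ge0 tau0.
have h1 : `|tau0| * (l * q)%:R <= `|tau0| * N%:R ^+ 2 by exact: ler_wpM2l.
have h2 : `|tau0| * N%:R ^+ 2 <= q%:R * (`|tau0| * N%:R ^+ 2).
  by rewrite ler_peMl ?mulr_ge0 ?exprn_ge0 ?ler1n // ltW.
have := qtau; lra.
Qed.

(** For the multiples [l q], the distance of [b l q] to the integers is exactly
    [l q |tau0|]. *)
Lemma multiples_sum :
  \sum_(0 <= l < n) geo N%:R (b * (l * q)%:R) <= 2 * (1 + harm R n) * S.
Proof.
have iden : 0 <= (q%:R * (1 + Y))^-1 by rewrite invr_ge0 ltW.
have [Y1|Y1] := leP Y 1.
  apply: le_trans (_ : \sum_(0 <= l < n) N%:R <= _).
    by apply: ler_sum => l _; exact: geo_le.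
  rewrite sumr_const_nat subn0 -[leLHS]mulr_natl.
  apply: le_trans (_ : 2 * N%:R ^+ 2 / q%:R * N%:R <= _).
    by apply: ler_wpM2r => //; exact: ltW.
  have -> : 2 * N%:R ^+ 2 / q%:R * N%:R = 2 * (1 + Y) * S :> R.
    by rewrite /S; field; rewrite !gt_eqF //; have := Y0; lra.
  by apply: ler_wpM2r => //; have := harm1; lra.
rewrite big_ltn //=; have -> : 2 * (1 + harm R n) * S = 2 * S + \sum_(1 <= l < n.+1) l%:R^-1 * (2 * S).
  by rewrite -mulr_suml -/(harm R n); ring.
apply: lerD.
  apply: le_trans (geo_le _ _) _; apply: le_trans sqr_N_le.
  by rewrite expr2 ler_peMr // ltW.
rewrite [leRHS]big_nat_recr //= big_nat [in leRHS]big_nat.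
rewrite -[leLHS]addr0; apply: lerD; last by rewrite !mulr_ge0 // invr_ge0 ler0n.
apply: ler_sum => l /andP[l0 ln].
have lp : 0 < l%:R :> R by rewrite ltr0n.
have tp : 0 < `|tau0|.
  rewrite normr_gt0; apply/eqP => t0; move: Y1; rewrite /Y t0 normr0 mulr0; lra.
have dp : 0 < dist (b * (l * q)%:R).
  by rewrite dist_mult // mulr_gt0 // ltr0n muln_gt0 l0.
apply: le_trans (geo_le_inv N dp) _; rewrite dist_mult //.
rewrite /S natrM; set x := `|tau0| in tp *.
have YE : Y = N%:R ^+ 3 * x by [].
rewrite -[leLHS]mul1r ler_pdivrMr; last by rewrite !mulr_gt0.
have -> : l%:R^-1 * (2 * (N%:R ^+ 3 / (q%:R * (1 + Y)))) * (x * (l%:R * q%:R)) =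
   2 * Y / (1 + Y).
  by rewrite YE; field; rewrite ?gt_eqF //; move: Y1; rewrite YE; lra.
by rewrite ler_pdivlMr; lra.
Qed.

(** Off the multiples of [q], [b m] stays at distance at least [1 / (2 q)] from
    the integers, so [N] may be replaced by [2 q]; the points of a block are well
    spaced at that scale. *)
Lemma residues_sum l : (l < n)%N ->
  \sum_(i < q) geo N%:R (b * (l * q + i)%:R) <=
  geo N%:R (b * (l * q)%:R) + 4 * ((2 * q)%:R * cell_total R (2 * q)).
Proof.
move=> ln; have q2 : (0 < 2 * q)%N by rewrite muln_gt0.
rewrite (bigD1 (Ordinal q0)) //= addn0 lerD2l.
have hbq : `|b - a%:~R / q%:R| <= q%:R ^- 2.
  have h := qtau; rewrite -/tau0 -[leRHS]mul1r ler_pdivlMr ?exprn_gt0 //.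
  have q2N : q%:R ^+ 2 <= q%:R * N%:R ^+ 2 :> R.
    rewrite expr2; apply: ler_wpM2l; first exact: ltW.
    by rewrite expr2; apply: le_trans qNR _; rewrite ler_peMl // ltW.
  have h1 := ler_wpM2l (normr_ge0 tau0) q2N.
  have h2 : 0 <= `|tau0| * (q%:R * N%:R ^+ 2) by rewrite mulr_ge0 // mulr_ge0 ?exprn_ge0 // ltW.
  lra.
apply: le_trans (_ : \sum_(i < q) 1 * geo (2 * q)%:R (b * (l * q + i)%:R) <= _); last first.
  apply: (@geo_sum_cells R _ _ _ _ _ (fun=> 1)) => // c.
  have iq : 0 <= (2 * q)%:R^-1 :> R by rewrite invr_ge0 ler0n.
  have := block_count (l * q) c q0 cop hbq iq.
  have -> : q%:R * (2 * q)%:R^-1 + 3 = 7 / 2 :> R.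
    by rewrite natrM; field; rewrite gt_eqF.
  move=> h; apply: le_trans (_ : 7 / 2 <= _); last by lra.
  apply: le_trans h; under eq_bigr do rewrite mul1r.
  rewrite -natr_sum ler_nat -sum1_card [leqRHS]big_mkcond; apply: leq_sum => i _.
  by rewrite inE; case: (fr _ < _).
rewrite [leRHS](bigD1 (Ordinal q0)) //= -[leLHS]add0r; apply: lerD.
  by rewrite mul1r geo_ge0 // ler0n.
apply: ler_sum => i i0; rewrite mul1r; apply: geo_compare; first by rewrite ltr0n.
have qm : ~~ (q %| l * q + i)%N.
  rewrite dvdn_addr ?dvdn_mull // gtnNdvd //.
  by rewrite lt0n; apply: contra i0 => /eqP h; apply/eqP/val_inj.
have mN : (l * q + i <= 2 * N ^ 2)%N.
  apply: leq_trans nN; apply: leq_trans (_ : l * q + q <= _)%N.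
    by rewrite leq_add2l ltnW.
  by rewrite addnC -mulSn leq_mul2r ln orbT.
have := dist_rat R q0 cop qm; set m := (l * q + i)%N in mN *.
have := dist_tri (a%:~R / q%:R * m%:R) (b * m%:R).
have -> : a%:~R / q%:R * m%:R - b * m%:R = - (tau0 * m%:R) by rewrite /tau0; ring.
rewrite normrN normrM (ger0_norm (ler0n _ m)) => h1 h2.
have h3 : `|tau0| * m%:R <= (2 * q)%:R^-1.
  have mR : m%:R <= 2 * N%:R ^+ 2 :> R by rewrite -natrX -natrM ler_nat.
  rewrite -[leRHS]mul1r ler_pdivlMr ?ltr0n // natrM.
  have := ler_wpM2l (mulr_ge0 (ltW qp) (normr_ge0 tau0)) mR; have := qtau; lra.
have h4 : (2 * q)%:R^-1 = q%:R^-1 / 2 :> R by rewrite natrM; field; rewrite gt_eqF.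
by rewrite h4 in h3 *; lra.
Qed.

Definition major_factor (N : nat) : R :=
  32 * cell_total R (2 * N) + 2 * (1 + harm R (2 * N ^ 2)).

Lemma major_geo_sum :
  \sum_(1 <= m < (N ^ 2).+1) geo N%:R (b * m%:R) <= major_factor N * S.
Proof.
have g0 m : 0 <= geo N%:R (b * m%:R) by rewrite geo_ge0 // ltW.
apply: le_trans (_ : \sum_(0 <= m < n * q) geo N%:R (b * m%:R) <= _).
  have Nn : (N ^ 2 < n * q)%N by rewrite ltn_ceil.
  rewrite [leRHS](@big_cat_nat _ _ _ 1) //=; last by apply: leq_trans Nn.
  rewrite [X in _ <= _ + X](@big_cat_nat _ _ _ (N ^ 2).+1) //=.
  have h1 : 0 <= \sum_(0 <= i < 1) geo N%:R (b * i%:R) by exact: sumr_ge0.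
  have h2 : 0 <= \sum_((N ^ 2).+1 <= i < n * q) geo N%:R (b * i%:R) by exact: sumr_ge0.
  lra.
rewrite sum_blocks big_nat.
apply: le_trans (_ : \sum_(0 <= l < n) (geo N%:R (b * (l * q)%:R) + 4 * ((2 * q)%:R * cell_total R (2 * q))) <= _).
  by rewrite [leRHS]big_nat; apply: ler_sum => l /andP[_ ln]; exact: residues_sum.
rewrite big_split /= sumr_const_nat subn0 -[X in _ + X <= _]mulr_natl.
have c0 := cell_total_ge0 R (2 * q).
have c1 : cell_total R (2 * q) <= cell_total R (2 * N).
  by rewrite /cell_total; apply: ler_wpM2l => //; rewrite lerD2l le_harm // leq_mul2l qN orbT.
have h1 : n%:R * (4 * ((2 * q)%:R * cell_total R (2 * q))) <= 32 * cell_total R (2 * N) * S.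
  apply: le_trans (_ : 2 * N%:R ^+ 2 / q%:R * (4 * ((2 * q)%:R * cell_total R (2 * q))) <= _).
    by apply: ler_wpM2r nR; apply: mulr_ge0 => //; apply: mulr_ge0 => //; exact: ler0n.
  have -> : 2 * N%:R ^+ 2 / q%:R * (4 * ((2 * q)%:R * cell_total R (2 * q))) =
    16 * (cell_total R (2 * q) * N%:R ^+ 2) by rewrite natrM; field; rewrite gt_eqF.
  have := ler_pM c0 (exprn_ge0 2 (ltW Np)) c1 sqr_N_le; lra.
have h2 := multiples_sum.
have h3 : harm R n <= harm R (2 * N ^ 2).
  by apply: le_harm; apply: leq_trans nN; rewrite leq_pmulr.
have h4 : 2 * (1 + harm R n) * S <= 2 * (1 + harm R (2 * N ^ 2)) * S.
  by apply: ler_wpM2r => //; lra.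
rewrite /major_factor [leRHS]mulrDl [leRHS]addrC; apply: lerD => //.
exact: le_trans h2 h4.
Qed.

End MajorSum.

Section MajorBound.
Variable R : realType.

Lemma slow_cell_total c m : (0 < m)%N -> (0 < c)%N ->
  slow (fun N => cell_total R (c * N ^ m)).
Proof.
move=> m0 c0; apply: slow_mul; first exact: slow_const.
apply: slow_add; first exact: slow_const.
apply: (slow_comp (slow_harm R) m0 (c := c)) => N N0.
by rewrite muln_gt0 c0 expn_gt0 N0 leqnn.
Qed.

Lemma slow_major_factor : slow (major_factor R).
Proof.
apply: slow_add; apply: slow_mul; try exact: slow_const.
  apply: slow_le (@slow_cell_total 2 1 isT isT) _ _ => N; first exact: cell_total_ge0.
  by rewrite expn1.
apply: slow_add; first exact: slow_const.
apply: (slow_comp (slow_harm R) (isT : (0 < 2)%N) (c := 2)) => N N0.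
by rewrite muln_gt0 expn_gt0 N0 leqnn.
Qed.

Lemma major_arc_bound : exists2 G, slow G &
  forall (N n q : nat) (a : int) (P : {poly R}),
  (0 < q)%N -> (q <= N)%N -> coprimez a q -> (n <= N)%N -> (size P <= 4)%N ->
  `|q%:R * (6 * P`_3) - a%:~R| <= (4 * N ^ 2)%:R^-1 ->
  (mag (wsum P n) / N%:R) ^+ 4 <=
  G N / (q%:R * (1 + N%:R ^+ 3 * `|6 * P`_3 - a%:~R / q%:R|)).
Proof.
have [c c0 hc] := cubic_weyl R.
exists (fun N => c * (2 + (tau_max (N ^ 2))%:R ^+ 2 * major_factor R N)).
  apply: slow_mul; first exact: slow_const.
  apply: slow_add; first exact: slow_const.
  apply: slow_mul; last exact: slow_major_factor.
  apply: slow_exp; apply: (slow_comp (slow_tau R) (isT : (0 < 2)%N) (c := 1)) => N N0.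
  by rewrite mul1n expn_gt0 N0 leqnn.
move=> N n q a P q0 qN cop nN sP hb.
have N0 : (0 < N)%N by exact: leq_trans qN.
have Np : 0 < N%:R :> R by rewrite ltr0n.
apply: le_trans (hc P n N N0 nN sP) _; rewrite -mulrA; apply: ler_wpM2l => //.
set D := q%:R * _.
have h1 : N%:R^-1 <= 2 / D by exact: inv_N_le.
have h3 : \sum_(h <- boxes N 2) geo N%:R (6 * P`_3 * (bprod h)%:R) <=
  (tau_max (N ^ 2))%:R ^+ 2 * \sum_(1 <= m < (N ^ 2).+1) geo N%:R (6 * P`_3 * m%:R).
  apply: (@sum_boxes_prod R N 2 (N ^ 2) _ (fun m => geo N%:R (6 * P`_3 * m%:R))) => // m.
    by case/andP => _; exact: tau_le_max.
  by apply: geo_ge0; exact: ltW.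
have h4 := major_geo_sum q0 qN cop hb; rewrite -/D in h4.
have t0 : 0 <= (tau_max (N ^ 2))%:R ^+ 2 :> R by rewrite exprn_ge0 ?ler0n.
have h5 := le_trans h3 (ler_wpM2l t0 h4).
rewrite [leRHS]mulrDl; apply: lerD => //.
have i3 : 0 <= N%:R ^- 3 :> R by rewrite invr_ge0 exprn_ge0 // ltW.
apply: le_trans (ler_wpM2l i3 h5) _; rewrite le_eqVlt; apply/orP; left; apply/eqP.
have D0 : D != 0.
  rewrite mulf_neq0 ?gt_eqF ?ltr0n // ltr_pwDl // mulr_ge0 // exprn_ge0 // ltW.
by field; rewrite D0 gt_eqF.
Qed.

(** Group the indices by [q i], by the residue of [a i] and by the position of
    [b i] relative to the fraction at scale [N^-3].  Each group has at most [D]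
    members, and the squared bounds summed over the residues leave the product
    of two harmonic sums. *)
Lemma major_eighth_moment (I : Type) (r : seq I) (P : pred I) (N : nat) (D g : R)
  (b v : I -> R) (q : I -> nat) (a : I -> int) :
  (0 < N)%N -> 0 <= g ->
  (forall c, \sum_(i <- r) (fr (b i - c) < (N ^ 3)%:R^-1)%R%:R <= D) ->
  (forall i, P i -> [/\ (0 < q i <= N)%N,
     `|(q i)%:R * b i - (a i)%:~R| <= (4 * N ^ 2)%:R^-1,
      0 <= v i & v i ^+ 4 <= g / ((q i)%:R * (1 + N%:R ^+ 3 * `|b i - (a i)%:~R / (q i)%:R|))]) ->
  \sum_(i <- r | P i) v i ^+ 8 <= 8 * g ^+ 2 * D * (harm R N * harm R N.+2).
Proof.
move=> N0 g0 hD hP.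
have Np : 0 < N%:R :> R by rewrite ltr0n.
have N3 : 0 < (N ^ 3)%:R :> R by rewrite ltr0n expn_gt0 N0.
have N3E : (N ^ 3)%:R = N%:R ^+ 3 :> R by rewrite natrX.
have D0 : 0 <= D by apply: le_trans (hD 0); apply: sumr_ge0 => i _; exact: ler0n.
pose w (k j : nat) : R := 4 * g ^+ 2 / (k%:R ^+ 2 * j%:R).
have w0 k j : 0 <= w k j.
  by rewrite divr_ge0 // mulr_ge0 // ?exprn_ge0 // ?ler0n.
pose c (k m j : nat) (s : bool) : R := m%:R / k%:R + (-1) ^+ s * (j%:R - 1) / (N ^ 3)%:R.
pose hit k m j s i : R := (fr (b i - c k m j s) < (N ^ 3)%:R^-1)%R%:R.
have hit0 k m j s i : 0 <= hit k m j s i by exact: ler0n.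
apply: le_trans (_ : \sum_(i <- r) \sum_(1 <= k < N.+1) \sum_(0 <= m < k)
   \sum_(1 <= j < N.+3) \sum_(s <- [:: true; false]) w k j * hit k m j s i <= _).
  rewrite [leLHS]big_mkcond; apply: ler_sum => i _.
  have F0 k m j s : 0 <= w k j * hit k m j s i by exact: mulr_ge0.
  case: ifP => Pi; last first.
    by do 4![apply: sumr_ge0 => ? _].
  have [/andP[q0 qN] hb v0 hv] := hP i Pi.
  have qp : 0 < (q i)%:R :> R by rewrite ltr0n.
  set t := b i - (a i)%:~R / (q i)%:R in hv.
  pose J := Num.floor (N%:R ^+ 3 * t).
  have qZ : (0 < (q i)%:Z)%R by rewrite ltz_nat.
  pose m := `|(a i %% q i)%Z|%N.
  have mE : m%:Z = (a i %% q i)%Z by rewrite /m gez0_abs // modz_ge0 // gt_eqF.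
  have mq : (m < q i)%N by rewrite -ltz_nat mE ltz_pmod.
  have [J1 J2] : J%:~R <= N%:R ^+ 3 * t /\ N%:R ^+ 3 * t < J%:~R + 1.
    by split; [exact: floor_le|rewrite -[X in _ + X]/(1%:~R) -intrD floorD1_gt].
  (* [j] starts at 1 so that the sum of [1 / j] makes sense *)
  pose j := (`|J|%N).+1; pose s := (J < 0)%R.
  have jJ : (-1) ^+ s * (j%:R - 1) = J%:~R :> R.
    rewrite /j -natr1 addrK /s; case: (J) => l /=; first by rewrite expr0 mul1r.
    by rewrite NegzE rmorphN /= expr1 mulN1r.
  have Ymul : `|N%:R ^+ 3 * t| = N%:R ^+ 3 * `|t|.
    by rewrite normrM ger0_norm // exprn_ge0 // ltW.
  have jY : j%:R <= 2 * (1 + N%:R ^+ 3 * `|t|).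
    rewrite -Ymul /j -natr1 -[(`|J|%N)%:R]/((`|J|%N%:Z)%:~R) abszE intr_norm.
    have : `|J%:~R| <= `|N%:R ^+ 3 * t| + 1.
      have -> : J%:~R = N%:R ^+ 3 * t - (N%:R ^+ 3 * t - J%:~R) by ring.
      apply: le_trans (ler_normB _ _) _; rewrite lerD2l ler_norml; apply/andP; split; lra.
    by have := normr_ge0 (N%:R ^+ 3 * t); lra.
  have Yb : N%:R ^+ 3 * `|t| * 4 <= N%:R.
    have tE : (q i)%:R * `|t| <= (4 * N ^ 2)%:R^-1.
      apply: le_trans hb; rewrite -{1}(ger0_norm (ltW qp)) -normrM le_eqVlt; apply/orP; left; apply/eqP.
      by congr `|_|; rewrite /t mulrBr mulrCA divff ?gt_eqF // mulr1.
    have t1 : `|t| <= (4 * N ^ 2)%:R^-1.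
      by apply: le_trans tE; rewrite ler_peMl // ler1n.
    have N2 : 0 < (4 * N ^ 2)%:R :> R by rewrite ltr0n muln_gt0 expn_gt0 N0.
    have := t1; rewrite -[X in _ <= X]mul1r ler_pdivlMr // natrM natrX => t2.
    have := ler_wpM2l (ltW Np) t2; rewrite mulr1; lra.
  have jN : (j < N.+3)%N.
    rewrite -(ltr_nat R); apply: le_lt_trans jY _.
    rewrite -[N.+3]addn3 natrD; lra.
  have hits : hit (q i) m j s i = 1.
    rewrite /hit /c jJ; suff -> : fr (b i - (m%:R / (q i)%:R + J%:~R / (N ^ 3)%:R)) < (N ^ 3)%:R^-1 by [].
    have aE : (a i)%:~R = (a i %/ q i)%Z%:~R * (q i)%:R + m%:R :> R.
      by rewrite {1}(divz_eq (a i) (q i)) -mE rmorphD rmorphM.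
    have x1 : 0 <= t - J%:~R / (N ^ 3)%:R.
      by rewrite subr_ge0 ler_pdivrMr // mulrC N3E.
    have x2 : t - J%:~R / (N ^ 3)%:R < (N ^ 3)%:R^-1.
      rewrite ltrBlDl -[X in _ + X]mul1r -mulrDl ltr_pdivlMr // mulrC N3E.
      by apply: lt_le_trans J2 _; lra.
    rewrite (@fr_uniq _ _ (t - J%:~R / (N ^ 3)%:R) (a i %/ q i)%Z) //.
      by rewrite /t aE; field; rewrite !gt_eqF.
    rewrite x1 /=; apply: lt_le_trans x2 _; rewrite invf_le1 // ler1n expn_gt0 N0 //.
  have big1 : v i ^+ 8 <= w (q i) j * hit (q i) m j s i.
    rewrite hits mulr1 /w (exprM (v i) 4 2).
    set y := 1 + N%:R ^+ 3 * `|t| in hv jY; have y1 : 1 <= y.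
      by rewrite lerDl mulr_ge0 // exprn_ge0 // ltW.
    have j1 : 1 <= j%:R :> R by rewrite ler1n.
    apply: le_trans (_ : (g / ((q i)%:R * y)) ^+ 2 <= _).
      by apply: lerXn2r; rewrite ?nnegrE ?exprn_ge0 // divr_ge0 // mulr_ge0 ?ler0n //; lra.
    have yp : 0 < y by lra.
    have jp : 0 < j%:R :> R by lra.
    rewrite expr_div_n ler_pdivrMr ?exprn_gt0 ?mulr_gt0 // exprMn.
    rewrite mulrAC ler_pdivlMr ?mulr_gt0 ?exprn_gt0 //.
    have -> : 4 * g ^+ 2 * ((q i)%:R ^+ 2 * y ^+ 2) = g ^+ 2 * (q i)%:R ^+ 2 * (4 * y ^+ 2) by ring.
    rewrite mulrA; apply: ler_wpM2l; first by rewrite mulr_ge0 ?exprn_ge0 // ltW.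
    by have := ler_pM (ltW jp) (ltW jp) jY jY; nra.
  apply: le_trans big1 _.
  rewrite (bigD1_seq (q i)) ?iota_uniq ?mem_index_iota ?q0 //=.
  rewrite (bigD1_seq m) ?iota_uniq ?mem_index_iota //=.
  rewrite (bigD1_seq j) ?iota_uniq ?mem_index_iota //=.
  have ss : w (q i) j * hit (q i) m j s i <= \sum_(s <- [:: true; false]) w (q i) j * hit (q i) m j s i.
    by rewrite !big_cons big_nil addr0; case: (s); rewrite ?lerDl ?lerDr.
  apply: le_trans ss _; rewrite -!addrA lerDl !addr_ge0 //.
  - by do 2![apply: sumr_ge0 => ? _].
  - by do 3![apply: sumr_ge0 => ? _].
  - by do 4![apply: sumr_ge0 => ? _].
rewrite exchange_big /=.
apply: le_trans (_ : \sum_(1 <= k < N.+1) \sum_(0 <= m < k) \sum_(1 <= j < N.+3) \sum_(s <- [:: true; false]) w k j * D <= _).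
  apply: ler_sum => k _; rewrite exchange_big /=; apply: ler_sum => m _.
  rewrite exchange_big /=; apply: ler_sum => j _.
  rewrite exchange_big /=; apply: ler_sum => s _.
  by rewrite -mulr_sumr; apply: ler_wpM2l => //; exact: hD.
rewrite le_eqVlt; apply/orP; left; apply/eqP.
rewrite /harm mulr_suml mulr_sumr [LHS]big_nat [RHS]big_nat; apply: eq_bigr => k /andP[k0 _].
rewrite sumr_const_nat subn0 -[LHS]mulr_natl !mulr_sumr; apply: eq_bigr => j _.
rewrite !big_cons big_nil addr0 /w.
have kp : k%:R != 0 :> R by rewrite pnatr_eq0 -lt0n.
rewrite invfM; have -> : k%:R^-1 = k%:R * (k%:R ^+ 2)^-1 :> R by field.
ring.
Qed.

End MajorBound.

(** * The large sieve *)

Section LargeSieve.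
Variable R : realType.

Definition vsum (M : nat) (x y z : R) : R[i] :=
  \sum_(n < M) e (x * n%:R + y * n%:R ^+ 2 + z * n%:R ^+ 3).

Definition energy (M : nat) : nat := @sols M (fun=> predT) (fun=> predT).

Lemma mag_nat n : mag (n%:R : R[i]) = n%:R.
Proof.
rewrite (_ : n%:R = (n%:R : R)%:C); last by rewrite rmorph_nat.
by rewrite mag_real ger0_norm ?ler0n.
Qed.

Lemma geoN (N t : R) : geo N (- t) = geo N t.
Proof. by rewrite /geo distN. Qed.

Lemma geo_sum0 N (t : R) : mag (\sum_(n < N) e (t * n%:R)) <= geo N%:R t.
Proof.
have := geo_sum t 0 0 N; rewrite subn0 big_mkord.
by under eq_bigr do rewrite addr0 -mulr_natr.
Qed.

Lemma psum_range M j (x : {ffun 'I_6 -> 'I_M}) : (0 < j)%N -> (psum j x < 6 * M ^ j)%N.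
Proof.
move=> j0; rewrite /psum.
have -> : (6 * M ^ j = \sum_(i < 6) M ^ j)%N by rewrite sum_nat_const card_ord.
rewrite [X in (X < _)%N](bigD1 ord0) //= [X in (_ < X)%N](bigD1 ord0) //= -addSn.
apply: leq_add; first by rewrite ltn_exp2r.
by apply: leq_sum => i _; rewrite leq_exp2r // ltnW.
Qed.

Section Dual.
Variables (I : Type) (r : seq I) (a1 a2 a3 : I -> R) (M : nat) (K : R).
Hypothesis rowK : forall i, \sum_(j <- r) geo (6 * M ^ 1)%:R (a1 j - a1 i) *
   geo (6 * M ^ 2)%:R (a2 j - a2 i) * geo (6 * M ^ 3)%:R (a3 j - a3 i) <= K.

Let F i : R[i] := vsum M (a1 i) (a2 i) (a3 i) ^+ 6.
Let W := {ffun 'I_6 -> 'I_M}.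
Let B := ('I_(6 * M ^ 1) * 'I_(6 * M ^ 2) * 'I_(6 * M ^ 3))%type.

Let Psi (x : W) : B :=
  (Ordinal (psum_range x (isT : 0 < 1)%N), Ordinal (psum_range x (isT : 0 < 2)%N),
   Ordinal (psum_range x (isT : 0 < 3)%N)).

Let phase i (n : B) : R[i] :=
  e (a1 i * (n.1.1)%:R + a2 i * (n.1.2)%:R + a3 i * (n.2)%:R).

Let FE i : F i = \sum_(x : W) phase i (Psi x).
Proof.
rewrite /F /vsum; have -> : forall u : R[i], u ^+ 6 = \prod_(i < 6) u.
  by move=> u; rewrite prodr_const card_ord.
rewrite bigA_distr_bigA /=; apply: eq_bigr => x _.
rewrite -e_sum; congr e; rewrite !big_split /= -!mulr_sumr /psum.
by rewrite !natr_sum; congr (_ + _ + _); congr (_ * _); apply: eq_bigr => i' _; rewrite natrX.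
Qed.

Let rep (n : B) : nat := #|[pred x : W | Psi x == n]|.

Let sum_rep (V : nmodType) (H : B -> V) : \sum_(x : W) H (Psi x) = \sum_(n : B) H n *+ rep n.
Proof.
rewrite (partition_big Psi xpredT) //=; apply: eq_bigr => n _.
by rewrite (eq_bigr (fun=> H n)) ?sumr_const // => x /eqP ->.
Qed.

Let rep2 : (\sum_(n : B) rep n ^ 2 = energy M)%N.
Proof.
have -> : (\sum_(n : B) rep n ^ 2 = \sum_(n : B) (rep n : nat) *+ rep n)%N.
  by apply: eq_bigr => n _; rewrite -mulr_natr natn.
rewrite -(sum_rep rep) /energy /sols -sum1_card.
transitivity (\sum_(x : W) \sum_(y : W | Psi y == Psi x) 1)%N.
  by apply: eq_bigr => x _; rewrite /rep -sum1_card.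
rewrite pair_big_dep /=; apply: eq_bigl => -[x y] /=; rewrite inE /=.
have F1 (z : W) : z \in family (fun=> predT : pred 'I_M) by apply/familyP => i.
rewrite !F1 /= /Psi !xpair_eqE -!val_eqE /=.
by rewrite ![psum _ y == _]eq_sym andbA.
Qed.

Let G (n : B) : R[i] := \sum_(i <- r) (F i)^* * phase i n.

Let S : R := \sum_(i <- r) mag (F i) ^+ 2.

Let S_le : S <= \sum_(n : B) (rep n)%:R * mag (G n).
Proof.
have E : (S%:C : R[i]) = \sum_(n : B) G n *+ rep n.
  rewrite -(sum_rep G) /G exchange_big /= /S rmorph_sum /=.
  apply: eq_bigr => i _; rewrite -mulr_sumr -FE mulrC.
  by rewrite -sqr_mag.
have S0 : 0 <= S by apply: sumr_ge0 => i _; exact: sqr_ge0.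
rewrite -[S]ger0_norm // -mag_real E; apply: le_trans (mag_sum _ _ _) _.
apply: ler_sum => n _; rewrite -[G n *+ _]mulr_natl magM mag_nat //.
Qed.

Let phase_split i j n : phase i n * (phase j n)^* =
  e ((a1 i - a1 j) * (n.1.1)%:R) * e ((a2 i - a2 j) * (n.1.2)%:R) * e ((a3 i - a3 j) * (n.2)%:R).
Proof. by rewrite /phase -eB -!eD; congr e; ring. Qed.

Let G2 : \sum_(n : B) mag (G n) ^+ 2 <= K * S.
Proof.
pose k i j := geo (6 * M ^ 1)%:R (a1 i - a1 j) * geo (6 * M ^ 2)%:R (a2 i - a2 j) *
   geo (6 * M ^ 3)%:R (a3 i - a3 j).
have k0 i j : 0 <= k i j by rewrite !mulr_ge0 // geo_ge0 // ler0n.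
have kS i j : k i j = k j i.
  by rewrite /k -(geoN _ (a1 i - _)) -(geoN _ (a2 i - _)) -(geoN _ (a3 i - _)) !opprB.
have E : ((\sum_(n : B) mag (G n) ^+ 2)%:C : R[i]) =
   \sum_(i <- r) \sum_(j <- r) (F i)^* * F j * \sum_(n : B) phase i n * (phase j n)^*.
  rewrite rmorph_sum /=; under [RHS]eq_bigr => i _ do under eq_bigr => j _ do rewrite mulr_sumr.
  under [RHS]eq_bigr => i _ do rewrite exchange_big /=.
  rewrite [RHS]exchange_big /=; apply: eq_bigr => n _.
  rewrite sqr_mag /G rmorph_sum /= big_distrlr /=; apply: eq_bigr => i _; apply: eq_bigr => j _.
  by move: (F i) (F j) (phase i n) (phase j n) => u v w x; rewrite rmorphM /= conjCK mulrACA.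
have G0 : 0 <= \sum_(n : B) mag (G n) ^+ 2 by apply: sumr_ge0 => n _; exact: sqr_ge0.
rewrite -[leLHS]ger0_norm // -mag_real E; apply: le_trans (mag_sum _ _ _) _.
apply: le_trans (_ : \sum_(i <- r) \sum_(j <- r) mag (F i) * mag (F j) * k i j <= _).
  apply: ler_sum => i _; apply: le_trans (mag_sum _ _ _) _; apply: ler_sum => j _.
  rewrite magM [mag (_^* * _)]magM mag_conj; apply: ler_wpM2l; first by rewrite mulr_ge0 ?mag_ge0.
  under eq_bigr do rewrite phase_split.
  have -> : \sum_(n : B) e ((a1 i - a1 j) * (n.1.1)%:R) * e ((a2 i - a2 j) * (n.1.2)%:R) *
      e ((a3 i - a3 j) * (n.2)%:R) =
    (\sum_(n < 6 * M ^ 1) e ((a1 i - a1 j) * n%:R)) * (\sum_(n < 6 * M ^ 2) e ((a2 i - a2 j) * n%:R)) *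
    (\sum_(n < 6 * M ^ 3) e ((a3 i - a3 j) * n%:R)).
    rewrite big_distrlr /= pair_bigA big_distrlr /= pair_bigA /=; exact: eq_bigr.
  rewrite !magM /k; apply: ler_pM; rewrite ?mulr_ge0 ?mag_ge0 ?geo_sum0 //.
  by apply: ler_pM; rewrite ?mag_ge0 ?geo_sum0.
apply: le_trans (_ : \sum_(i <- r) \sum_(j <- r) (mag (F i) ^+ 2 * k i j / 2 + mag (F j) ^+ 2 * k i j / 2) <= _).
  apply: ler_sum => i _; apply: ler_sum => j _.
  have := mulr_ge0 (sqr_ge0 (mag (F i) - mag (F j))) (k0 i j).
  by move: (mag (F i)) (mag (F j)) (k i j) => x y w; lra.
(* the kernel is symmetric, so both halves of the bound have the same sum *)
have half : \sum_(i <- r) \sum_(j <- r) mag (F i) ^+ 2 * k i j / 2 <= K * S / 2.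
  rewrite mulrAC mulrC /S mulr_suml; apply: ler_sum => i _.
  under eq_bigr do rewrite -mulrA.
  rewrite -mulr_sumr; apply: ler_wpM2l; first exact: sqr_ge0.
  rewrite -mulr_suml; apply: ler_wpM2r; first by rewrite invr_ge0.
  by under eq_bigr do rewrite kS; exact: rowK.
under eq_bigr do rewrite big_split /=.
rewrite big_split /=.
have half' : \sum_(i <- r) \sum_(j <- r) mag (F j) ^+ 2 * k i j / 2 <= K * S / 2.
  by rewrite exchange_big /=; under eq_bigr => i _ do under eq_bigr => j _ do rewrite kS.
lra.
Qed.

(** Expanding the square of the dual form: the rows of the matrix of kernels
    have sum at most [K]. *)
Lemma dual_large_sieve : 0 <= K -> \sum_(i <- r) mag (F i) ^+ 2 <= (energy M)%:R * K.
Proof.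
move=> K0; rewrite -/S.
have S0 : 0 <= S by apply: sumr_ge0 => i _; exact: sqr_ge0.
have [->|Sn] := eqVneq S 0; first by rewrite mulr_ge0 ?ler0n.
have Sp : 0 < S by rewrite lt_def Sn.
rewrite -(ler_pM2r Sp) -mulrA -expr2.
apply: le_trans (_ : (\sum_(n : B) (rep n)%:R * mag (G n)) ^+ 2 <= _).
  by apply: lerXn2r; rewrite ?nnegrE //; apply: sumr_ge0 => n _; rewrite mulr_ge0 ?ler0n ?mag_ge0.
apply: le_trans (cauchy_schwarz _ _ _ _) _.
apply: ler_pM => //; try by apply: sumr_ge0 => n _; exact: sqr_ge0.
by under eq_bigr do rewrite -natrX; rewrite -natr_sum rep2.
Qed.

End Dual.

(** The sixth power of [vsum] is a sum over values of the three power sums, whose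
    coefficients have [energy M] as sum of squares.  The linear coordinate [a1]
    may be concentrated: its kernel is estimated trivially. *)
Lemma large_sieve (I : Type) (r : seq I) (a1 a2 a3 : I -> R) (M : nat) (D : R) :
  (0 < M)%N ->
  (forall c d, \sum_(i <- r) (fr (a3 i - c) < (6 * M ^ 3)%:R^-1)%R%:R *
     (fr (a2 i - d) < (6 * M ^ 2)%:R^-1)%R%:R <= D) ->
  \sum_(i <- r) mag (vsum M (a1 i) (a2 i) (a3 i)) ^+ 12 <=
  (energy M)%:R * (D * (6 ^+ 3 * M%:R ^+ 6 * (cell_total R (6 * M ^ 2) * cell_total R (6 * M ^ 3)))).
Proof.
move=> M0 hD.
have D0 : 0 <= D by apply: le_trans (hD 0 0); apply: sumr_ge0 => i _; rewrite mulr_ge0 ?ler0n.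
set K := D * _.
have K0 : 0 <= K.
  apply: mulr_ge0 => //; apply: mulr_ge0; apply: mulr_ge0; try exact: cell_total_ge0.
    exact: exprn_ge0.
  by apply: exprn_ge0; exact: ler0n.
have -> : \sum_(i <- r) mag (vsum M (a1 i) (a2 i) (a3 i)) ^+ 12 =
   \sum_(i <- r) mag (vsum M (a1 i) (a2 i) (a3 i) ^+ 6) ^+ 2.
  by apply: eq_bigr => i _; rewrite magX -exprM.
apply: dual_large_sieve => // i.
apply: le_trans (_ : \sum_(j <- r) (6 * M ^ 1)%:R *
   (geo (6 * M ^ 2)%:R (a2 j - a2 i) * geo (6 * M ^ 3)%:R (a3 j - a3 i)) <= _).
  apply: ler_sum => j _; rewrite -mulrA; apply: ler_wpM2r; last exact: geo_le.
  by rewrite mulr_ge0 // geo_ge0 // ler0n.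
rewrite -mulr_sumr.
have p2 : (0 < 6 * M ^ 2)%N by rewrite muln_gt0 expn_gt0 M0.
have p3 : (0 < 6 * M ^ 3)%N by rewrite muln_gt0 expn_gt0 M0.
have h : \sum_(j <- r) geo (6 * M ^ 2)%:R (a2 j - a2 i) * geo (6 * M ^ 3)%:R (a3 j - a3 i) <=
   D * ((6 * M ^ 2)%:R * cell_total R (6 * M ^ 2)) * ((6 * M ^ 3)%:R * cell_total R (6 * M ^ 3)).
  apply: geo_sum_cells => // [j|c]; first by rewrite geo_ge0 // ler0n.
  under eq_bigr do rewrite mulrC.
  apply: geo_sum_cells => // d.
  apply: le_trans (hD (a3 i + c) (a2 i + d)); rewrite le_eqVlt; apply/orP; left; apply/eqP.
  by apply: eq_bigr => j _; rewrite !opprD !addrA.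
apply: le_trans (ler_wpM2l _ h) _; first exact: ler0n.
rewrite /K !natrM !natrX le_eqVlt; apply/orP; left; apply/eqP.
ring.
Qed.

End LargeSieve.

(** * Minor arcs *)

Section Completion.
Variable R : realType.

Lemma sum_geo_fractions M : (0 < M)%N ->
  \sum_(t < M) geo M%:R (t%:R / M%:R : R) <= 4 * (M%:R * cell_total R M).
Proof.
move=> M0; have Mp : 0 < M%:R :> R by rewrite ltr0n.
apply: le_trans (_ : \sum_(t < M) 1 * geo M%:R (t%:R / M%:R : R) <= _).
  by under [leRHS]eq_bigr do rewrite mul1r.
apply: (@geo_sum_cells R _ _ _ _ _ (fun=> 1)) => // c.
have iM : 0 <= M%:R^-1 :> R by rewrite invr_ge0 ltW.
have h0 : `|M%:R^-1 - 1%:~R / M%:R| <= M%:R ^- 2 :> R.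
  by rewrite mul1r subrr normr0 invr_ge0 exprn_ge0 // ltW.
have := block_count 0 c M0 (coprime1n M : coprimez 1 M) h0 iM.
rewrite divff ?gt_eqF // => h; apply: le_trans (_ : 1 + 3 <= _); last by lra.
apply: le_trans h; under eq_bigr do rewrite mul1r.
rewrite -natr_sum ler_nat -sum1_card [leqRHS]big_mkcond; apply: leq_sum => i _.
by rewrite inE add0n (mulrC M%:R^-1); case: (fr _ < _).
Qed.

(** The indicator function of the interval is a combination of characters
    modulo [M] with coefficients summing to about the logarithm of [M]; the largest
    of the twisted sums is taken. *)
Lemma completion (phi : nat -> R) M u n : (0 < M)%N -> (u + n <= M)%N ->
  exists t : 'I_M, mag (\sum_(u <= y < u + n) e (phi y)) <=
    4 * cell_total R M * mag (\sum_(y < M) e (phi y + (t * y)%:R / M%:R)).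
Proof.
move=> M0 unM; have Mp : 0 < M%:R :> R by rewrite ltr0n.
pose A (t : 'I_M) := \sum_(y < M) e (phi y + (t * y)%:R / M%:R).
pose B (t : 'I_M) := \sum_(x < M | (u <= x < u + n)%N) (e ((t * x)%:R / M%:R : R))^*.
have SE (F : nat -> R[i]) : \sum_(u <= y < u + n) F y = \sum_(y < M | (u <= y < u + n)%N) F y.
  by rewrite (big_nat_widenl u 0) // (big_nat_widen 0 (u + n) M) // big_mkord /=.

have key : M%:R * (\sum_(u <= y < u + n) e (phi y)) = \sum_(t < M) A t * B t.
  rewrite SE; under [RHS]eq_bigr do rewrite /A /B big_distrlr /=.
  rewrite [RHS]exchange_big /= mulr_sumr big_mkcond /=; apply: eq_bigr => y _.
  rewrite exchange_big /=.
  have E (x : 'I_M) : \sum_(t < M) e (phi y + (t * y)%:R / M%:R) * (e ((t * x)%:R / M%:R : R))^* =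
      if y == x then M%:R * e (phi y) else 0.
    under eq_bigr do rewrite eD -mulrA.
    rewrite -mulr_sumr (ortho1 R (ltn_ord y) (ltn_ord x)) -val_eqE /=.
    by case: eqP => _; rewrite ?mulr0 // mulrC.
  under eq_bigr do rewrite E.
  rewrite -big_mkcondr /=; case: ifP => hy.
    rewrite (bigD1 y) /=; last by rewrite hy eqxx.
    rewrite big1 ?addr0 // => x /andP[/andP[_ /eqP ->]]; by rewrite eqxx.
  by rewrite big1 // => x /andP[hx /eqP yx]; rewrite yx hx in hy.
have c0 := cell_total_ge0 R M.
have [t _ ht] := @arg_maxP _ _ 'I_M (Ordinal M0) xpredT (fun t => mag (A t)) isT.
exists t; rewrite -/(A t) -(ler_pM2l Mp).
have -> : M%:R * mag (\sum_(u <= y < u + n) e (phi y)) = mag (M%:R * \sum_(u <= y < u + n) e (phi y)).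
  by rewrite magM mag_nat.
rewrite key; apply: le_trans (mag_sum _ _ _) _.
apply: le_trans (_ : \sum_(s < M) mag (A t) * geo M%:R (s%:R / M%:R : R) <= _).
  apply: ler_sum => s _; rewrite magM; apply: ler_pM; rewrite ?mag_ge0 //; first exact: ht.
  have -> : mag (B s) = mag (\sum_(u <= x < u + n) e (s%:R / M%:R *+ x + 0 : R)).
    rewrite SE -[RHS]mag_conj /B rmorph_sum /=; congr mag; apply: eq_bigr => x _.
    by rewrite addr0 natrM -[in RHS]mulr_natr mulrAC (mulrC s%:R).
  apply: le_trans (geo_sum _ _ _ _) _; apply: geo_mono; rewrite ler_nat.
  by rewrite addKn (leq_trans _ unM) // leq_addl.
rewrite -mulr_sumr; apply: le_trans (ler_wpM2l (mag_ge0 _) (sum_geo_fractions M0)) _.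
rewrite le_eqVlt; apply/orP; left; apply/eqP; ring.
Qed.

(** Translation by the even number [2 z] makes the change of the quadratic
    coefficient a multiple of [6 P`_3], the frequency approximated by rationals. *)
Lemma shifted_vsum (P : {poly R}) M n (z : nat) : (0 < M)%N -> (size P <= 4)%N ->
  (2 * z + n <= M)%N ->
  exists th, mag (wsum P n) <=
    4 * cell_total R M * mag (vsum M th (P`_2 - 6 * P`_3 * z%:R) P`_3).
Proof.
move=> M0 sP znM; pose w : R := (2 * z)%:R.
have PE x : P.[x] = P`_0 + P`_1 * x + P`_2 * x ^+ 2 + P`_3 * x ^+ 3.
  rewrite (horner_coef_wide _ sP) !big_ord_recl big_ord0 /= /bump /=.
  by rewrite expr0 expr1; ring.
have [t ht] := @completion (fun y => P.[y%:R - w]) M (2 * z) n M0 znM.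
exists (P`_1 - 2 * P`_2 * w + 3 * P`_3 * w ^+ 2 + t%:R / M%:R).
have -> : wsum P n = \sum_(2 * z <= y < 2 * z + n) e P.[y%:R - w].
  rewrite -{1}[(2 * z)%N]add0n big_addn addKn; apply: eq_bigr => i _.
  by rewrite natrD addrK.
apply: le_trans ht _; apply: ler_wpM2l.
  by rewrite mulr_ge0 // cell_total_ge0.
pose c0 := P`_0 - P`_1 * w + P`_2 * w ^+ 2 - P`_3 * w ^+ 3.
set V := vsum _ _ _ _; have -> : mag V = mag (e c0 * V) by rewrite magM mag_e mul1r.
rewrite /V /vsum mulr_sumr le_eqVlt; apply/orP; left; apply/eqP.
congr mag; apply: eq_bigr => y _; rewrite -eD; congr e.
have wz : w = 2 * z%:R by rewrite /w natrM.
by rewrite PE natrM /c0 wz; ring.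
Qed.

End Completion.

Section Energy.
Variable R : realType.

Definition level N := up_log 7 (3 * N).
(** A power of 7, so that [vinogradov_cubic] applies, large enough to contain the
    summation interval and its translates. *)
Definition padded N := (7 ^ level N)%N.

Lemma padded_bounds N : (0 < N)%N -> (3 * N <= padded N <= 21 * N)%N.
Proof.
move=> N0; have h : (1 < 3 * N)%N by lia.
have /andP[h1 h2] := up_log_bounds (isT : (1 < 7)%N) h.
rewrite /padded /level h2 /=; move: h1 h2; set l := up_log 7 _.
case: l => [|l] /=; first by rewrite expn0; lia.
by rewrite expnS; lia.
Qed.

Lemma small_root (n : nat) : exists2 s : R, 1 < s & s ^+ n <= 2.
Proof.
pose x : R := 2 ^- n; have x0 : 0 < x by rewrite invr_gt0 exprn_gt0.
have x1 : x <= 1 by rewrite invf_le1 ?exprn_gt0 // exprn_ege1 // ler1n.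
exists (1 + x); first by rewrite ltrDl.
have h m : (1 + x) ^+ m <= 1 + (2 ^+ m - 1) * x.
  elim: m => [|m IH]; first by rewrite !expr0 subrr mul0r addr0.
  rewrite exprS; apply: le_trans (_ : (1 + x) * (1 + (2 ^+ m - 1) * x) <= _).
    by apply: ler_wpM2l => //; lra.
  have m1 : 1 <= 2 ^+ m :> R by rewrite exprn_ege1 // ler1n.
  rewrite [2 ^+ m.+1]exprS; move: (2 ^+ m : R) m1 => y y1.
  have : 0 <= (y - 1) * (x * (1 - x)) by rewrite !mulr_ge0 //; lra.
  lra.
apply: le_trans (h n) _; have : 2 ^+ n * x = 1 by rewrite /x mulfV // expf_neq0 // pnatr_eq0.
lra.
Qed.

(** The prime 7 is fixed, so a factor [sg ^ (6 l)] with [sg] close to 1 is a small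
    power of [7 ^ l]. *)
Lemma slow_energy : slow (fun N => (energy (padded N))%:R / (padded N)%:R ^+ 6 : R).
Proof.
split=> [N|s]; first by rewrite divr_ge0 ?exprn_ge0 ?ler0n.
have [sg sg1 sgs] := small_root (6 * s).
have [C C0 hC] := @vinogradov_cubic R 7 isT isT sg sg1.
exists (C ^+ s * 21); first by rewrite mulr_ge0 // exprn_ge0 // ltW.
move=> N N0; have /andP[r1 r2] := padded_bounds N0.
have rp : 0 < (padded N)%:R :> R by rewrite ltr0n expn_gt0.
have sg0 : 0 <= sg by lra.
have h : (energy (padded N))%:R / (padded N)%:R ^+ 6 <= C * sg ^+ (6 * level N) :> R.
  rewrite ler_pdivrMr ?exprn_gt0 //; apply: le_trans (hC (level N)) _.
  rewrite /padded natrX -exprM mulnC le_eqVlt; apply/orP; left; apply/eqP; ring.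
apply: le_trans (_ : (C * sg ^+ (6 * level N)) ^+ s <= _).
  apply: lerXn2r; rewrite ?nnegrE //; first by rewrite divr_ge0 ?exprn_ge0 ?ler0n.
  by rewrite mulr_ge0 ?exprn_ge0 // ltW.
rewrite exprMn -mulrA; apply: ler_wpM2l; first by rewrite exprn_ge0 // ltW.
have -> : (sg ^+ (6 * level N)) ^+ s = (sg ^+ (6 * s)) ^+ level N.
  by rewrite -!exprM mulnAC.
apply: le_trans (_ : 7 ^+ level N <= _).
  apply: lerXn2r; rewrite ?nnegrE ?exprn_ge0 //; lra.
by rewrite -natrX -natrM ler_nat.
Qed.

End Energy.

Section MinorArcs.
Variable R : realType.

Lemma slow_cell_padded c m : (0 < m)%N -> (0 < c)%N ->
  slow (fun N => cell_total R (c * padded N ^ m)).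
Proof.
move=> m0 c0; apply: slow_mul; first exact: slow_const.
apply: slow_add; first exact: slow_const.
apply: (slow_comp (slow_harm R) m0 (c := c * 21 ^ m)) => N N0.
have /andP[_ r2] := padded_bounds N0.
by rewrite muln_gt0 c0 !expn_gt0 /= -mulnA -expnMn leq_mul2l leq_exp2r // r2 orbT.
Qed.

(** The spacing hypothesis concerns the frequencies [6 P`_3], the large sieve the
    coefficients [P`_3]. *)
Lemma fr_mul6 (x : R) : fr x < 1 / 6 -> fr (6 * x) = 6 * fr x.
Proof.
move=> h; apply: (@fr_uniq _ _ _ (6 * Num.floor x)).
  by rewrite {1}(fr_eqz x) rmorphM /=; ring.
by have := fr_ge0 x; lra.
Qed.

(** Every index occurs with [N] translates; the counting hypothesis bounds the
    number of indices near a given frequency, and [interval_count] the number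
    of translates near a given quadratic coefficient. *)
Lemma minor_twelfth_moment : exists2 G, slow G &
  forall (I : Type) (r : seq I) (Q : pred I) (P : I -> {poly R}) (n : I -> nat) (N : nat) (D : R),
  (0 < N)%N -> (forall i, n i <= N)%N -> (forall i, Q i -> size (P i) <= 4)%N ->
  (forall c, \sum_(i <- r) (fr (6 * (P i)`_3 - c) < (N ^ 3)%:R^-1)%R%:R <= D) ->
  (forall i, Q i -> exists (q : nat) (a : int), [/\ (N < q <= 4 * N ^ 2)%N, coprimez a q &
      `|q%:R * (6 * (P i)`_3) - a%:~R| <= (4 * N ^ 2)%:R^-1]) ->
  \sum_(i <- r | Q i) (mag (wsum (P i) (n i)) / N%:R) ^+ 12 <= G N * D / N%:R.
Proof.
pose G N : R := (4 * cell_total R (padded N)) ^+ 12 *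
  ((energy (padded N))%:R / (padded N)%:R ^+ 6) *
  (8 * 6 ^+ 3 * 21 ^+ 12 * (cell_total R (6 * padded N ^ 2) * cell_total R (6 * padded N ^ 3))).
exists G.
  apply: slow_mul.
    apply: slow_mul; last exact: slow_energy.
    apply: slow_exp; apply: slow_mul; first exact: slow_const.
    apply: slow_le (@slow_cell_padded 1 1 isT isT) _ _ => N; first exact: cell_total_ge0.
    by rewrite mul1n expn1.
  apply: slow_mul; first by apply: slow_const; rewrite !mulr_ge0.
  by apply: slow_mul; exact: slow_cell_padded.
move=> I r Q P n N D N0 nN sP hD hQ.
have Np : 0 < N%:R :> R by rewrite ltr0n.
have /andP[M1 M2] := padded_bounds N0; set M := padded N in M1 M2.
have M0 : (0 < M)%N by lia.
have Mp : 0 < M%:R :> R by rewrite ltr0n.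
have NM : (N <= M)%N by lia.
(* one linear coefficient for each index and each translate *)
have /choice [th hth] : forall iz : I * nat, exists th, Q iz.1 -> (iz.2 < N)%N ->
    mag (wsum (P iz.1) (n iz.1)) <= 4 * cell_total R M *
      mag (vsum M th ((P iz.1)`_2 - 6 * (P iz.1)`_3 * iz.2%:R) (P iz.1)`_3).
  case=> i z /=.
  have [Qi|Qi] := boolP (Q i); last by exists 0.
  have [zN|zN] := ltnP z N; last by exists 0.
  have znM : (2 * z + n i <= M)%N by have := nN i; lia.
  have [t ht] := shifted_vsum M0 (sP i Qi) znM.
  by exists t.
pose pairs := [seq (i, z) | i <- [seq i <- r | Q i], z <- iota 0 N].
have D0 : 0 <= D by apply: le_trans (hD 0); apply: sumr_ge0 => i _; exact: ler0n.
have hits c d : \sum_(iz <- pairs)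
    (fr ((P iz.1)`_3 - c) < (6 * M ^ 3)%:R^-1)%R%:R *
    (fr ((P iz.1)`_2 - 6 * (P iz.1)`_3 * iz.2%:R - d) < (6 * M ^ 2)%:R^-1)%R%:R <= 8 * D.
  rewrite /pairs big_allpairs big_filter /=.
  apply: le_trans (_ : \sum_(i <- r) 8 * (fr (6 * (P i)`_3 - 6 * c) < (N ^ 3)%:R^-1)%R%:R <= _); last first.
    by rewrite -mulr_sumr; apply: ler_wpM2l.
  rewrite big_mkcond /=; apply: ler_sum => i _.
  case: ifP => Qi; last by rewrite mulr_ge0 // ler0n.
  rewrite -mulr_sumr mulrC; apply: ler_pM; rewrite ?ler0n //.
  - by apply: sumr_ge0 => z _; exact: ler0n.
  - have [q [a [/andP[q1 q2] cop hb]]] := hQ i Qi.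
    have q0 : (0 < q)%N by lia.
    have qp : 0 < q%:R :> R by rewrite ltr0n.
    have N4 : 0 < (4 * N ^ 2)%:R :> R by rewrite ltr0n muln_gt0 expn_gt0 N0.
    have hbq : `|- (6 * (P i)`_3) - (- a)%:~R / q%:R| <= q%:R ^- 2.
      rewrite rmorphN mulNr -opprD normrN.
      have -> : 6 * (P i)`_3 + - (a%:~R / q%:R) = (q%:R * (6 * (P i)`_3) - a%:~R) * q%:R^-1.
        by field; rewrite gt_eqF.
      rewrite normrM (ger0_norm (_ : 0 <= q%:R^-1)); last by rewrite invr_ge0 ltW.
      rewrite exprSr expr1 invfM; apply: ler_wpM2r; first by rewrite invr_ge0 ltW.
      by apply: le_trans hb _; rewrite lef_pV2 ?posrE // ler_nat.
    have copN : coprimez (- a) q by rewrite coprimezE abszN -coprimezE.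
    have dl0 : 0 <= (6 * M ^ 2)%:R^-1 :> R by rewrite invr_ge0 ler0n.
    have := interval_count N (d - (P i)`_2) q0 copN hbq dl0.
    rewrite /index_iota subn0 => cnt.
    apply: le_trans (_ : (N%:R / q%:R + 1) * (q%:R * (6 * M ^ 2)%:R^-1 + 3) <= _).
      apply: le_trans cnt; rewrite le_eqVlt; apply/orP; left; apply/eqP.
      by apply: eq_bigr => z _; congr ((_ < _)%R%:R); congr fr; ring.
    have k1 : N%:R / q%:R <= 1 :> R by rewrite ler_pdivrMr // mul1r ler_nat ltnW.
    have k2 : q%:R * (6 * M ^ 2)%:R^-1 <= 1 :> R.
      rewrite ler_pdivrMr ?ltr0n ?muln_gt0 ?expn_gt0 ?M0 // mul1r ler_nat.
      by apply: leq_trans q2 _; apply: leq_mul => //; rewrite leq_exp2r.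
    have k3 : 0 <= q%:R * (6 * M ^ 2)%:R^-1 :> R by rewrite mulr_ge0 // ltW.
    have k4 : 0 <= N%:R / q%:R :> R by rewrite divr_ge0 // ltW.
    nra.
  rewrite ler_nat; case: (boolP (fr ((P i)`_3 - c) < _)) => // h.
  have M3 : 0 < (M ^ 3)%:R :> R by rewrite ltr0n expn_gt0 M0.
  have N3 : 0 < (N ^ 3)%:R :> R by rewrite ltr0n expn_gt0 N0.
  have i1 : (6 * M ^ 3)%:R^-1 = (M ^ 3)%:R^-1 / 6 :> R by rewrite natrM invfM mulrC.
  have i2 : (M ^ 3)%:R^-1 <= 1 :> R by rewrite invf_le1 // ler1n expn_gt0 M0.
  have i3 : (M ^ 3)%:R^-1 <= (N ^ 3)%:R^-1 :> R.
    by rewrite lef_pV2 ?posrE // ler_nat leq_exp2r.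
  rewrite i1 in h; rewrite -mulrBr fr_mul6; last by lra.
  by rewrite (_ : (_ < _) = true) //; apply/idP; lra.
have c0 := cell_total_ge0 R M.
have LS := @large_sieve R _ pairs th (fun iz => (P iz.1)`_2 - 6 * (P iz.1)`_3 * iz.2%:R)
   (fun iz => (P iz.1)`_3) M (8 * D) M0 hits.
have lower : N%:R * \sum_(i <- r | Q i) mag (wsum (P i) (n i)) ^+ 12 <=
   (4 * cell_total R M) ^+ 12 * \sum_(iz <- pairs)
     mag (vsum M (th iz) ((P iz.1)`_2 - 6 * (P iz.1)`_3 * iz.2%:R) (P iz.1)`_3) ^+ 12.
  rewrite /pairs big_allpairs big_filter /= !mulr_sumr; apply: ler_sum => i Qi.
  apply: le_trans (_ : \sum_(z <- iota 0 N) mag (wsum (P i) (n i)) ^+ 12 <= _).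
    by rewrite big_const_seq count_predT size_iota iter_addr_0 -[leRHS]mulr_natl.
  rewrite mulr_sumr !big_seq; apply: ler_sum => z; rewrite mem_iota add0n => /andP[_ zN].
  rewrite -exprMn; apply: lerXn2r; rewrite ?nnegrE ?mag_ge0 //.
    by rewrite mulr_ge0 ?mag_ge0 // mulr_ge0.
  exact: (hth (i, z) Qi zN).
have CT12 : 0 <= (4 * cell_total R M) ^+ 12 by rewrite exprn_ge0 // mulr_ge0.
have := le_trans lower (ler_wpM2l CT12 LS).
set S12 := \sum_(i <- r | Q i) _ => main.
have -> : \sum_(i <- r | Q i) (mag (wsum (P i) (n i)) / N%:R) ^+ 12 = S12 / N%:R ^+ 12.
  by rewrite mulr_suml; apply: eq_bigr => i _; rewrite expr_div_n.
rewrite ler_pdivrMr ?exprn_gt0 // mulrAC ler_pdivlMr // mulrC.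
apply: le_trans main _; rewrite /G -/M.
set E := (energy M)%:R; set CC := cell_total R (6 * M ^ 2) * _; set T := (4 * _) ^+ 12 in CT12 *.
have E0 : 0 <= E by exact: ler0n.
have CC0 : 0 <= CC by rewrite mulr_ge0 // cell_total_ge0.
have M12 : M%:R ^+ 12 <= 21 ^+ 12 * N%:R ^+ 12 :> R.
  rewrite -exprMn; apply: lerXn2r; rewrite ?nnegrE ?ler0n ?mulr_ge0 ?ler0n //.
  by rewrite -natrM ler_nat.
pose Z := T * (E / M%:R ^+ 6) * (8 * 6 ^+ 3 * CC) * D.
have Z0 : 0 <= Z.
  apply: mulr_ge0 => //; apply: mulr_ge0; last by rewrite mulr_ge0 // mulr_ge0 // exprn_ge0.
  by apply: mulr_ge0 => //; rewrite divr_ge0 // exprn_ge0 // ltW.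
have -> : T * (E * (8 * D * (6 ^+ 3 * M%:R ^+ 6 * CC))) = Z * M%:R ^+ 12.
  by rewrite /Z; field; rewrite gt_eqF.
apply: le_trans (ler_wpM2l Z0 M12) _.
rewrite /Z le_eqVlt; apply/orP; left; apply/eqP; ring.
Qed.

End MinorArcs.

(** * Assembly *)

Section Assembly.
Variable R : realType.

Lemma sum_multiples_le (F : nat -> R) c n : (0 < c)%N -> (forall m, 0 <= F m) ->
  \sum_(0 <= m < n) F (c * m)%N <= \sum_(0 <= m < n * c) F m.
Proof.
move=> c0 F0; rewrite sum_blocks; apply: ler_sum => l _.
rewrite (bigD1 (Ordinal c0)) //= addn0 mulnC lerDl.
exact: sumr_ge0.
Qed.

Definition monomial (k : nat) (alpha : R) : {poly R} := alpha *: ('X + 1%:P) ^+ k.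

Lemma weyl_sumE k (alpha X : R) :
  weyl_sum k alpha X = wsum (monomial k alpha) (Num.truncn X).
Proof.
rewrite /weyl_sum /wsum big_add1 /=; apply: eq_bigr => x _.
by rewrite /monomial !hornerE natr1.
Qed.

Lemma monomial_lead k (alpha : R) :
  (size (monomial k alpha) <= k.+1)%N /\ (monomial k alpha)`_k = alpha.
Proof.
have s : size (('X + 1%:P : {poly R}) ^+ k) = k.+1.
  have := size_exp_XsubC k (-1 : R); by rewrite polyCN opprK.
split; first by rewrite -s size_scale_leq.
have m : ('X + 1%:P : {poly R}) ^+ k \is monic.
  by rewrite rpredX // -[1%:P]opprK -polyCN monicXsubC.
by move/monicP: m; rewrite lead_coefE s /monomial coefZ /= => ->; rewrite mulr1.
Qed.

Definition freq k (alpha : R) (h : seq nat) : R := 6 * (diffs h (monomial k alpha))`_3.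

Lemma diffs_monomial k alpha N h : (3 <= k)%N -> h \in boxes N (k - 3) ->
  (size (diffs h (monomial k alpha)) <= 4)%N /\
  freq k alpha h = alpha * (k`! * bprod h)%:R.
Proof.
move=> k3 hb; have [s1 s2] := monomial_lead k alpha; have sh := boxes_size hb.
have := @diffs_lead R h (monomial k alpha) 3; rewrite sh subnK // => /(_ _) [|h1 h2].
  by apply: leq_trans s1 _; lia.
split=> //; rewrite /freq natrM -/(bprod h) in h2 *.
by move: h2; rewrite s2 (_ : 3`! = 6)%N // mulrC => ->; rewrite mulrC mulrA.
Qed.

(** The frequency depends on the product of the box only, and a product comes
    from few boxes; then [interval_count] applies to [alpha]. *)
Lemma frequency_count k : (6 <= k)%N -> exists2 T : nat -> R, slow T &
  forall (alpha : R) (a : int) (q N : nat) (c : R),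
  (0 < q)%N -> coprimez a q -> `|alpha - a%:~R / q%:R| <= q%:R ^- 2 -> (0 < N)%N ->
  \sum_(h <- boxes N (k - 3)) (fr (freq k alpha h - c) < (N ^ 3)%:R^-1)%R%:R <=
  T N * N%:R ^+ (k - 3) * Theta k q N%:R.
Proof.
move=> k6; have k3 : (3 <= k)%N by lia.
set r := (k - 3)%N; have r3 : (3 <= r)%N by rewrite /r; lia.
exists (fun N => (tau_max (N ^ r))%:R ^+ r * (12 * k`!%:R)).
  apply: slow_mul; last by apply: slow_const; rewrite mulr_ge0 // ler0n.
  apply: slow_exp; apply: (slow_comp (slow_tau R) (_ : 0 < r)%N (c := 1)); first by lia.
  by move=> N N0; rewrite mul1n expn_gt0 N0 leqnn.
move=> alpha a q N c q0 cop hal N0.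
have Np : 0 < N%:R :> R by rewrite ltr0n.
have qp : 0 < q%:R :> R by rewrite ltr0n.
have kf : (0 < k`!)%N by exact: fact_gt0.
have dl0 : 0 <= (N ^ 3)%:R^-1 :> R by rewrite invr_ge0 ler0n.
pose F (m : nat) : R := (fr (alpha * m%:R - c) < (N ^ 3)%:R^-1)%R%:R.
have F0 m : 0 <= F m by exact: ler0n.
have t0 : 0 <= (tau_max (N ^ r))%:R ^+ r :> R by rewrite exprn_ge0 // ler0n.
have -> : \sum_(h <- boxes N r) (fr (freq k alpha h - c) < (N ^ 3)%:R^-1)%R%:R =
   \sum_(h <- boxes N r) F (k`! * bprod h)%N.
  rewrite !big_seq; apply: eq_bigr => h hb.
  by have [_ ->] := diffs_monomial alpha k3 hb.
apply: le_trans (@sum_boxes_prod R N r (N ^ r) (tau_max (N ^ r)) (fun m => F (k`! * m)%N) _ _ _) _ => //.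
  by move=> m /andP[_]; exact: tau_le_max.
rewrite -!mulrA; apply: ler_wpM2l => //.
apply: le_trans (_ : \sum_(0 <= m < (N ^ r).+1) F (k`! * m)%N <= _).
  by rewrite [leRHS]big_ltn // lerDr.
apply: le_trans (sum_multiples_le _ kf F0) _.
apply: le_trans (interval_count _ c q0 cop hal dl0) _.
set f : R := k`!%:R; have f1 : 1 <= f by rewrite ler1n.
have Nr1 : 1 <= N%:R ^+ r :> R by rewrite exprn_ege1 // ler1n.
have M1 : ((N ^ r).+1 * k`!)%:R <= 2 * N%:R ^+ r * f.
  rewrite natrM -natr1 natrX; apply: ler_wpM2r; lra.
pose u : R := N%:R ^+ (r - 3); have u1 : 1 <= u by rewrite exprn_ege1 // ler1n.
have rE : N%:R ^+ r = u * N%:R ^+ 3 by rewrite /u -exprD subnK.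
have kE : N%:R ^+ k = u * N%:R ^+ 3 * N%:R ^+ 3 :> R.
  by rewrite -rE -exprD; congr (_ ^+ _); rewrite /r; lia.
set n3 : R := N%:R ^+ 3 in rE kE; have n3p : 0 < n3 by rewrite exprn_gt0.
have up : 0 < u by lra.
rewrite natrX -/n3 /Theta -/n3 kE rE.
have -> : 12 * (f * (u * n3 * (q%:R^-1 + n3^-1 + q%:R / (u * n3 * n3)))) =
   12 * f * (u * n3 / q%:R) + 12 * f * u + 12 * f * (q%:R / n3).
  by field; rewrite !gt_eqF.
apply: le_trans (_ : (2 * (u * n3) * f / q%:R + 1) * (q%:R / n3 + 3) <= _).
  apply: ler_wpM2r; first by rewrite addr_ge0 // divr_ge0 // ltW.
  rewrite lerD2r; apply: ler_wpM2r; first by rewrite invr_ge0 ltW.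
  by rewrite -rE.
have -> : (2 * (u * n3) * f / q%:R + 1) * (q%:R / n3 + 3) =
   2 * u * f + 6 * f * (u * n3 / q%:R) + q%:R / n3 + 3 by field; rewrite !gt_eqF.
have p1 : 0 <= u * n3 / q%:R by rewrite divr_ge0 ?mulr_ge0 // ltW.
have p2 : 0 <= q%:R / n3 by rewrite divr_ge0 // ltW.
have h1 : q%:R / n3 <= f * (q%:R / n3) by rewrite ler_peMl.
have h2 : 1 <= f * u by rewrite mulr_ege1.
have h3 : 0 <= f * (u * n3 / q%:R) by rewrite mulr_ge0 //; lra.
have h4 : 0 <= f * (q%:R / n3) by rewrite mulr_ge0 //; lra.
have -> : 2 * u * f = 2 * (f * u) by ring.
have -> : 6 * f * (u * n3 / q%:R) = 6 * (f * (u * n3 / q%:R)) by ring.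
have -> : 12 * f * (u * n3 / q%:R) = 12 * (f * (u * n3 / q%:R)) by ring.
have -> : 12 * f * u = 12 * (f * u) by ring.
have -> : 12 * f * (q%:R / n3) = 12 * (f * (q%:R / n3)) by ring.
lra.
Qed.

Lemma Theta_ge0 k q (X : R) : 0 <= X -> 0 <= Theta k q X.
Proof.
by move=> X0; rewrite !addr_ge0 // ?mulr_ge0 ?invr_ge0 ?exprn_ge0 ?ler0n.
Qed.

Lemma Theta_nat k q (N : nat) (X : R) : (3 <= k)%N -> (0 < N)%N -> X <= 2 * N%:R -> 1 <= X ->
  Theta k q N%:R <= 2 ^+ k * Theta k q X.
Proof.
move=> k3 N0 XN X1; have Np : 0 < N%:R :> R by rewrite ltr0n.
have Xp : 0 < X by lra.
have inv j : (j <= k)%N -> N%:R ^- j <= 2 ^+ k * X ^- j.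
  move=> jk; rewrite ler_pdivlMr ?exprn_gt0 // mulrC ler_pdivrMr ?exprn_gt0 //.
  apply: le_trans (_ : (2 * N%:R) ^+ j <= _).
    by apply: lerXn2r; rewrite ?nnegrE //; lra.
  rewrite exprMn; apply: ler_wpM2r; first by rewrite exprn_ge0 // ltW.
  by apply: ler_weXn2l => //; rewrite ler1n.
have q0 : 0 <= q%:R :> R by exact: ler0n.
have iq : 0 <= q%:R^-1 :> R by rewrite invr_ge0.
have k1 : 1 <= 2 ^+ k :> R by rewrite exprn_ege1 // ler1n.
rewrite /Theta !mulrDr; apply: lerD; first apply: lerD.
- by rewrite ler_peMl.
- exact: inv.
- by rewrite mulrCA; apply: ler_wpM2l => //; exact: inv.
Qed.

(** [A] and [B] are the averages over the major and the minor arcs; the power mean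
    inequality over the box passes from the eighth and twelfth moments to them. *)
Lemma differenced_bound k : (6 <= k)%N -> exists2 K : nat -> R, slow K &
  forall (X alpha : R) (a : int) (q N : nat),
  (0 < N)%N -> N%:R <= X -> X <= 2 * N%:R -> (0 < q)%N -> coprimez a q ->
  `|alpha - a%:~R / q%:R| <= q%:R ^- 2 ->
  exists A B : R, [/\ 0 <= A, 0 <= B, A ^+ 8 <= K N * Theta k q X,
    B ^+ 12 <= K N * (Theta k q X / X) &
    (mag (wsum (monomial k alpha) N) / N%:R) ^+ (2 ^ (k - 3)) <= K N * (N%:R^-1 + A + B)].
Proof.
move=> k6; have k3 : (3 <= k)%N by lia.
set r := (k - 3)%N; have [T sT hT] := frequency_count k6.
have [G sG hG] := major_arc_bound R.
have [H sH hH] := minor_twelfth_moment R.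
have [c c0 hc] := weyl_differencing R r.
have two_k : 0 <= 2 ^+ k :> R by exact: exprn_ge0.
pose K1 N := 8 * G N ^+ 2 * (harm R N * harm R N.+2) * (T N * 2 ^+ k).
pose K2 N := 2 * (H N * (T N * 2 ^+ k)).
have sT2 : slow (fun N => T N * 2 ^+ k) by apply: slow_mul => //; exact: slow_const.
have s1 : slow K1.
  apply: slow_mul => //; apply: slow_mul.
    by apply: slow_mul; [exact: slow_const|exact: slow_exp].
  apply: slow_mul; first exact: slow_harm.
  apply: (slow_comp (slow_harm R) (isT : (0 < 1)%N) (c := 3)) => N N0.
  by rewrite expn1; lia.
have s2 : slow K2 by apply: slow_mul; [exact: slow_const|exact: slow_mul].
exists (fun N => c + (K1 N + K2 N)).
  by apply: slow_add; [exact: slow_const|exact: slow_add].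
move=> X alpha a q N N0 NX XN q0 cop hal.
have Np : 0 < N%:R :> R by rewrite ltr0n.
have N1 : 1 <= N%:R :> R by rewrite ler1n.
have Xp : 0 < X by lra.
pose v h := mag (wsum (diffs h (monomial k alpha)) (residual_length N h)) / N%:R.
have v0 h : 0 <= v h by rewrite divr_ge0 ?mag_ge0 // ltW.
have Q0 : (0 < 4 * N ^ 2)%N by rewrite muln_gt0 expn_gt0 N0.
have /choice [qa hqa] : forall h, exists qa : nat * int,
    [/\ (0 < qa.1 <= 4 * N ^ 2)%N, coprimez qa.2 qa.1 &
      `|qa.1%:R * freq k alpha h - qa.2%:~R| <= (4 * N ^ 2)%:R^-1].
  move=> h; have [q' [a' h']] := dirichlet (freq k alpha h) Q0.
  by exists (q', a').
pose good h := (size (diffs h (monomial k alpha)) <= 4)%N.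
pose maj h := good h && ((qa h).1 <= N)%N.
pose mnr h := good h && (N < (qa h).1)%N.
pose th := Theta k q X.
pose D := T N * N%:R ^+ r * Theta k q N%:R.
have hD c' : \sum_(h <- boxes N r) (fr (freq k alpha h - c') < (N ^ 3)%:R^-1)%R%:R <= D.
  exact: (hT alpha a).
have T0 : 0 <= T N by exact: slow_ge0.
have th0 : 0 <= th by apply: Theta_ge0; exact: ltW.
have Nr : 0 < N%:R ^+ r :> R by rewrite exprn_gt0.
have DE : D <= N%:R ^+ r * (T N * 2 ^+ k * th).
  rewrite /D mulrAC mulrC; apply: ler_wpM2l; first exact: ltW.
  rewrite -mulrA; apply: ler_wpM2l => //.
  by apply: Theta_nat => //; lra.
have G0 : 0 <= G N by exact: slow_ge0.
have H0 : 0 <= H N by exact: slow_ge0.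
have majb : \sum_(h <- boxes N r | maj h) v h ^+ 8 <= 8 * G N ^+ 2 * D * (harm R N * harm R N.+2).
  apply: (major_eighth_moment (b := freq k alpha) (q := fun h => (qa h).1) (a := fun h => (qa h).2)) => //.
  move=> h /andP[gh qN]; have [/andP[q1 _] cq hq] := hqa h.
  split=> //; first by rewrite q1.
  by apply: hG => //; exact: residual_length_le.
have mnrb : \sum_(h <- boxes N r | mnr h) v h ^+ 12 <= H N * D / N%:R.
  apply: hH => //.
  - by move=> h; exact: residual_length_le.
  - by move=> h /andP[].
  - move=> h /andP[_ qN]; have [/andP[_ q2] cq hq] := hqa h.
    by exists (qa h).1, (qa h).2; split=> //; rewrite qN.
pose A := N%:R ^- r * \sum_(h <- boxes N r | maj h) v h.
pose B := N%:R ^- r * \sum_(h <- boxes N r | mnr h) v h.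
have Nr0 : 0 <= N%:R ^- r :> R by rewrite invr_ge0 ltW.
have pm m (Z : R) (Pr : pred (seq nat)) : 
    \sum_(h <- boxes N r | Pr h) v h ^+ m.+1 <= N%:R ^+ r * Z ->
    (N%:R ^- r * \sum_(h <- boxes N r | Pr h) v h) ^+ m.+1 <= Z.
  move=> hZ; rewrite exprMn.
  have p1 := power_mean (boxes N r) m (fun h _ => v0 h) (P := Pr).
  have vs : 0 <= \sum_(h <- boxes N r | Pr h) v h ^+ m.+1.
    by apply: sumr_ge0 => h _; exact: exprn_ge0.
  have p2 : (count Pr (boxes N r))%:R ^+ m <= (N%:R ^+ r) ^+ m :> R.
    apply: lerXn2r; rewrite ?nnegrE ?ler0n ?(ltW Nr) // -natrX ler_nat.
    by apply: leq_trans (count_size _ _) _; exact: size_boxes.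
  have p3 := le_trans p1 (ler_wpM2r vs p2).
  have nm : 0 <= (N%:R ^+ r) ^+ m :> R by rewrite exprn_ge0 // ltW.
  have p4 := le_trans p3 (ler_wpM2l nm hZ).
  rewrite exprVn ler_pdivrMl ?exprn_gt0 //; apply: le_trans p4 _.
  by rewrite mulrA -exprSr.
exists A, B.
have A0 : 0 <= A by rewrite mulr_ge0 // sumr_ge0.
have B0 : 0 <= B by rewrite mulr_ge0 // sumr_ge0.
have K10 : 0 <= K1 N by exact: slow_ge0.
have K20 : 0 <= K2 N by exact: slow_ge0.
have hh0 : 0 <= harm R N * harm R N.+2 by rewrite mulr_ge0 ?harm_ge0.
have G2 : 0 <= 8 * G N ^+ 2 by rewrite mulr_ge0 // exprn_ge0.
split=> //.
- apply: pm; apply: le_trans majb _.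
  apply: le_trans (_ : N%:R ^+ r * (K1 N * th) <= _).
    have -> : N%:R ^+ r * (K1 N * th) = 8 * G N ^+ 2 * (N%:R ^+ r * (T N * 2 ^+ k * th)) * (harm R N * harm R N.+2).
      by rewrite /K1; ring.
    by apply: ler_wpM2r => //; apply: ler_wpM2l.
  apply: ler_wpM2l; first exact: ltW.
  by apply: ler_wpM2r => //; lra.
- apply: pm; apply: le_trans mnrb _.
  have i1 : N%:R^-1 <= 2 / X by rewrite ler_pdivlMr // ler_pdivrMl // mulrC.
  have HD : H N * D <= H N * (N%:R ^+ r * (T N * 2 ^+ k * th)) by apply: ler_wpM2l.
  have HD0 : 0 <= H N * (N%:R ^+ r * (T N * 2 ^+ k * th)).
    by rewrite mulr_ge0 // mulr_ge0 ?(ltW Nr) // mulr_ge0 // mulr_ge0.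
  have iN0 : 0 <= N%:R^-1 :> R by rewrite invr_ge0 ltW.
  apply: le_trans (ler_wpM2r iN0 HD) _; apply: le_trans (ler_wpM2l HD0 i1) _.
  have -> : H N * (N%:R ^+ r * (T N * 2 ^+ k * th)) * (2 / X) = N%:R ^+ r * (K2 N * (th / X)).
    by rewrite /K2; ring.
  apply: ler_wpM2l; first exact: ltW.
  by apply: ler_wpM2r; [rewrite divr_ge0 // ltW|lra].
have := hc (monomial k alpha) N N N0 (leqnn N).
have -> : N%:R ^- r * \sum_(h <- boxes N r) mag (wsum (diffs h (monomial k alpha)) (residual_length N h)) / N%:R = A + B.
  rewrite /A /B -mulrDr; congr (_ * _); rewrite (bigID maj) /=; congr (_ + _).
  rewrite big_seq_cond [RHS]big_seq_cond; apply: eq_bigl => h.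
  case hb: (h \in boxes N r) => //=; have [gh _] := diffs_monomial alpha k3 hb.
  by rewrite /maj /mnr /good gh /= -ltnNge.
move=> h; apply: le_trans h _; rewrite addrA; apply: ler_wpM2r; last by lra.
by rewrite !addr_ge0 // invr_ge0 ltW.
Qed.

(** The choice [s >= 1 / eps] turns the power [s] in [slow] into a real exponent. *)
Lemma slow_powR (K : nat -> R) (eps : R) : slow K -> 0 < eps ->
  exists2 C, 0 < C & forall (N : nat) (X : R), (0 < N)%N -> N%:R <= X -> K N <= C * X `^ eps.
Proof.
move=> [K0 sK] eps0; pose s := (Num.truncn (eps^-1)).+1.
have [C C0 hC] := sK s; exists (C + 1); first by lra.
move=> N X N0 NX; have N1 : 1 <= N%:R :> R by rewrite ler1n.
have X1 : 1 <= X by lra.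
have sp : 0 < s%:R :> R by rewrite ltr0n.
have h1 : s%:R^-1 <= eps.
  have : eps^-1 < s%:R by exact: truncnS_gt.
  by move=> h; rewrite -[eps]invrK lef_pV2 ?posrE ?invr_gt0 // ltW.
apply: le_trans (_ : (C + 1) * X `^ (s%:R^-1) <= _); last first.
  by apply: ler_wpM2l; [lra|apply: ler_powR].
have Xs : (X `^ (s%:R^-1)) ^+ s = X.
  by rewrite -powR_mulrn ?powR_ge0 // -powRrM mulVf ?gt_eqF // powRr1 //; lra.
apply: (@ler_Xn_imp _ _ _ s.-1); first by rewrite mulr_ge0 ?powR_ge0 //; lra.
rewrite prednK // exprMn Xs; apply: le_trans (hC N N0) _.
apply: le_trans (_ : (C + 1) * X <= _); first by apply: ler_pM => //; lra.
by apply: ler_wpM2r; [lra|rewrite ler_eXnr //; lra].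
Qed.

Lemma root_bound (y K z : R) m : (0 < m)%N -> 0 <= y -> 1 <= K -> 0 <= z ->
  y ^+ m <= K * z -> y <= K * z `^ (m%:R^-1).
Proof.
move=> m0 y0 K1 z0 h; apply: (@ler_Xn_imp _ _ _ m.-1); first by rewrite mulr_ge0 ?powR_ge0 //; lra.
have zm : (z `^ (m%:R^-1)) ^+ m = z.
  by rewrite -powR_mulrn ?powR_ge0 // -powRrM mulVf ?powRr1 // pnatr_eq0 -lt0n.
rewrite prednK // exprMn zm; apply: le_trans h _; apply: ler_wpM2r => //.
by rewrite ler_eXnr.
Qed.

End Assembly.

Theorem theorem1p3 (R : realType) (k : nat) (hk : (6 <= k)%N)
    (eps : R) (heps : 0 < eps) :
  exists2 C : R, 0 < C &
    forall (X alpha : R) (a : int) (q : nat),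
      1 <= X -> (0 < q)%N -> coprimez a q%:Z ->
      `|alpha - a%:~R / q%:R| <= q%:R ^- 2 ->
      `|weyl_sum k alpha X| <=
        (C * (X `^ (1 + eps) * Theta k q X `^ (2 ^- k)
              + X `^ (1 + eps) * (Theta k q X / X) `^ (2 / 3 * 2 ^- k)))%:C.
Proof.
have [K sK hK] := differenced_bound R hk.
pose r := (k - 3)%N.
(* [256 = 2^8] pays for replacing [N^-8] by [X^-3], hence by [Theta] *)
pose K' N := 257 + K N.
have sK' : slow K' by apply: slow_add => //; exact: slow_const.
pose W N := 2 * (K N * (3 * K' N)) + 1.
have sW : slow W.
  apply: slow_add; last exact: slow_const.
  apply: slow_mul; first exact: slow_const.
  by apply: slow_mul => //; apply: slow_mul => //; exact: slow_const.
have [C C0 hC] := slow_powR sW heps.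
exists C => // X alpha a q X1 q0 cop hal.
have X0 : 0 < X by lra.
pose N := Num.truncn X.
have /andP[N1 N2] := truncn_itv (ltW X0); rewrite -/N -natr1 in N1 N2.
have N0 : (0 < N)%N by rewrite /N truncn_gt0.
have Np : 0 < N%:R :> R by rewrite ltr0n.
have N1' : 1 <= N%:R :> R by rewrite ler1n.
have XN : X <= 2 * N%:R by lra.
have [A [B [A0 B0 hA hB hU]]] := hK X alpha a q N N0 N1 XN q0 cop hal.
set th := Theta k q X in hA hB *.
set U := mag (wsum (monomial k alpha) N) / N%:R in hU.
have U0 : 0 <= U by rewrite divr_ge0 ?mag_ge0 // ltW.
have KN0 : 0 <= K N by exact: slow_ge0.
have th0 : 0 <= th by apply: Theta_ge0; exact: ltW.
have thX : X ^- 3 <= th.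
  rewrite /th /Theta; have : 0 <= q%:R^-1 :> R by rewrite invr_ge0 ler0n.
  have : 0 <= q%:R * X ^- k by rewrite mulr_ge0 ?ler0n // invr_ge0 exprn_ge0 // ltW.
  lra.
have K'1 : 1 <= K' N by rewrite /K'; lra.
have iN : N%:R^-1 ^+ 8 <= K' N * th.
  apply: le_trans (_ : 256 * X ^- 3 <= _); last by apply: ler_pM => //; rewrite /K' ?invr_ge0 ?exprn_ge0 ?(ltW X0) //; lra.
  have i1 : N%:R^-1 <= 2 / X by rewrite ler_pdivlMr // ler_pdivrMl // mulrC.
  apply: le_trans (_ : (2 / X) ^+ 8 <= _).
    by apply: lerXn2r; rewrite ?nnegrE ?invr_ge0 ?divr_ge0 // ltW.
  rewrite expr_div_n (_ : 2 ^+ 8 = 256); last by ring.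
  apply: ler_wpM2l => //; rewrite lef_pV2 ?posrE ?exprn_gt0 //.
  by apply: ler_weXn2l.
pose a1 := th `^ (8%:R^-1); pose b1 := (th / X) `^ (12%:R^-1).
have a10 : 0 <= a1 by exact: powR_ge0.
have b10 : 0 <= b1 by exact: powR_ge0.
have tX0 : 0 <= th / X by rewrite divr_ge0 // ltW.
have iN8 : N%:R^-1 <= K' N * a1.
  by apply: root_bound => //; rewrite invr_ge0 ltW.
have hA8 : A <= K' N * a1.
  apply: root_bound => //; apply: le_trans hA _; apply: ler_wpM2r => //.
  by rewrite /K'; lra.
have hB12 : B <= K' N * b1.
  apply: root_bound => //; apply: le_trans hB _; apply: ler_wpM2r => //.
  by rewrite /K'; lra.
(* the maximum, unlike the sum, commutes with the power [2^-r] *)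
pose ab := Num.max a1 b1.
have ab1 : a1 <= ab by rewrite le_max lexx.
have ab2 : b1 <= ab by rewrite le_max lexx orbT.
have W1 : 1 <= W N.
  by rewrite /W lerDr mulr_ge0 // mulr_ge0 // mulr_ge0 //; lra.
have UW : U ^+ (2 ^ r) <= W N * ab.
  apply: le_trans hU _; apply: le_trans (_ : K N * (3 * K' N * ab) <= _).
    apply: ler_wpM2l => //.
    have := ler_wpM2l (_ : 0 <= K' N) ab1; have := ler_wpM2l (_ : 0 <= K' N) ab2.
    move=> /(_ ltac:(lra)) h1 /(_ ltac:(lra)) h2; lra.
  rewrite mulrA; apply: ler_wpM2r; first exact: le_trans ab1.
  by rewrite /W; have := mulr_ge0 KN0 (_ : 0 <= 3 * K' N); move=> /(_ ltac:(lra)); lra.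
have r2 : (0 < 2 ^ r)%N by rewrite expn_gt0.
have UF : U <= W N * ab `^ ((2 ^ r)%:R^-1).
  by apply: root_bound => //; exact: le_trans ab1.
have kE : (2 ^ r)%:R^-1 = 8 * 2 ^- k :> R.
  have k3 : (3 <= k)%N by exact: leq_trans hk.
  have e2k : 2 ^+ k = 2 ^+ r * 2 ^+ 3 :> R by rewrite -exprD /r subnK.
  by rewrite natrX e2k; field; rewrite expf_neq0 // pnatr_eq0.
have e1 : a1 `^ ((2 ^ r)%:R^-1) = th `^ (2 ^- k).
  by rewrite /a1 -powRrM kE; congr (_ `^ _); field; rewrite expf_neq0 // pnatr_eq0.
have e2 : b1 `^ ((2 ^ r)%:R^-1) = (th / X) `^ (2 / 3 * 2 ^- k).
  by rewrite /b1 -powRrM kE; congr (_ `^ _); field; rewrite expf_neq0 // pnatr_eq0.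
have fin : ab `^ ((2 ^ r)%:R^-1) <= th `^ (2 ^- k) + (th / X) `^ (2 / 3 * 2 ^- k).
  rewrite -e1 -e2 /ab maxEle; case: ifP => _; [rewrite lerDr|rewrite lerDl]; exact: powR_ge0.
rewrite weyl_sumE -/N magE lecR -mulrDr.
have X1e : X `^ (1 + eps) = X * X `^ eps.
  rewrite powRD ?powRr1 ?(ltW X0) //; apply/implyP => _; exact: lt0r_neq0.
have -> : mag (wsum (monomial k alpha) N) = N%:R * U by rewrite /U mulrC divfK // gt_eqF.
rewrite X1e; apply: le_trans (_ : X * (C * X `^ eps * (th `^ (2 ^- k) + (th / X) `^ (2 / 3 * 2 ^- k))) <= _).
  apply: ler_pM => //.
  apply: le_trans UF _; apply: ler_pM fin; [exact: le_trans W1|exact: powR_ge0|exact: hC].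
by rewrite le_eqVlt; apply/orP; left; apply/eqP; ring.
Qed.
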